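(* Let $A$ and $B$ be finite essential square matrices with entries in $\mathbb{N}$, over $V$ and $W$ respectively. Suppose that $X(A)$ and $X(B)$ are aligned shift equivalent. Then $C^*(G_A)\otimes\mathbb{K}$ and $C^*(G_B)\otimes\mathbb{K}$ are equivariantly $*$-isomorphic.
   Context: $\mathbb{N}=\{0,1,2,\dots\}$. A matrix is essential if it has no zero row and no zero column. For a $V\times V$ matrix $A$ over $\mathbb{N}$, $E_A=\{(v,k,w): v,w\in V, 0\le k<A_{vw}\}$, $s(v,k,w)=v$, $r(v,k,w)=w$, and $G_A=(V,E_A,s,r)$ is the associated directed graph. $C^*(G_A)$ is the universal C*-algebra generated by mutually orthogonal projections $\{P_v\}_{v\in V}$ and partial isometries $\{S_e\}_{e\in E_A}$ with $S_e^*S_e=P_{r(e)}$ and $P_v=\sum_{s(e)=v}S_eS_e^*$; its gauge action of $\mathbb{T}$ is $\gamma_z(P_v)=P_v$, $\gamma_z(S_e)=zS_e$. $\mathbb{K}$ is the compact operators on a separable infinite-dimensional Hilbert space; $C^*(G_A)\otimes\mathbb{K}$ carries $\gamma\otimes\mathrm{id}$, and equivariance is with respect to these actions. For C*-algebras $\mathcal{A},\mathcal{B}$, an $\mathcal{A}-\mathcal{B}$ correspondence is a right Hilbert $\mathcal{B}$-module $X$ with a $*$-homomorphism $\phi_X:\mathcal{A}\to\mathcal{L}(X)$ into the adjointable operators, always assumed non-degenerate ($\phi_X(\mathcal{A})X=X$). A unitary correspondence isomorphism is an inner-product-preserving surjective bimodule map. Tensor products are interior tensor products, and associativity isomorphisms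 are suppressed. $c(V)$ is the C*-algebra of functions on $V$. $X(A)$ is the $c(V)-c(V)$ correspondence of functions $E_A\to\mathbb{C}$ with $(a\cdot\xi\cdot b)(e)=a(s(e))\xi(e)b(r(e))$ and $\langle\xi,\eta\rangle(w)=\sum_{r(e)=w}\overline{\xi(e)}\eta(e)$. Let $X$ be an $\mathcal{A}$-correspondence and $Y$ a $\mathcal{B}$-correspondence. A concrete shift between $X$ and $Y$ with lag $m\in\mathbb{N}\setminus\{0\}$ is a tuple $(M,N,\Phi_M,\Phi_N,\Psi_X,\Psi_Y)$ where $M$ is an $\mathcal{A}-\mathcal{B}$ correspondence, $N$ is a $\mathcal{B}-\mathcal{A}$ correspondence, and $\Phi_M:X\otimes_{\mathcal{A}}M\to M\otimes_{\mathcal{B}}Y$, $\Phi_N:Y\otimes_{\mathcal{B}}N\to N\otimes_{\mathcal{A}}X$, $\Psi_X:M\otimes_{\mathcal{B}}N\to X^{\otimes m}$, $\Psi_Y:N\otimes_{\mathcal{A}}M\to Y^{\otimes m}$ are unitary correspondence isomorphisms. It is aligned if $(\Psi_X\otimes\mathrm{id}_X)(\mathrm{id}_M\otimes\Phi_N)(\Phi_M\otimes\mathrm{id}_N)=\mathrm{id}_X\otimes\Psi_X$ and $(\Psi_Y\otimes\mathrm{id}_Y)(\mathrm{id}_N\otimes\Phi_M)(\Phi_N\otimes\mathrm{id}_M)=\mathrm{id}_Y\otimes\Psi_Y$. $X$ and $Y$ are aligned shift equivalent (aligned shift related) if there is an aligned concrete shift between them with some lag $m\ge 1$. *)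

(* Defs.v *)
From HB Require Import structures.
From mathcomp Require Import all_boot all_order all_algebra.
From mathcomp Require Import complex.
From mathcomp Require Import all_classical all_reals all_analysis.
From mathcomp Require Import ring lra.

Set Implicit Arguments.
Unset Strict Implicit.
Unset Printing Implicit Defensive.

Import Order.TTheory GRing.Theory Num.Theory.
Import numFieldNormedType.Exports.
Import Normc.

Local Open Scope classical_set_scope.
Local Open Scope complex_scope.
Local Open Scope ring_scope.

Section CStarAlgebras.
Variable R : realType.
Local Notation C := R[i].

Record cstar_algebra := CStarAlgebra {
  cstar_car :> completeNormedModType C;
  cmul : cstar_car -> cstar_car -> cstar_car;
  cadj : cstar_car -> cstar_car;
  cmulA : associative cmul;
  cmul_linearl : forall y, linear (cmul^~ y);
  cmul_linearr : forall x, linear (cmul x);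
  cadjK : involutive cadj;
  cadjD : {morph cadj : x y / x + y};
  cadjZ : forall (c : C) x, cadj (c *: x) = c^* *: cadj x;
  cadjM : forall x y, cadj (cmul x y) = cmul (cadj y) (cadj x);
  cmul_norm : forall x y, `|cmul x y| <= `|x| * `|y|;
  cstar_identity : forall x, `|cmul (cadj x) x| = `|x| ^+ 2
}.

Definition is_star_hom (A B : cstar_algebra) (f : A -> B) : Prop :=
  [/\ linear f, {morph f : x y / cmul x y >-> cmul x y}
    & {morph f : x / cadj x >-> cadj x}].

Definition lin_span (E : lmodType C) (S : set E) : set E :=
  [set v | exists n (c : 'I_n -> C) (u : 'I_n -> E),
     (forall i, S (u i)) /\ v = \sum_i c i *: u i].

Definition is_star_subalgebra (A : cstar_algebra) (S : set A) : Prop :=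
  [/\ S 0, forall (c : C) x y, S x -> S y -> S (c *: x + y),
      forall x y, S x -> S y -> S (cmul x y)
    & forall x, S x -> S (cadj x)].

Definition generates (A : cstar_algebra) (G : set A) : Prop :=
  forall S : set A, closed S -> is_star_subalgebra S -> G `<=` S -> S = setT.

(* Positivity of [inner x x] is written in the form [b^* b]; the topology is
   the one of the norm x |-> sqrt |<x, x>|, and the module is complete. *)
Record hilbert_module (B : cstar_algebra) := HilbertModule {
  hmod_car :> completeNormedModType C;
  ract : hmod_car -> B -> hmod_car;
  inner : hmod_car -> hmod_car -> B;
  ract_linearl : forall b, linear (ract^~ b);
  ract_linearr : forall x, linear (ract x);
  ractM : forall x b c, ract x (cmul b c) = ract (ract x b) c;
  inner_linear : forall x, linear (inner x);
  inner_ract : forall x y b, inner x (ract y b) = cmul (inner x y) b;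
  inner_adj : forall x y, cadj (inner x y) = inner y x;
  inner_pos : forall x, exists b, inner x x = cmul (cadj b) b;
  inner_norm : forall x, `|x| ^+ 2 = `|inner x x|
}.

(* [lact_adj] says that [lact a] is adjointable with adjoint [lact (cadj a)];
   in particular it commutes with the right action. *)
Record correspondence (A B : cstar_algebra) := Correspondence {
  corr_mod :> hilbert_module B;
  lact : A -> corr_mod -> corr_mod;
  lact_linearl : forall x, linear (lact^~ x);
  lact_linearr : forall a, linear (lact a);
  lactM : forall a b x, lact (cmul a b) x = lact a (lact b x);
  lact_adj : forall a x y, inner (lact a x) y = inner x (lact (cadj a) y);
  lact_nondegenerate : forall x, exists a y, x = lact a y
}.

Definition is_unitary (A B : cstar_algebra) (X Y : correspondence A B)
    (U : X -> Y) : Prop :=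
  [/\ linear U,
      forall a x, U (lact a x) = lact a (U x),
      forall x b, U (ract x b) = ract (U x) b,
      forall x y, inner (U x) (U y) = inner x y
    & forall y, exists x, U x = y].

(* Any model of the interior tensor product over B: these properties determine
   it up to a unique unitary isomorphism respecting [tens]. *)
Record interior_tensor (A B D : cstar_algebra)
    (X : correspondence A B) (Y : correspondence B D) := InteriorTensor {
  itens_corr :> correspondence A D;
  tens : X -> Y -> itens_corr;
  tens_linearl : forall y, linear (tens^~ y);
  tens_linearr : forall x, linear (tens x);
  tens_balanced : forall x b y, tens (ract x b) y = tens x (lact b y);
  tens_lact : forall a x y, lact a (tens x y) = tens (lact a x) y;
  tens_ract : forall x y d, ract (tens x y) d = tens x (ract y d);
  tens_inner : forall x y x' y',
    inner (tens x y) (tens x' y') = inner y (lact (inner x x') y');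
  tens_dense : dense (lin_span [set tens x y | x in setT & y in setT])
}.

Definition tensor_choice :=
  forall (A B D : cstar_algebra) (X : correspondence A B)
    (Y : correspondence B D), interior_tensor X Y.

End CStarAlgebras.

Arguments tensor_choice : clear implicits.
Arguments tens {R A B D X Y} i x y.

Section ShiftEquivalence.
Variables (R : realType) (T : tensor_choice R).
Local Notation "X '⊗' Y" := (T X Y) (at level 40, left associativity).
Local Notation "x '⊙' y" := (tens (T _ _) x y) (at level 40, left associativity).

(* [tensor_power X k] is the (k+1)-fold power of X. *)
Fixpoint tensor_power (A : cstar_algebra R) (X : correspondence A A) (k : nat)
    : correspondence A A :=
  if k is k'.+1 then tensor_power X k' ⊗ X else X.

Fixpoint elementary_tensor (A : cstar_algebra R) (X : correspondence A A)
    (k : nat) (x : nat -> X) : tensor_power X k :=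
  match k return tensor_power X k with
  | 0%N => x 0%N
  | k'.+1 => elementary_tensor k' x ⊙ x k'.+1
  end.

Definition is_tensor_map (A B D : cstar_algebra R)
    (X X' : correspondence A B) (Y Y' : correspondence B D)
    (F : X -> X') (G : Y -> Y') (H : X ⊗ Y -> X' ⊗ Y') : Prop :=
  is_unitary H /\ forall x y, H (x ⊙ y) = F x ⊙ G y.

Definition is_assoc (A B D E : cstar_algebra R) (X : correspondence A B)
    (Y : correspondence B D) (Z : correspondence D E)
    (a : (X ⊗ Y) ⊗ Z -> X ⊗ (Y ⊗ Z)) : Prop :=
  is_unitary a /\ forall x y z, a ((x ⊙ y) ⊙ z) = x ⊙ (y ⊙ z).

Definition is_assocV (A B D E : cstar_algebra R) (X : correspondence A B)
    (Y : correspondence B D) (Z : correspondence D E)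
    (a : X ⊗ (Y ⊗ Z) -> (X ⊗ Y) ⊗ Z) : Prop :=
  is_unitary a /\ forall x y z, a (x ⊙ (y ⊙ z)) = (x ⊙ y) ⊙ z.

(* The iterated associativity X ⊗ X^(k+1) = X^(k+1) ⊗ X. *)
Definition is_power_assoc (A : cstar_algebra R) (X : correspondence A A)
    (k : nat) (s : X ⊗ tensor_power X k -> tensor_power X k ⊗ X) : Prop :=
  is_unitary s /\
  forall x : nat -> X,
    s (x 0%N ⊙ elementary_tensor k (x \o succn)) = elementary_tensor k.+1 x.

(* A concrete shift of lag k+1. *)
Record concrete_shift (A B : cstar_algebra R) (X : correspondence A A)
    (Y : correspondence B B) (k : nat) := ConcreteShift {
  shift_M : correspondence A B;
  shift_N : correspondence B A;
  PhiM : X ⊗ shift_M -> shift_M ⊗ Y;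
  PhiN : Y ⊗ shift_N -> shift_N ⊗ X;
  PsiX : shift_M ⊗ shift_N -> tensor_power X k;
  PsiY : shift_N ⊗ shift_M -> tensor_power Y k;
  PhiM_unitary : is_unitary PhiM;
  PhiN_unitary : is_unitary PhiN;
  PsiX_unitary : is_unitary PsiX;
  PsiY_unitary : is_unitary PsiY
}.

(* (PsiX ⊗ id_X) (id_M ⊗ PhiN) (PhiM ⊗ id_N) = id_X ⊗ PsiX
   with the associativity isomorphisms written out:

   (X⊗M)⊗N --PhiM⊗id--> (M⊗Y)⊗N --> M⊗(Y⊗N) --id⊗PhiN--> M⊗(N⊗X)
       |                                                     |
       v                                                     v
   X⊗(M⊗N) --id⊗PsiX--> X⊗X^(k+1) --> X^(k+1)⊗X <--PsiX⊗id-- (M⊗N)⊗X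

   All the auxiliary maps exist and are determined by their values on
   elementary tensors. *)
Definition alignment (A B : cstar_algebra R) (X : correspondence A A)
    (Y : correspondence B B) (M : correspondence A B) (N : correspondence B A)
    (k : nat) (phiM : X ⊗ M -> M ⊗ Y) (phiN : Y ⊗ N -> N ⊗ X)
    (psi : M ⊗ N -> tensor_power X k) : Prop :=
  exists (phiM_id : (X ⊗ M) ⊗ N -> (M ⊗ Y) ⊗ N)
         (id_phiN : M ⊗ (Y ⊗ N) -> M ⊗ (N ⊗ X))
         (psi_id : (M ⊗ N) ⊗ X -> tensor_power X k ⊗ X)
         (id_psi : X ⊗ (M ⊗ N) -> X ⊗ tensor_power X k)
         (aMYN : (M ⊗ Y) ⊗ N -> M ⊗ (Y ⊗ N))
         (aMNX : M ⊗ (N ⊗ X) -> (M ⊗ N) ⊗ X)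
         (aXMN : (X ⊗ M) ⊗ N -> X ⊗ (M ⊗ N))
         (aX : X ⊗ tensor_power X k -> tensor_power X k ⊗ X),
  [/\ [/\ is_tensor_map phiM id phiM_id, is_tensor_map id phiN id_phiN,
          is_tensor_map psi id psi_id & is_tensor_map id psi id_psi],
      [/\ is_assoc aMYN, is_assocV aMNX, is_assoc aXMN & is_power_assoc aX]
    & psi_id \o aMNX \o id_phiN \o aMYN \o phiM_id
        =1 aX \o id_psi \o aXMN].

Definition aligned (A B : cstar_algebra R) (X : correspondence A A)
    (Y : correspondence B B) (k : nat) (s : concrete_shift X Y k) : Prop :=
  alignment (PhiM (c := s)) (PhiN (c := s)) (PsiX (c := s)) /\
  alignment (PhiN (c := s)) (PhiM (c := s)) (PsiY (c := s)).

End ShiftEquivalence.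

(* Interior tensor products exist and are unique up to unitary isomorphism, so
   that the notion does not depend on the choice T of a model for each of them. *)
Definition aligned_shift_equivalent (R : realType) (A B : cstar_algebra R)
    (X : correspondence A A) (Y : correspondence B B) : Prop :=
  exists (T : tensor_choice R) (k : nat) (s : concrete_shift T X Y k),
    aligned s.

(* Completeness of a normed space whose norm is comparable with a finite
   family of complex coordinates. *)
Lemma finite_coord_complete (R : realType) (E : normedModType R[i])
    (I : finType) (coord : I -> E -> R[i]) (build : (I -> R[i]) -> E)
    (coordB : forall i, {morph coord i : x y / x - y})
    (coordK : forall g i, coord i (build g) = g i)
    (coord_le : forall i x, `|coord i x| <= `|x|)
    (le_coord : forall x, `|x| <= \sum_i `|coord i x|)
    (F : set_system E) : ProperFilter F -> cauchy F -> cvg F.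
Proof.
move=> FF /cauchy_ballP Fc.
have RC (h : R[i] -> R) (hB : {morph h : x y / x - y})
    (hle : forall z, (`|h z|)%:C <= `|z|) i : cvg ((h \o coord i) @ F).
  apply/cauchy_cvgP/cauchy_ballP => e e0.
  have e0' : 0 < e%:C :> R[i] by rewrite ltcR.
  have := Fc _ e0'; rewrite -ball_normE => H.
  rewrite near_map2 /=; apply: filterS H => -[x y] /=.
  rewrite -ball_normE /= => xy; rewrite -ltcR -hB -coordB.
  exact: le_lt_trans (hle _) (le_lt_trans (coord_le _ _) xy).
have ReB : {morph (@complex.Re R) : x y / x - y} by case=> ? ? [].
have ImB : {morph (@complex.Im R) : x y / x - y} by case=> ? ? [].
have Imle (z : R[i]) : (`|complex.Im z|)%:C <= `|z|.
  have := normc_ge_Re (z * 'i%C); rewrite ReiNIm normrN normrM.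
  suff -> : `|('i%C : R[i])| = 1 by rewrite mulr1.
  by rewrite normc_def /= expr0n expr1n add0r sqrtr1.
have {}RC i : exists l : R[i], forall e : R, 0 < e ->
    \forall x \near F, `|coord i x - l| < e%:C.
  have /cvg_ex[a /= Ha] := RC _ ReB (@normc_ge_Re R) i.
  have /cvg_ex[b /= Hb] := RC _ ImB Imle i.
  exists (a +i* b) => e e0.
  have e2 : 0 < e / 2 by rewrite divr_gt0.
  move/cvgrPdist_lt : Ha => /(_ _ e2) Ha.
  move/cvgrPdist_lt : Hb => /(_ _ e2) Hb.
  near=> x.
  have -> : coord i x - (a +i* b) =
      (complex.Re (coord i x) - a)%:C + 'i%C * (complex.Im (coord i x) - b)%:C.
    by rewrite [LHS]complexE ReB ImB.
  rewrite (le_lt_trans (ler_normD _ _))//.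
  have -> : e%:C = (e / 2)%:C + (e / 2)%:C :> R[i].
    by rewrite -[RHS]raddfD /= -splitr.
  have ni : `|('i%C : R[i])| = 1.
    by rewrite normc_def /= expr0n expr1n add0r sqrtr1.
  have nr (r : R) : `|(r%:C : R[i])| = `|r|%:C.
    by rewrite normc_def /= expr0n addr0 sqrtr_sqr.
  rewrite normrM ni mul1r !nr ltrD// ltcR distrC.
    by near: x.
  by near: x.
have [l Hl] := choice RC.
apply/cvg_ex; exists (build l); apply/cvgrPdist_lt => e e0.
have ere : e = (complex.Re e)%:C by rewrite RRe_real// gtr0_real.
have e1 : 0 < complex.Re e by rewrite -ltcR -ere.
pose d := complex.Re e / (#|I|.+1)%:R.
have d0 : 0 < d by rewrite divr_gt0.
near=> x.
rewrite distrC (le_lt_trans (le_coord _))//.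
have Hx : forall i, `|coord i x - l i| < d%:C.
  near: x; apply: filter_forall => i; exact: Hl.
apply: (@le_lt_trans _ _ (\sum_(i : I) d%:C)).
  by apply: ler_sum => i _; rewrite coordB coordK ltW.
rewrite sumr_const -raddfMn /= [ltRHS]ere ltcR -mulr_natr.
rewrite /d -mulrA -[ltRHS]mulr1 ltr_pM2l// mulrC ltr_pdivrMr ?ltr0n//.
by rewrite mul1r ltr_nat.
Unshelve. all: by end_near. Qed.

Section FiniteSup.
Variables (R : realType) (V : finType).
Implicit Types h : V -> R.

Definition sup_fin h : R := \big[Num.max/0]_v h v.

Lemma sup_fin_ge0 h : 0 <= sup_fin h.
Proof. exact: bigmax_ge_id. Qed.

Lemma le_sup_fin h v : h v <= sup_fin h.
Proof. exact: le_bigmax. Qed.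

Lemma sup_fin_le h m : 0 <= m -> (forall v, h v <= m) -> sup_fin h <= m.
Proof. by move=> m0 hm; apply: bigmax_le. Qed.

Lemma sup_fin_mono (phi : R -> R) h : phi 0 = 0 ->
  (forall x y, 0 <= x -> x <= y -> phi x <= phi y) -> (forall v, 0 <= h v) ->
  sup_fin (phi \o h) = phi (sup_fin h).
Proof.
move=> phi0 phile h0; apply/eqP; rewrite eq_le; apply/andP; split.
  apply: sup_fin_le => [|v]; first by rewrite -[leLHS]phi0 phile ?sup_fin_ge0.
  by rewrite /= phile ?le_sup_fin.
have /bigmax_geP := lexx (sup_fin h); rewrite -/(sup_fin h).
move=> [le0|[v _ hv]].
  rewrite (_ : sup_fin h = 0) ?phi0 ?sup_fin_ge0//.
  by apply/eqP; rewrite eq_le le0 sup_fin_ge0.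
by rewrite (le_trans (phile _ _ (sup_fin_ge0 _) hv))// (@le_sup_fin (phi \o h)).
Qed.

Lemma sup_finD h1 h2 : (forall v, 0 <= h1 v) -> (forall v, 0 <= h2 v) ->
  sup_fin (fun v => h1 v + h2 v) <= sup_fin h1 + sup_fin h2.
Proof.
move=> h10 h20; apply: sup_fin_le => [|v]; first by rewrite addr_ge0 ?sup_fin_ge0.
by rewrite lerD ?le_sup_fin.
Qed.

Lemma le_sup_fin2 h1 h2 : (forall v, h1 v <= h2 v) -> sup_fin h1 <= sup_fin h2.
Proof.
move=> h12; apply: sup_fin_le => [|v]; first exact: sup_fin_ge0.
exact: le_trans (h12 v) (le_sup_fin _ _).
Qed.

Lemma sup_fin_eq0 h v : (forall v, 0 <= h v) -> sup_fin h = 0 -> h v = 0.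
Proof. by move=> h0 hs; apply/eqP; rewrite eq_le h0 andbT -hs le_sup_fin. Qed.

End FiniteSup.

Lemma normc_ge0 (R : rcfType) (z : R[i]) : 0 <= normc z.
Proof. by case: z => a b; rewrite sqrtr_ge0. Qed.

Lemma normcD_le (R : rcfType) (x y : R[i]) : normc (x + y) <= normc x + normc y.
Proof. exact: le_normcD. Qed.

Lemma normcJ_eq (R : rcfType) (x : R[i]) : normc x^* = normc x.
Proof. by case: x => a b /=; rewrite sqrrN. Qed.

Section EuclideanNorm.
Variables (R : realType) (I : finType) (P : pred I).
Implicit Types a b : I -> R.

Definition euclid a : R := Num.sqrt (\sum_(i | P i) a i ^+ 2).

Lemma euclid_sqr a : euclid a ^+ 2 = \sum_(i | P i) a i ^+ 2.
Proof. by rewrite sqr_sqrtr// sumr_ge0// => i _; exact: sqr_ge0. Qed.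

Lemma euclid_dot a b : \sum_(i | P i) a i * b i <= euclid a * euclid b.
Proof.
set S := \sum_(i | P i) a i ^+ 2; set T := \sum_(i | P i) b i ^+ 2.
set D := \sum_(i | P i) a i * b i.
have T0 : 0 <= T by apply: sumr_ge0 => i _; exact: sqr_ge0.
have S0 : 0 <= S by apply: sumr_ge0 => i _; exact: sqr_ge0.
have [T00|TN0] := eqVneq T 0.
  have b0 i : P i -> b i = 0.
    move=> Pi; apply/eqP; rewrite -sqrf_eq0.
    move: T00 => /eqP; rewrite psumr_eq0; last by move=> *; exact: sqr_ge0.
    by move=> /allP /(_ i (mem_index_enum _)); rewrite Pi.
  rewrite /D big1; last by move=> i Pi; rewrite b0// mulr0.
  by rewrite mulr_ge0// sqrtr_ge0.
have Tp : 0 < T by rewrite lt_neqAle eq_sym TN0.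
rewrite /euclid -/S -/T -sqrtrM// (le_trans (ler_norm _))// -sqrtr_sqr.
rewrite ler_wsqrtr//.
have : 0 <= \sum_(i | P i) (T * a i - D * b i) ^+ 2.
  by apply: sumr_ge0 => i _; exact: sqr_ge0.
have -> : \sum_(i | P i) (T * a i - D * b i) ^+ 2 = T * (S * T - D ^+ 2).
  transitivity (\sum_(i | P i) (T ^+ 2 * a i ^+ 2 - T * D *+ 2 * (a i * b i)
                               + D ^+ 2 * b i ^+ 2)).
    by apply: eq_bigr => i _; ring.
  by rewrite big_split sumrB /= -!mulr_sumr -/S -/T -/D; ring.
by rewrite pmulr_rge0// subr_ge0.
Qed.

Lemma euclidD a b : euclid (fun i => a i + b i) <= euclid a + euclid b.
Proof.
have e0 c : 0 <= euclid c by exact: sqrtr_ge0.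
rewrite -(@ler_pXn2r _ 2)// ?nnegrE ?addr_ge0//.
rewrite sqrrD !euclid_sqr -mulr_natl.
under eq_bigr do rewrite sqrrD -mulr_natl.
rewrite big_split/= big_split/= lerD2r lerD2l -mulr_sumr ler_wpM2l//.
exact: euclid_dot.
Qed.

Lemma euclid_le a b : (forall i, 0 <= a i) -> (forall i, a i <= b i) ->
  euclid a <= euclid b.
Proof.
move=> a0 ab; rewrite ler_wsqrtr// ler_sum// => i _.
by rewrite ler_pXn2r// nnegrE (le_trans (a0 i)).
Qed.

Lemma euclidZ (c : R) a : 0 <= c -> euclid (fun i => c * a i) = c * euclid a.
Proof.
move=> c0; rewrite /euclid; under eq_bigr do rewrite exprMn.
by rewrite -mulr_sumr sqrtrM ?sqr_ge0// sqrtr_sqr ger0_norm.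
Qed.

Lemma le_euclid a i : P i -> 0 <= a i -> a i <= euclid a.
Proof.
move=> Pi a0; rewrite -[leLHS](ger0_norm a0) -sqrtr_sqr ler_wsqrtr//.
by rewrite (bigD1 i)//= lerDl sumr_ge0// => j _; exact: sqr_ge0.
Qed.

Lemma euclid_le_sum a : (forall i, 0 <= a i) -> euclid a <= \sum_(i | P i) a i.
Proof.
move=> a0; set s := (leRHS).
have s0 : 0 <= s by rewrite sumr_ge0.
rewrite -[leRHS](ger0_norm s0) -sqrtr_sqr ler_wsqrtr//.
rewrite expr2 {1}/s mulr_suml ler_sum// => i Pi; rewrite expr2 ler_wpM2l//.
by rewrite /s (bigD1 i)//= lerDl sumr_ge0.
Qed.

End EuclideanNorm.

Section FunctionAlgebra.
Variables (R : realType) (V : finType).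
Local Notation C := R[i].

(* c(V), with the supremum norm. *)
Definition cfun := {ffun V -> C}.
HB.instance Definition _ := GRing.Lmodule.on cfun.
Implicit Types f g : cfun.

Definition cfun_norm f : C := (sup_fin (fun v => normc (f v)))%:C.

Lemma cfun_normD f g : cfun_norm (f + g) <= cfun_norm f + cfun_norm g.
Proof.
rewrite /cfun_norm -rmorphD lecR.
apply: le_trans (sup_finD _ _); try by move=> v; exact: normc_ge0.
by apply: le_sup_fin2 => v; rewrite ffunE normcD_le.
Qed.

Lemma cfun_normZ (c : C) f : cfun_norm (c *: f) = `|c| * cfun_norm f.
Proof.
rewrite -[`|c|]/(normc c)%:C /cfun_norm -rmorphM; congr (_%:C).
rewrite -(sup_fin_mono (phi := fun t : R => normc c * t)) ?mulr0//.
- by apply: eq_bigr => v _; rewrite ffunE /= normcM.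
- by move=> x y x0 xy; rewrite ler_wpM2l ?normc_ge0.
- by move=> v; exact: normc_ge0.
Qed.

Lemma cfun_norm_eq0 f : cfun_norm f = 0 -> f = 0.
Proof.
move=> /(congr1 (@complex.Re R)) /= f0; apply/ffunP => v; rewrite ffunE.
apply: eq0_normc; apply: (sup_fin_eq0 (h := fun v => normc (f v))) => // w.
exact: normc_ge0.
Qed.

HB.instance Definition _ :=
  Lmodule_isNormed.Build C cfun cfun_normD cfun_normZ cfun_norm_eq0.

Lemma cfun_normE f : `|f| = (sup_fin (fun v => normc (f v)))%:C.
Proof. by []. Qed.

Lemma cfun_complete (F : set_system cfun) : ProperFilter F -> cauchy F -> cvg F.
Proof.
pose co v (f : cfun) := f v; pose bu (g : V -> C) : cfun := [ffun v => g v].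
apply: (@finite_coord_complete R cfun V co bu).
- by move=> v f g; rewrite /co !ffunE.
- by move=> g v; rewrite /co ffunE.
- move=> v f; rewrite cfun_normE lecR.
  exact: (le_sup_fin (fun v => normc (f v))).
- move=> f; rewrite cfun_normE -[leRHS](rmorph_sum (real_complex R)) lecR.
  apply: sup_fin_le => [|v]; first by rewrite sumr_ge0// => v _; exact: normc_ge0.
  by rewrite (bigD1 v)//= lerDl sumr_ge0// => w _; exact: normc_ge0.
Qed.

HB.instance Definition _ := Uniform_isComplete.Build cfun cfun_complete.

Definition cfun_mul f g : cfun := [ffun v => f v * g v].
Definition cfun_adj f : cfun := [ffun v => (f v)^*].

Lemma cfun_mulA : associative cfun_mul.
Proof. by move=> f g h; apply/ffunP => v; rewrite !ffunE mulrA. Qed.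

Lemma cfun_mul_linearl g : linear (cfun_mul^~ g).
Proof.
by move=> c f h; apply/ffunP => v; rewrite !ffunE mulrDl -scalerAl.
Qed.

Lemma cfun_mul_linearr f : linear (cfun_mul f).
Proof.
by move=> c g h; apply/ffunP => v; rewrite !ffunE mulrDr; congr (_ + _); exact: mulrCA.
Qed.

Lemma cfun_adjK : involutive cfun_adj.
Proof. by move=> f; apply/ffunP => v; rewrite !ffunE conjCK. Qed.

Lemma cfun_adjD : {morph cfun_adj : f g / f + g}.
Proof. by move=> f g; apply/ffunP => v; rewrite !ffunE rmorphD. Qed.

Lemma cfun_adjZ (c : C) f : cfun_adj (c *: f) = c^* *: cfun_adj f.
Proof. by apply/ffunP => v; rewrite !ffunE rmorphM. Qed.

Lemma cfun_adjM f g : cfun_adj (cfun_mul f g) = cfun_mul (cfun_adj g) (cfun_adj f).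
Proof. by apply/ffunP => v; rewrite !ffunE rmorphM mulrC. Qed.

Lemma cfun_mul_norm f g : `|cfun_mul f g| <= `|f| * `|g|.
Proof.
rewrite !cfun_normE -rmorphM lecR; apply: sup_fin_le => [|v].
  by rewrite mulr_ge0 ?sup_fin_ge0.
rewrite ffunE normcM ler_pM ?normc_ge0//.
- exact: (le_sup_fin (fun v => normc (f v))).
- exact: (le_sup_fin (fun v => normc (g v))).
Qed.

Lemma cfun_cstar_identity f : `|cfun_mul (cfun_adj f) f| = `|f| ^+ 2.
Proof.
rewrite !cfun_normE -rmorphXn; congr (_%:C).
rewrite -(sup_fin_mono (phi := fun t : R => t ^+ 2)) ?expr0n//.
- by apply: eq_bigr => v _; rewrite !ffunE normcM normcJ_eq.
- by move=> a b a0 ab; rewrite ler_pXn2r// nnegrE (le_trans a0).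
- by move=> v; exact: normc_ge0.
Qed.

Definition cfun_algebra : cstar_algebra R :=
  @CStarAlgebra R cfun cfun_mul cfun_adj cfun_mulA cfun_mul_linearl
    cfun_mul_linearr cfun_adjK cfun_adjD cfun_adjZ cfun_adjM cfun_mul_norm
    cfun_cstar_identity.

End FunctionAlgebra.

Definition essential (V : finType) (A : V -> V -> nat) : Prop :=
  (forall v, exists w, A v w != 0%N) /\ (forall w, exists v, A v w != 0%N).

Section GraphCorrespondence.
Variables (R : realType) (V : finType) (A : V -> V -> nat).
Local Notation C := R[i].

(* The edge (v, k, w) is the pair of (v, w) and of k < A v w. *)
Definition edge := {p : V * V & 'I_(A p.1 p.2)}.
HB.instance Definition _ := Finite.on edge.
Definition edge_source (e : edge) : V := (tag e).1.
Definition edge_range (e : edge) : V := (tag e).2.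

(* X(A), with its Hilbert module norm. *)
Definition edge_fun := {ffun edge -> C}.
HB.instance Definition _ := GRing.Lmodule.on edge_fun.
Implicit Types x y : edge_fun.

Definition edge_euclid (w : V) x : R :=
  euclid (fun e => edge_range e == w) (fun e => normc (x e)).

Definition edge_fun_norm x : C := (sup_fin (fun w => edge_euclid w x))%:C.

Lemma edge_euclid_ge0 w x : 0 <= edge_euclid w x.
Proof. exact: sqrtr_ge0. Qed.

Lemma edge_fun_normD x y :
  edge_fun_norm (x + y) <= edge_fun_norm x + edge_fun_norm y.
Proof.
rewrite /edge_fun_norm -rmorphD lecR.
apply: le_trans (sup_finD _ _); try by move=> w; exact: edge_euclid_ge0.
apply: le_sup_fin2 => w; apply: le_trans (euclidD _ (fun e => normc (x e)) (fun e => normc (y e))).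
apply: euclid_le => e; first exact: normc_ge0.
by rewrite ffunE normcD_le.
Qed.

Lemma edge_fun_normZ (c : C) x : edge_fun_norm (c *: x) = `|c| * edge_fun_norm x.
Proof.
rewrite -[`|c|]/(normc c)%:C /edge_fun_norm -rmorphM; congr (_%:C).
rewrite -(sup_fin_mono (phi := fun t : R => normc c * t)) ?mulr0//.
- apply: eq_bigr => w _; rewrite /= -euclidZ ?normc_ge0//.
  by congr Num.sqrt; apply: eq_bigr => e _; rewrite ffunE /= normcM.
- by move=> a b a0 ab; rewrite ler_wpM2l ?normc_ge0.
- by move=> w; exact: edge_euclid_ge0.
Qed.

Lemma normc_le_edge_fun_norm x e : normc (x e) <= sup_fin (edge_euclid^~ x).
Proof.
apply: le_trans (le_sup_fin _ (edge_range e)).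
by apply: (le_euclid (a := fun e => normc (x e))) => //; exact: normc_ge0.
Qed.

Lemma edge_fun_norm_eq0 x : edge_fun_norm x = 0 -> x = 0.
Proof.
move=> /(congr1 (@complex.Re R)) /= x0; apply/ffunP => e; rewrite ffunE.
apply: eq0_normc; apply/eqP; rewrite eq_le normc_ge0 andbT -x0.
exact: normc_le_edge_fun_norm.
Qed.

HB.instance Definition _ := Lmodule_isNormed.Build C edge_fun
  edge_fun_normD edge_fun_normZ edge_fun_norm_eq0.

Lemma edge_fun_normE x : `|x| = (sup_fin (fun w => edge_euclid w x))%:C.
Proof. by []. Qed.

Lemma edge_fun_complete (F : set_system edge_fun) :
  ProperFilter F -> cauchy F -> cvg F.
Proof.
pose co e (x : edge_fun) := x e.
pose bu (g : edge -> C) : edge_fun := [ffun e => g e].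
apply: (@finite_coord_complete R edge_fun edge co bu).
- by move=> e x y; rewrite /co !ffunE.
- by move=> g e; rewrite /co ffunE.
- by move=> e x; rewrite edge_fun_normE lecR normc_le_edge_fun_norm.
- move=> x; rewrite edge_fun_normE -[leRHS](rmorph_sum (real_complex R)) lecR.
  have n0 e : 0 <= normc (x e) by exact: normc_ge0.
  apply: sup_fin_le => [|w]; first by apply: sumr_ge0 => e _; exact: n0.
  apply: le_trans (euclid_le_sum _ n0) _.
  rewrite [leRHS](bigID (fun e => edge_range e == w))/= lerDl.
  by apply: sumr_ge0 => e _; exact: n0.
Qed.

HB.instance Definition _ := Uniform_isComplete.Build edge_fun edge_fun_complete.

Definition edge_inner x y : cfun R V :=
  [ffun w => \sum_(e | edge_range e == w) (x e)^* * y e].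
Definition edge_ract x (b : cfun R V) : edge_fun :=
  [ffun e => x e * b (edge_range e)].
Definition edge_lact (a : cfun R V) x : edge_fun :=
  [ffun e => a (edge_source e) * x e].

Lemma conjM_normc (z : C) : z^* * z = (normc z ^+ 2)%:C.
Proof. by rewrite rmorphXn mulrC; exact: esym (sqr_normc z). Qed.

Lemma edge_innerxx x w : edge_inner x x w = (edge_euclid w x ^+ 2)%:C.
Proof.
rewrite ffunE euclid_sqr rmorph_sum; apply: eq_bigr => e _.
exact: conjM_normc.
Qed.

Lemma edge_ract_linearl b : linear (edge_ract^~ b).
Proof.
by move=> c x y; apply/ffunP => e; rewrite !ffunE mulrDl -scalerAl.
Qed.

Lemma edge_ract_linearr x : linear (edge_ract x).
Proof.
by move=> c a b; apply/ffunP => e; rewrite !ffunE mulrDr; congr (_ + _); exact: mulrCA.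
Qed.

Lemma edge_ractM x b c :
  edge_ract x (cfun_mul b c) = edge_ract (edge_ract x b) c.
Proof. by apply/ffunP => e; rewrite !ffunE mulrA. Qed.

Lemma edge_inner_linear x : linear (edge_inner x).
Proof.
move=> c y z; apply/ffunP => w; rewrite !ffunE scaler_sumr -big_split/=.
by apply: eq_bigr => e _; rewrite !ffunE mulrDr; congr (_ + _); exact: mulrCA.
Qed.

Lemma edge_inner_ract x y b :
  edge_inner x (edge_ract y b) = cfun_mul (edge_inner x y) b.
Proof.
apply/ffunP => w; rewrite !ffunE mulr_suml.
by apply: eq_bigr => e /eqP <-; rewrite !ffunE mulrA.
Qed.

Lemma edge_inner_adj x y : cfun_adj (edge_inner x y) = edge_inner y x.
Proof.
apply/ffunP => w; rewrite !ffunE rmorph_sum.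
by apply: eq_bigr => e _; rewrite rmorphM /= conjCK mulrC.
Qed.

Lemma edge_inner_pos x : exists b, edge_inner x x = cfun_mul (cfun_adj b) b.
Proof.
exists [ffun w => (edge_euclid w x)%:C]; apply/ffunP => w.
rewrite edge_innerxx !ffunE conjM_normc /= expr0n /= addr0 sqrtr_sqr.
by rewrite ger0_norm ?edge_euclid_ge0.
Qed.

Lemma edge_inner_norm x : `|x| ^+ 2 = `|edge_inner x x|.
Proof.
rewrite edge_fun_normE cfun_normE -rmorphXn; congr (_%:C).
rewrite -(sup_fin_mono (phi := fun t : R => t ^+ 2)) ?expr0n//.
- apply: eq_bigr => w _; rewrite edge_innerxx /= expr0n /= addr0 sqrtr_sqr.
  by rewrite ger0_norm ?sqr_ge0.
- by move=> a b a0 ab; rewrite ler_pXn2r// nnegrE (le_trans a0).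
- by move=> w; exact: edge_euclid_ge0.
Qed.

Definition graph_hilbert_module : hilbert_module (cfun_algebra R V) :=
  @HilbertModule R (cfun_algebra R V) edge_fun edge_ract edge_inner
    edge_ract_linearl edge_ract_linearr edge_ractM edge_inner_linear
    edge_inner_ract edge_inner_adj edge_inner_pos edge_inner_norm.

Lemma edge_lact_linearl x : linear (edge_lact^~ x).
Proof.
by move=> c a b; apply/ffunP => e; rewrite !ffunE mulrDl -scalerAl.
Qed.

Lemma edge_lact_linearr a : linear (edge_lact a).
Proof.
by move=> c x y; apply/ffunP => e; rewrite !ffunE mulrDr; congr (_ + _); exact: mulrCA.
Qed.

Lemma edge_lactM a b x :
  edge_lact (cfun_mul a b) x = edge_lact a (edge_lact b x).
Proof. by apply/ffunP => e; rewrite !ffunE mulrA. Qed.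

Lemma edge_lact_adj a x y :
  edge_inner (edge_lact a x) y = edge_inner x (edge_lact (cfun_adj a) y).
Proof.
apply/ffunP => w; rewrite !ffunE; apply: eq_bigr => e _.
by rewrite !ffunE rmorphM /= -mulrA mulrCA mulrA.
Qed.

Lemma edge_lact_nondegenerate x : exists a y, x = edge_lact a y.
Proof.
by exists [ffun=> 1], x; apply/ffunP => e; rewrite !ffunE mul1r.
Qed.

Definition graph_correspondence :
    correspondence (cfun_algebra R V) (cfun_algebra R V) :=
  @Correspondence R (cfun_algebra R V) (cfun_algebra R V) graph_hilbert_module
    edge_lact edge_lact_linearl edge_lact_linearr edge_lactM edge_lact_adj
    edge_lact_nondegenerate.

End GraphCorrespondence.

Section GraphAlgebra.
Variables (R : realType) (V : finType) (A : V -> V -> nat).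
Local Notation C := R[i].

Definition is_graph_family (D : cstar_algebra R) (P : V -> D) (S : edge A -> D)
    : Prop :=
  [/\ forall v, cmul (P v) (P v) = P v /\ cadj (P v) = P v,
      forall v w, v != w -> cmul (P v) (P w) = 0,
      forall e, cmul (cmul (S e) (cadj (S e))) (S e) = S e,
      forall e, cmul (cadj (S e)) (S e) = P (edge_range e)
    & forall v, P v =
        \sum_(e : edge A | edge_source e == v) cmul (S e) (cadj (S e))].

(* C^*(G_A), given by its universal property. Only the values of [gauge] on the
   unit circle are meaningful. *)
Record graph_algebra := GraphAlgebra {
  graph_cstar :> cstar_algebra R;
  vertex_proj : V -> graph_cstar;
  edge_isom : edge A -> graph_cstar;
  graph_familyP : is_graph_family vertex_proj edge_isom;
  graph_generated : generates (range vertex_proj `|` range edge_isom);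
  graph_universal : forall (E : cstar_algebra R) (Q : V -> E) (T : edge A -> E),
    is_graph_family Q T -> exists f : graph_cstar -> E,
      [/\ is_star_hom f, forall v, f (vertex_proj v) = Q v
        & forall e, f (edge_isom e) = T e];
  gauge : C -> graph_cstar -> graph_cstar;
  gaugeP : forall z : C, `|z| = 1 ->
    [/\ is_star_hom (gauge z),
        forall v, gauge z (vertex_proj v) = vertex_proj v
      & forall e, gauge z (edge_isom e) = z *: edge_isom e]
}.

End GraphAlgebra.

Section CompactOperators.
Variable R : realType.
Local Notation C := R[i].

Record hilbert_space := HilbertSpace {
  hilbert_car :> completeNormedModType C;
  hdot : hilbert_car -> hilbert_car -> C;
  hdot_linear : forall (c : C) x y z,
    hdot x (c *: y + z) = c * hdot x y + hdot x z;
  hdot_conj : forall x y, (hdot x y)^* = hdot y x;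
  hdot_norm : forall x, `|x| ^+ 2 = hdot x x
}.

Definition separable (H : hilbert_space) : Prop :=
  exists D : set H, countable D /\ dense D.

Definition infinite_dimensional (H : hilbert_space) : Prop :=
  forall n (u : 'I_n -> H), exists x,
    forall c : 'I_n -> C, x <> \sum_i c i *: u i.

Definition is_compact_operator (H : hilbert_space) (T : H -> H) : Prop :=
  linear T /\ compact (closure (T @` [set x | `|x| <= 1])).

(* A C^*-algebra identified, through [kop], with that of the compact operators
   on H. *)
Record compact_operators (H : hilbert_space) := CompactOperators {
  compacts_cstar :> cstar_algebra R;
  kop : compacts_cstar -> H -> H;
  kop_linear : forall (c : C) a b x, kop (c *: a + b) x = c *: kop a x + kop b x;
  kopM : forall a b x, kop (cmul a b) x = kop a (kop b x);
  kop_adj : forall a x y, hdot (kop a x) y = hdot x (kop (cadj a) y);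
  kop_inj : injective kop;
  kop_norm : forall a x, `|kop a x| <= `|a| * `|x|;
  kop_norm_le : forall a (m : C), 0 <= m ->
    (forall x, `|kop a x| <= m * `|x|) -> `|a| <= m;
  kop_compact : forall a, is_compact_operator (kop a);
  kop_surj : forall T, is_compact_operator T -> exists a, kop a = T
}.

Definition lin_independent (E : lmodType C) n (u : 'I_n -> E) : Prop :=
  forall c : 'I_n -> C, \sum_i c i *: u i = 0 -> forall i, c i = 0.

(* A C^*-completion of the algebraic tensor product of D and K: [ctens] is
   injective on the latter ([ctens_inj]) and has dense range. When K is the
   algebra of compact operators, K is nuclear, so that the completion is
   unique. *)
Record cstar_tensor (D K : cstar_algebra R) := CStarTensor {
  ctens_cstar :> cstar_algebra R;
  ctens : D -> K -> ctens_cstar;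
  ctens_linearl : forall k, linear (ctens^~ k);
  ctens_linearr : forall d, linear (ctens d);
  ctensM : forall d k d' k',
    cmul (ctens d k) (ctens d' k') = ctens (cmul d d') (cmul k k');
  ctens_adj : forall d k, cadj (ctens d k) = ctens (cadj d) (cadj k);
  ctens_inj : forall n (d : 'I_n -> D) (k : 'I_n -> K), lin_independent d ->
    \sum_i ctens (d i) (k i) = 0 -> forall i, k i = 0;
  ctens_dense : dense (lin_span [set ctens d k | d in setT & k in setT])
}.

(* C^*(G_A) ⊗ K with the action gauge ⊗ id. *)
Record stabilization (V : finType) (A : V -> V -> nat)
    (D : graph_algebra R A) (K : cstar_algebra R) := Stabilization {
  stab_tensor :> cstar_tensor D K;
  stab_gauge : C -> stab_tensor -> stab_tensor;
  stab_gaugeP : forall z : C, `|z| = 1 ->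
    is_star_hom (stab_gauge z) /\
    forall d k, stab_gauge z (ctens stab_tensor d k)
                = ctens stab_tensor (gauge z d) k
}.

Definition equivariantly_isomorphic (V W : finType) (A : V -> V -> nat)
    (B : W -> W -> nat) (DA : graph_algebra R A) (DB : graph_algebra R B)
    (K : cstar_algebra R) (EA : stabilization DA K) (EB : stabilization DB K)
    : Prop :=
  exists f : EA -> EB,
    [/\ is_star_hom f, bijective f
      & forall z : C, `|z| = 1 ->
          forall x, f (stab_gauge z x) = stab_gauge z (f x)].

End CompactOperators.

(* Main.v *)
(* An aligned shift makes E_M = M ⊗ C^*(G_B) an equivariant equivalence
   bimodule from C^*(G_A) to C^*(G_B) with inverse N ⊗ C^*(G_A) up to X(A)^m:
   the unitary X ⊗ M -> M ⊗ Y lets C^*(G_A) act on E_M, and the alignment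
   relations say that E_M ⊗ E_N = X(A)^m ⊗ C^*(G_A) = C^*(G_A) as bimodules.

   This is carried out in coordinates. Since M is finite dimensional and the
   compact operators absorb multiplicities, infinitely many orthogonal copies
   m_i of M fit into C^*(G_B) ⊗ K and fill it. A graph family of G_A is defined
   on one copy and moved to the others, which gives an equivariant
   *-homomorphism f : C^*(G_A) ⊗ K -> C^*(G_B) ⊗ K, and likewise g from N. The
   alignment turns g f into the conjugation by a unitary multiplier whose rows
   are built from Psi : M ⊗ N -> X(A)^m, so that g f and f g are bijective.

   The tensor product with K is only known to be some C^*-completion, so maps
   on it need a norm estimate. It rests on two facts with elementary proofs:
   *-homomorphisms are contractive (a self-adjoint contraction a is the real
   part of the unitary a + i sqrt (1 - a^2), and sqrt is a limit of
   polynomials), and injective ones are isometric. *)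

From HB Require Import structures.
Require Import Defs.
From mathcomp Require Import all_boot all_order all_algebra.
From mathcomp Require Import complex.
From mathcomp Require Import all_classical all_reals all_analysis.
From mathcomp Require Import ring lra.

Set Implicit Arguments.
Unset Strict Implicit.
Unset Printing Implicit Defensive.

Import Order.TTheory GRing.Theory Num.Theory.
Import numFieldNormedType.Exports.
Import Normc.

Local Open Scope classical_set_scope.
Local Open Scope complex_scope.
Local Open Scope ring_scope.

(** The hypothesis [essential] makes [M] and [N] visible at every vertex: it provides paths of every
    length from and to each vertex, so each [cdelta] acts nontrivially on either side of the powers,
    hence of [M] and [N]. An orthonormal family in [M], tensored with suitable unit vectors of [N],
    stays orthonormal in the finite dimensional power of X(A); this is why [M] is finite
    dimensional, and why sums over frames are finite and no multiplier algebra has to be built.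
    Equivariance comes from degrees: the copies of [M] have entries in the span of the vertex
    projections, which the gauge action fixes, and Phi trades one edge of G_A for one edge of G_B.
    The lag is harmless for invertibility, since the range projections of the words of a given
    length in the edges add up to 1. As the completion is only known through density and algebraic
    injectivity, maps are built from matrix entries and extended; on each finite corner they are
    homomorphisms, hence contractive. Once all correspondences are represented in one algebra,
    tensors become products and the associativity isomorphisms disappear. *)

Local Notation "x ⋅ y" := (cmul x y) (at level 40, left associativity).
Local Notation "x ^†" := (cadj x) (at level 2, format "x ^†").

(** * Real-valued norms, density and limits *)

Section RealNorm.
Variable R : realType.
Local Notation C := R[i].
Implicit Types E : normedModType C.

(** The norm takes its values in [R[i]]; its real part is what order arguments, [lra] and [nra]
    apply to. *)
Definition nrm E (x : E) : R := complex.Re `|x|.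

Lemma nrmE E (x : E) : `|x| = (nrm x)%:C.
Proof. by rewrite /nrm RRe_real// normr_real. Qed.

Lemma nrm_ge0 E (x : E) : 0 <= nrm x.
Proof. by rewrite -ler0c -nrmE. Qed.

Lemma nrm0 E : nrm (0 : E) = 0.
Proof. by rewrite /nrm normr0. Qed.

Lemma nrm_eq0 E (x : E) : nrm x = 0 -> x = 0.
Proof. by move=> h; apply/eqP; rewrite -normr_eq0 nrmE h. Qed.

Lemma nrmD E (x y : E) : nrm (x + y) <= nrm x + nrm y.
Proof. by rewrite -lecR rmorphD /= -!nrmE ler_normD. Qed.

Lemma nrmN E (x : E) : nrm (- x) = nrm x.
Proof. by rewrite /nrm normrN. Qed.

Lemma nrmB E (x y : E) : nrm (x - y) <= nrm x + nrm y.
Proof. by rewrite -(nrmN y) nrmD. Qed.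

Lemma nrm_dist E (x y : E) : nrm (x - y) = nrm (y - x).
Proof. by rewrite -nrmN opprB. Qed.

Lemma nrmZ E (c : C) (x : E) : nrm (c *: x) = normc c * nrm x.
Proof.
apply: complexI; rewrite rmorphM /= -!nrmE normrZ; congr (_ * _).
Qed.

Lemma nrm_triangle E (z x y : E) : nrm (x - y) <= nrm (x - z) + nrm (z - y).
Proof. by have -> : x - y = (x - z) + (z - y); rewrite ?nrmD// addrA subrK. Qed.

Lemma nrm_sum E (I : Type) (r : seq I) (P : pred I) (F : I -> E) :
  nrm (\sum_(i <- r | P i) F i) <= \sum_(i <- r | P i) nrm (F i).
Proof.
elim/big_ind2: _ => [|x a y b ha hb|//]; first by rewrite nrm0.
exact: le_trans (nrmD _ _) (lerD ha hb).
Qed.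

Lemma nrm_small E (x : E) : (forall e : R, 0 < e -> nrm x <= e) -> x = 0.
Proof.
move=> h; apply: nrm_eq0; apply/eqP; rewrite eq_le nrm_ge0 andbT leNgt.
apply/negP => x0; have := h _ (divr_gt0 x0 (ltr0Sn R 1)).
by rewrite -[leLHS]mulr1 ler_pM2l// leNgt invf_lt1// ltr1n.
Qed.

Lemma gt0_complexP (e : C) : 0 < e -> 0 < complex.Re e /\ e = (complex.Re e)%:C.
Proof.
move=> e0; have ee : e = (complex.Re e)%:C by rewrite RRe_real// gtr0_real.
by split=> //; rewrite -ltcR -ee.
Qed.

Lemma nbhs_nrmP E (x : E) (P : set E) : nbhs x P <->
  exists2 e : R, 0 < e & forall y, nrm (x - y) < e -> P y.
Proof.
split=> [/nbhs_ballP[e /= e0 h]|[e e0 h]].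
  have [e1 ee] := gt0_complexP e0; exists (complex.Re e) => // y xy; apply: h.
  by rewrite -ball_normE /= nrmE ee ltcR.
apply/nbhs_ballP; exists e%:C; first by rewrite /= ltcR.
by move=> y; rewrite -ball_normE /= nrmE ltcR => /h.
Qed.

Definition nrm_dense E (S : set E) :=
  forall x (e : R), 0 < e -> exists2 y, S y & nrm (x - y) < e.

Lemma dense_nrmP E (S : set E) : dense S <-> nrm_dense S.
Proof.
split=> [dS x e e0|h O [x Ox] oO].
  have [||y [xy Sy]] := dS (ball x e%:C)^°; last 1 first.
  - exists y => //; have := interior_subset xy.
    by rewrite -ball_normE /= nrmE ltcR.
  - by exists x; apply: nbhsx_ballx; rewrite ltcR.
  - exact: open_interior.
have /nbhs_nrmP[e e0 he] : nbhs x O by apply: open_nbhs_nbhs.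
by have [y Sy xy] := h x e e0; exists y; split=> //; exact: he.
Qed.

Lemma closed_nrmP E (S : set E) : closed S <->
  forall x, (forall e : R, 0 < e -> exists2 y, S y & nrm (x - y) < e) -> S x.
Proof.
split=> [cS x h|h x clx].
  apply: cS => A /nbhs_nrmP[e e0 he].
  by have [y Sy xy] := h e e0; exists y; split=> //; exact: he.
apply: h => e e0.
have [|y [Sy xy]] := clx (fun y => nrm (x - y) < e).
  by apply/nbhs_nrmP; exists e.
by exists y.
Qed.

Definition seq_lim E (u : nat -> E) (l : E) :=
  forall e : R, 0 < e -> exists N : nat, forall n, (N <= n)%N -> nrm (u n - l) < e.

Lemma seq_lim_unique E (u : nat -> E) (l l' : E) :
  seq_lim u l -> seq_lim u l' -> l = l'.
Proof.
move=> h h'; apply/eqP; rewrite -subr_eq0; apply/eqP/nrm_small => e e0.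
have e2 : 0 < e / 2 by rewrite divr_gt0.
have [N hN] := h _ e2; have [N' hN'] := h' _ e2.
have h1 := hN (maxn N N') (leq_maxl _ _); have h2 := hN' (maxn N N') (leq_maxr _ _).
apply: le_trans (nrm_triangle (u (maxn N N')) _ _) _.
by rewrite nrm_dist [e in leRHS]splitr lerD// ltW.
Qed.

Lemma nrm_complete (E : completeNormedModType C) (u : nat -> E) :
  (forall e : R, 0 < e -> exists N : nat, forall m n, (N <= n)%N -> (n <= m)%N ->
     nrm (u m - u n) < e) ->
  exists l, seq_lim u l.
Proof.
move=> h.
have uc : cauchy (u @ \oo).
  apply/cauchy_exP => e /gt0_complexP[e0 ee].
  have [N hN] := h _ e0; exists (u N); exists N => // n /= Nn.
  by rewrite -ball_normE /= nrmE ee ltcR nrm_dist hN.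
have /cvg_ex[l hl] : cvg (u @ \oo) by exact: cauchy_cvg.
exists l => e e0; move/cvgrPdist_lt: hl => /(_ e%:C).
rewrite ltcR => /(_ e0) [N _ hN]; exists N => n Nn.
by have := hN n Nn; rewrite nrmE ltcR nrm_dist.
Qed.

End RealNorm.

(** * Bounded additive maps and their agreement on dense sets *)

Section BoundedAdditive.
Variable R : realType.
Local Notation C := R[i].

(* Complex scalars play no role here, so that conjugate linear maps such as
   the adjoint are covered. *)
Definition badd (E F : normedModType C) (f : E -> F) : Prop :=
  {morph f : x y / x + y} /\ exists K : R, forall x, nrm (f x) <= K * nrm x.

Lemma morphD0 (E F : zmodType) (f : E -> F) : {morph f : x y / x + y} -> f 0 = 0.
Proof. by move=> fD; apply: (addrI (f 0)); rewrite -fD !addr0. Qed.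

Lemma morphDN (E F : zmodType) (f : E -> F) : {morph f : x y / x + y} ->
  {morph f : x / - x}.
Proof. by move=> fD x; apply: (addrI (f x)); rewrite -fD !subrr (morphD0 fD). Qed.

Lemma morphDB (E F : zmodType) (f : E -> F) : {morph f : x y / x + y} ->
  {morph f : x y / x - y}.
Proof. by move=> fD x y; rewrite fD (morphDN fD). Qed.

Lemma morphD_sum (E F : zmodType) (f : E -> F) : {morph f : x y / x + y} ->
  forall (I : Type) (r : seq I) (P : pred I) (G : I -> E),
  f (\sum_(i <- r | P i) G i) = \sum_(i <- r | P i) f (G i).
Proof. by move=> fD I r P G; apply: big_morph => //; exact: morphD0. Qed.

Lemma baddK (E F : normedModType C) (f : E -> F) : badd f ->
  exists2 K : R, 0 < K & forall x, nrm (f x) <= K * nrm x.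
Proof.
move=> [_ [K hK]]; exists (`|K| + 1); first by rewrite ltr_wpDl.
move=> x; apply: le_trans (hK x) _; rewrite ler_wpM2r ?nrm_ge0//.
by rewrite (le_trans (ler_norm K))// lerDl.
Qed.

Lemma badd_lim (E F : normedModType C) (f : E -> F) (u : nat -> E) l :
  badd f -> seq_lim u l -> seq_lim (f \o u) (f l).
Proof.
move=> bf ul e e0; have [K K0 hK] := baddK bf.
have [N hN] := ul _ (divr_gt0 e0 K0); exists N => n /hN.
rewrite ltr_pdivlMr// mulrC; apply: le_lt_trans.
by rewrite /= -(morphDB bf.1).
Qed.

Lemma badd_eq_closed (E F : normedModType C) (f g : E -> F) :
  badd f -> badd g -> closed [set x | f x = g x].
Proof.
move=> bf bg; apply/closed_nrmP => x h.
have [K K0 hK] := baddK bf; have [L L0 hL] := baddK bg.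
apply/eqP; rewrite -subr_eq0; apply/eqP/nrm_small => e e0.
have [y /= fg xy] := h _ (divr_gt0 e0 (addr_gt0 K0 L0)).
have -> : f x - g x = f (x - y) - g (x - y).
  by rewrite (morphDB bf.1) (morphDB bg.1) fg opprB addrA subrK.
apply: le_trans (nrmB _ _) _; apply: le_trans (lerD (hK _) (hL _)) _.
by move: xy; rewrite ltr_pdivlMr ?addr_gt0// -mulrDl mulrC => /ltW.
Qed.

Lemma badd_id (E : normedModType C) : badd (fun x : E => x).
Proof. by split=> //; exists 1 => x; rewrite mul1r. Qed.

Lemma badd_0 (E F : normedModType C) : badd (fun x : E => 0 : F).
Proof. by split=> [x y|]; [rewrite addr0|exists 0 => x; rewrite mul0r nrm0]. Qed.

Lemma badd_comp (E F G : normedModType C) (g : F -> G) (f : E -> F) :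
  badd g -> badd f -> badd (fun x => g (f x)).
Proof.
move=> bg bf; split=> [x y|]; first by rewrite bf.1 bg.1.
have [K K0 hK] := baddK bf; have [L L0 hL] := baddK bg.
exists (L * K) => x; apply: le_trans (hL _) _.
by rewrite -mulrA ler_pM2l.
Qed.

Lemma baddD (E F : normedModType C) (f g : E -> F) :
  badd f -> badd g -> badd (fun x => f x + g x).
Proof.
move=> bf bg; split=> [x y|]; first by rewrite bf.1 bg.1 addrACA.
have [K K0 hK] := baddK bf; have [L L0 hL] := baddK bg.
exists (K + L) => x; apply: le_trans (nrmD _ _) _.
by rewrite mulrDl lerD.
Qed.

Lemma badd_scale (E : normedModType C) (c : C) : badd (fun x : E => c *: x).
Proof.
by split=> [x y|]; [rewrite scalerDr|exists (normc c) => x; rewrite nrmZ].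
Qed.

Lemma badd_sum (E F : normedModType C) (I : Type) (r : seq I) (P : pred I)
    (f : I -> E -> F) :
  (forall i, badd (f i)) -> badd (fun x => \sum_(i <- r | P i) f i x).
Proof.
move=> bf; elim: r => [|i r IH].
  rewrite (_ : (fun x => _) = fun=> 0); first exact: badd_0.
  by apply/funext => x; rewrite big_nil.
case Pi: (P i).
  rewrite (_ : (fun x => _) = fun x => f i x + \sum_(j <- r | P j) f j x).
    exact: baddD.
  by apply/funext => x; rewrite big_cons Pi.
rewrite (_ : (fun x => _) = fun x => \sum_(j <- r | P j) f j x)//.
by apply/funext => x; rewrite big_cons Pi.
Qed.

(** Additive maps need not commute with complex scalars, so agreement is required on every multiple
    of an element of [S]. *)
Lemma badd_dense_eq (E F : normedModType C) (f g : E -> F) (S : set E) :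
  badd f -> badd g -> nrm_dense (lin_span S) ->
  (forall (c : C) x, S x -> f (c *: x) = g (c *: x)) -> f =1 g.
Proof.
move=> bf bg dS h x.
have /closed_nrmP := badd_eq_closed bf bg; apply=> e /(dS x)[y [n [c [u [Su ->]]]] xy].
exists (\sum_i c i *: u i) => //=.
by rewrite (morphD_sum bf.1) (morphD_sum bg.1); apply: eq_bigr => i _; exact: h.
Qed.

End BoundedAdditive.

Section LinearMaps.
Variables (K : pzRingType) (E F : lmodType K) (f : E -> F).
Hypothesis lf : linear f.

Lemma linear_morphD : {morph f : x y / x + y}.
Proof. by move=> x y; have := lf 1 x y; rewrite !scale1r. Qed.

Lemma linear_morphZ c x : f (c *: x) = c *: f x.
Proof.
by have := lf c x 0; rewrite (morphD0 linear_morphD) !addr0.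
Qed.

Lemma linear_comb (I : Type) (r : seq I) (P : pred I) (c : I -> K) (u : I -> E) :
  f (\sum_(i <- r | P i) c i *: u i) = \sum_(i <- r | P i) c i *: f (u i).
Proof.
rewrite (morphD_sum linear_morphD); apply: eq_bigr => i _.
by rewrite linear_morphZ.
Qed.

End LinearMaps.

(** * Self-adjoint elements and *-homomorphisms without spectral theory *)

(* The trivial extension K ⊕ M, a commutative ring in which the identities of
   the module M become ring identities, hence accessible to [ring]. *)
Section TrivialExtension.
Variables (K : comNzRingType) (M : lmodType K).

Definition trivext : Type := (K * M)%type.
HB.instance Definition _ := GRing.Zmodule.on trivext.

Definition trivext_one : trivext := (1, 0).
Definition trivext_mul (x y : trivext) : trivext :=
  (x.1 * y.1, x.1 *: y.2 + y.1 *: x.2).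

Let pairE (x y : trivext) : x.1 = y.1 -> x.2 = y.2 -> x = y.
Proof. by case: x y => ? ? [? ?] /= -> ->. Qed.

Lemma trivext_mulA : associative trivext_mul.
Proof.
move=> x y z; apply: pairE; rewrite /= ?mulrA// !scalerDr !scalerA -addrA.
by congr (_ + (_ + _)); congr (_ *: _); rewrite mulrC.
Qed.

Lemma trivext_mulC : commutative trivext_mul.
Proof.
by move=> x y; apply: pairE => /=; [rewrite mulrC|rewrite [RHS]addrC].
Qed.

Lemma trivext_mul1 : left_id trivext_one trivext_mul.
Proof. by move=> x; apply: pairE; rewrite /= ?mul1r// scale1r scaler0 addr0. Qed.

Lemma trivext_mulDl : left_distributive trivext_mul +%R.
Proof.
move=> x y z; apply: pairE; rewrite /= ?mulrDl//.
by rewrite scalerDl scalerDr addrACA.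
Qed.

Lemma trivext_oner_neq0 : trivext_one != 0.
Proof. by apply/eqP => /(congr1 fst) /eqP; rewrite /= oner_eq0. Qed.

HB.instance Definition _ := GRing.Zmodule_isComNzRing.Build trivext
  trivext_mulA trivext_mulC trivext_mul1 trivext_mulDl trivext_oner_neq0.

Definition trivm (m : M) : trivext := (0, m).
Definition trivs (c : K) : trivext := (c, 0).

Lemma trivm_inj (x y : M) : trivm x = trivm y -> x = y.
Proof. by case. Qed.

Lemma trivmD x y : trivm (x + y) = trivm x + trivm y.
Proof. by apply: pairE; rewrite /= ?addr0. Qed.

Lemma trivmN x : trivm (- x) = - trivm x.
Proof. by apply: pairE; rewrite /= ?oppr0. Qed.

Lemma trivm0 : trivm 0 = 0.
Proof. by []. Qed.

Lemma trivmZ c x : trivm (c *: x) = trivs c * trivm x.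
Proof. by apply: pairE; rewrite /= ?mulr0// scale0r addr0. Qed.

Lemma trivsM c d : trivs (c * d) = trivs c * trivs d.
Proof. by apply: pairE; rewrite /= // !scaler0 addr0. Qed.

Lemma trivsD c d : trivs (c + d) = trivs c + trivs d.
Proof. by apply: pairE; rewrite /= ?addr0. Qed.

Lemma trivsN c : trivs (- c) = - trivs c.
Proof. by apply: pairE; rewrite /= ?oppr0. Qed.

Lemma trivs1 : trivs 1 = 1.
Proof. by []. Qed.

Definition trivE := (trivmD, trivmN, trivm0, trivmZ, trivsM, trivsD, trivsN, trivs1).

End TrivialExtension.

Ltac module := apply: trivm_inj; rewrite !trivE; ring.

Section CStarBasics.
Variable R : realType.
Local Notation C := R[i].
Implicit Types A B : cstar_algebra R.

Lemma cmulDl A (x y z : A) : (x + y) ⋅ z = x ⋅ z + y ⋅ z.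
Proof. exact: (linear_morphD (cmul_linearl z)). Qed.
Lemma cmulDr A (x y z : A) : x ⋅ (y + z) = x ⋅ y + x ⋅ z.
Proof. exact: (linear_morphD (cmul_linearr x)). Qed.
Lemma cmulNl A (x z : A) : (- x) ⋅ z = - (x ⋅ z).
Proof. exact: (morphDN (linear_morphD (cmul_linearl z))). Qed.
Lemma cmulNr A (x z : A) : x ⋅ (- z) = - (x ⋅ z).
Proof. exact: (morphDN (linear_morphD (cmul_linearr x))). Qed.
Lemma cmulBl A (x y z : A) : (x - y) ⋅ z = x ⋅ z - y ⋅ z.
Proof. by rewrite cmulDl cmulNl. Qed.
Lemma cmulBr A (x y z : A) : x ⋅ (y - z) = x ⋅ y - x ⋅ z.
Proof. by rewrite cmulDr cmulNr. Qed.
Lemma cmul0l A (z : A) : 0 ⋅ z = 0.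
Proof. exact: (morphD0 (linear_morphD (cmul_linearl z))). Qed.
Lemma cmul0r A (z : A) : z ⋅ 0 = 0.
Proof. exact: (morphD0 (linear_morphD (cmul_linearr z))). Qed.
Lemma cmulZl A (c : C) (x z : A) : (c *: x) ⋅ z = c *: (x ⋅ z).
Proof. exact: (linear_morphZ (cmul_linearl z)). Qed.
Lemma cmulZr A (c : C) (x z : A) : x ⋅ (c *: z) = c *: (x ⋅ z).
Proof. exact: (linear_morphZ (cmul_linearr x)). Qed.
Lemma cmul_suml A (I : Type) (r : seq I) (P : pred I) (F : I -> A) z :
  (\sum_(i <- r | P i) F i) ⋅ z = \sum_(i <- r | P i) F i ⋅ z.
Proof. exact: (morphD_sum (linear_morphD (cmul_linearl z))). Qed.
Lemma cmul_sumr A (I : Type) (r : seq I) (P : pred I) (F : I -> A) z :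
  z ⋅ (\sum_(i <- r | P i) F i) = \sum_(i <- r | P i) z ⋅ F i.
Proof. exact: (morphD_sum (linear_morphD (cmul_linearr z))). Qed.

Lemma cadj0 A : (0 : A)^† = 0.
Proof. exact: (morphD0 (@cadjD R A)). Qed.
Lemma cadjB A (x y : A) : (x - y)^† = x^† - y^†.
Proof. exact: (morphDB (@cadjD R A)). Qed.
Lemma cadj_sum A (I : Type) (r : seq I) (P : pred I) (F : I -> A) :
  (\sum_(i <- r | P i) F i)^† = \sum_(i <- r | P i) (F i)^†.
Proof. exact: (morphD_sum (@cadjD R A)). Qed.

Lemma nrmM A (x y : A) : nrm (x ⋅ y) <= nrm x * nrm y.
Proof. by rewrite -lecR rmorphM /= -!nrmE cmul_norm. Qed.

Lemma nrm_star A (x : A) : nrm (x^† ⋅ x) = nrm x ^+ 2.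
Proof. by apply: complexI; rewrite rmorphXn /= -!nrmE cstar_identity. Qed.

Lemma cstar_eq0 A (x : A) : x^† ⋅ x = 0 -> x = 0.
Proof.
move=> h; apply: nrm_eq0; apply/eqP; rewrite -sqrf_eq0 -nrm_star h nrm0.
exact: eqxx.
Qed.

Lemma nrm_adj A (x : A) : nrm x^† = nrm x.
Proof.
suff le (y : A) : nrm y <= nrm y^†.
  by apply/eqP; rewrite eq_le le andbT; have := le x^†; rewrite cadjK.
have [->|y0] := eqVneq (nrm y) 0; first exact: nrm_ge0.
have yp : 0 < nrm y by rewrite lt_neqAle eq_sym y0 nrm_ge0.
by rewrite -(ler_pM2r yp) -expr2 -nrm_star nrmM.
Qed.

Lemma badd_cmull A (x : A) : badd (fun y : A => x ⋅ y).
Proof. by split=> [y z|]; [rewrite cmulDr|exists (nrm x) => y; rewrite nrmM]. Qed.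

Lemma badd_cmulr A (x : A) : badd (fun y : A => y ⋅ x).
Proof.
by split=> [y z|]; [rewrite cmulDl|exists (nrm x) => y; rewrite mulrC nrmM].
Qed.

Lemma badd_cadj A : badd (fun y : A => y^†).
Proof. by split=> [y z|]; [rewrite cadjD|exists 1 => y; rewrite mul1r nrm_adj]. Qed.

End CStarBasics.

(** * Square roots by iteration, in an algebra without unit *)

Section SquareRoot.
Variable R : realType.
Local Notation C := R[i].
Variable A : cstar_algebra R.
Implicit Types x y b : A.

(** Fixed-point iteration for b = (x + b²)/2, which expresses (1 - b)² = 1 - x without a unit. *)
Fixpoint half_iter x n : A :=
  if n is n'.+1 then 2^-1 *: (x + half_iter x n' ⋅ half_iter x n') else 0.

(* The iteration at x = 1 in the real numbers dominates the others. *)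
Fixpoint real_iter n : R :=
  if n is n'.+1 then (1 + real_iter n' ^+ 2) / 2 else 0.

Lemma real_iter_ge0 n : 0 <= real_iter n.
Proof. by case: n => [//|n] /=; rewrite divr_ge0// addr_ge0// sqr_ge0. Qed.

(** The gap u = 1 - [real_iter n] evolves by u ↦ u - u²/2, which is increasing on [0, 1] and sends
    2/(n+2) below 2/(n+3). An explicit rate is used because at norm 1 the convergence need not be
    geometric. *)
Lemma real_iter_rate n : 1 - 2 / n.+2%:R <= real_iter n <= 1.
Proof.
elim: n => [|n /andP[IH1 IH2]]; first by rewrite divff// subrr/= ler01 lexx.
rewrite [real_iter _]/=; have b0 := real_iter_ge0 n.
move: IH1 IH2 b0; set b := real_iter n => IH1 IH2 b0; apply/andP; split; last by nra.
have n0 : 0 <= n%:R :> R by rewrite ler0n.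
move: IH1; rewrite (_ : n.+3%:R = n%:R + 3); last by rewrite -(natrD _ n 3) addn3.
rewrite (_ : n.+2%:R = n%:R + 2); last by rewrite -(natrD _ n 2) addn2.
set m : R := n%:R in n0 *; set u := 2 / _ => IH1.
have hu : u * (m + 2) = 2 by rewrite /u; field; lra.
set w := 2 / _; have hw : w * (m + 3) = 2 by rewrite /w; field; lra.
have u0 : 0 <= u by rewrite /u divr_ge0//; lra.
have u1 : u <= 1 by nra.
have hb : (1 - u) ^+ 2 <= b ^+ 2 by rewrite ler_pXn2r ?nnegrE//; lra.
suff : u - u ^+ 2 / 2 <= w by nra.
have mw : 0 < m + 3 by lra.
have mu : 0 < m + 2 by lra.
rewrite -subr_ge0 /u /w.
have -> : 2 / (m + 3) - (2 / (m + 2) - (2 / (m + 2)) ^+ 2 / 2)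
  = 2 / ((m + 3) * (m + 2) ^+ 2) by field; lra.
by rewrite divr_ge0// mulr_ge0// ?sqr_ge0// ltW.
Qed.

Lemma nrm_half x : nrm (2^-1 *: x) = nrm x / 2.
Proof.
rewrite nrmZ mulrC; congr (_ * _).
have -> : (2^-1 : C) = (2^-1)%:C by rewrite fmorphV rmorph_nat.
by rewrite /= expr0n addr0 sqrtr_sqr ger0_norm.
Qed.

(** The splitting b'b' - bb = b'(b' - b) + (b' - b)b needs no commutation, and the real increments
    obey the same identity, so bounds on the factors give the bound on the next increment. *)
Lemma half_iter_bound x n : nrm x <= 1 ->
  nrm (half_iter x n) <= real_iter n /\
  nrm (half_iter x n.+1 - half_iter x n) <= real_iter n.+1 - real_iter n.
Proof.
move=> x1.
have step m : nrm (half_iter x m) <= real_iter m ->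
    nrm (half_iter x m.+1) <= real_iter m.+1.
  move=> h; rewrite [half_iter _ _]/= nrm_half ler_pM2r//.
  apply: le_trans (nrmD _ _) (lerD x1 _); apply: le_trans (nrmM _ _) _.
  by rewrite expr2 ler_pM ?nrm_ge0.
elim: n => [|n [IH1 IH2]].
  by split; rewrite ?nrm0// subr0 subr0 /= cmul0l addr0 nrm_half expr0n addr0 ler_pM2r.
have IH3 := step _ IH1; split=> //.
move: IH1 IH2 IH3; rewrite [half_iter x n.+2]/= -/(half_iter x n.+1).
rewrite [half_iter x n.+1 in X in _ -> _ -> _ -> nrm (_ - X) <= _]/=.
rewrite [real_iter n.+2]/= -/(real_iter n.+1).
rewrite [real_iter n.+1 in X in _ -> _ -> _ -> _ <= _ - X]/=.
set b := half_iter x n; set b' := half_iter x n.+1.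
set r := real_iter n; set r' := real_iter n.+1 => h1 h2 h3.
rewrite -scalerBr nrm_half -mulrBl ler_pM2r//.
have -> : x + b' ⋅ b' - (x + b ⋅ b) = b' ⋅ (b' - b) + (b' - b) ⋅ b.
  by rewrite cmulBl cmulBr; module.
have -> : 1 + r' ^+ 2 - (1 + r ^+ 2) = r' * (r' - r) + (r' - r) * r by ring.
apply: le_trans (nrmD _ _) (lerD _ _); apply: le_trans (nrmM _ _) _;
  by rewrite ler_pM ?nrm_ge0.
Qed.

Lemma half_iter_cauchy x m n : nrm x <= 1 -> (n <= m)%N ->
  nrm (half_iter x m - half_iter x n) <= real_iter m - real_iter n.
Proof.
move=> x1; elim: m => [|m IH]; first by rewrite leqn0 => /eqP ->; rewrite !subrr nrm0.
rewrite leq_eqVlt => /predU1P[->|nm]; first by rewrite !subrr nrm0.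
apply: le_trans (nrm_triangle (half_iter x m) _ _) _.
rewrite (_ : real_iter m.+1 - _ =
  (real_iter m.+1 - real_iter m) + (real_iter m - real_iter n)); last by ring.
exact: lerD (half_iter_bound m x1).2 (IH nm).
Qed.

(* With 1 formally adjoined, 1 - b is the square root of 1 - x. *)
Lemma sqrt_compl x : nrm x <= 1 -> exists b,
  [/\ x = b + b - b ⋅ b, nrm b <= 1
    & forall S : set A, closed S -> S 0 ->
        (forall y, S y -> S (2^-1 *: (x + y ⋅ y))) -> S b].
Proof.
move=> x1.
have [b hb] : exists b, seq_lim (half_iter x) b.
  apply: nrm_complete => e e0.
  exists (Num.truncn (2 / e)) => m n Nn nm.
  apply: le_lt_trans (half_iter_cauchy x1 nm) _.
  have /andP[h1 _] := real_iter_rate n; have /andP[_ h2] := real_iter_rate m.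
  have : 2 / e < n.+2%:R.
    by apply: lt_le_trans (truncnS_gt _) _; rewrite ler_nat ltnS leqW.
  rewrite ltr_pdivrMr// mulrC -ltr_pdivrMr//.
  by move: h1; set u := 2 / _; lra.
have Sb (S : set A) : closed S -> S 0 ->
    (forall y, S y -> S (2^-1 *: (x + y ⋅ y))) -> S b.
  move=> /closed_nrmP cS S0 hS; apply: cS => e e0.
  have [N hN] := hb e e0; exists (half_iter x N); last by rewrite nrm_dist hN.
  by elim: N {hN} => [//|n IH]; exact: hS.
have b1 : nrm b <= 1.
  apply/ler_addgt0Pr => e e0; have [N hN] := hb e e0.
  have -> : b = (b - half_iter x N) + half_iter x N by rewrite subrK.
  apply: le_trans (nrmD _ _) _; rewrite addrC lerD//; last first.
    by rewrite nrm_dist ltW// hN.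
  apply: le_trans (half_iter_bound N x1).1 _.
  by have /andP[] := real_iter_rate N.
exists b; split=> //.
suff -> : b + b = x + b ⋅ b by rewrite addrK.
have : b = 2^-1 *: (x + b ⋅ b).
  (* The shifted sequence converges to [b] and also, by continuity of the square, to (x + b²)/2. *)
  apply: (@seq_lim_unique R A (fun n => half_iter x n.+1)).
    by move=> e /hb[N hN]; exists N => n Nn; rewrite hN// leqW.
  move=> e /hb[N hN]; exists N => n Nn /=.
  rewrite -scalerBr nrm_half opprD addrACA subrr add0r.
  set c := half_iter x n.
  have -> : c ⋅ c - b ⋅ b = c ⋅ (c - b) + (c - b) ⋅ b.
    by rewrite cmulBl cmulBr; module.
  have c1 : nrm c <= 1.
    by apply: le_trans (half_iter_bound n x1).1 _; have /andP[] := real_iter_rate n.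
  have d0 := nrm_ge0 (c - b); have := hN n Nn; rewrite -/c => de.
  have n1 := nrmD (c ⋅ (c - b)) ((c - b) ⋅ b).
  have n2 := nrmM c (c - b); have n3 := nrmM (c - b) b.
  have := nrm_ge0 c; have := nrm_ge0 b; nra.
move=> e; rewrite {1 2}e -scalerDl (_ : 2^-1 + 2^-1 = 1 :> C) ?scale1r//.
by have := @splitr C 1; rewrite mul1r.
Qed.

(** The closed invariant sets fed to [sqrt_compl] are the self-adjoint elements, the commutant of
    [z], and [S] itself. *)
Lemma sqrt_compl_sa x : nrm x <= 1 -> x^† = x -> exists b,
  [/\ x = b + b - b ⋅ b, nrm b <= 1, b^† = b,
      forall z, z ⋅ x = x ⋅ z -> z ⋅ b = b ⋅ z
    & forall S : set A, closed S -> is_star_subalgebra S -> S x -> S b].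
Proof.
move=> x1 xx; have [b [eb b1 Sb]] := sqrt_compl x1; exists b; split=> //.
- apply: (Sb [set y | y^† = y]); rewrite /= ?cadj0//.
    by apply: badd_eq_closed; [exact: badd_cadj|exact: badd_id].
  move=> y yy; rewrite cadjZ cadjD cadjM yy xx; congr (_ *: _).
  by rewrite fmorphV rmorph_nat.
- move=> z zx; apply: (Sb [set y | z ⋅ y = y ⋅ z]); rewrite /= ?cmul0l ?cmul0r//.
    by apply: badd_eq_closed; [exact: badd_cmull|exact: badd_cmulr].
  move=> y zy; rewrite cmulZl cmulZr cmulDl cmulDr zx; congr (_ *: (_ + _)).
  by rewrite cmulA zy -cmulA zy cmulA.
- move=> S cS sS Sx; have [S0 SL SM _] := sS; apply: Sb => // y Sy.
  rewrite -[_ *: _]addr0; apply: (SL) => //; rewrite -[x]scale1r.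
  by apply: SL => //; exact: SM.
Qed.

End SquareRoot.

Section StarHom.
Variable R : realType.
Local Notation C := R[i].
Implicit Types A B : cstar_algebra R.

(** Used for [c] equal to i and to -i: the two cross terms are opposite, because [c] is imaginary
    and [v^† ⋅ w] is self-adjoint. *)
Lemma rotated_norm A (c : C) (v w : A) : c^* = - c -> c * c = -1 ->
  v^† ⋅ w = w^† ⋅ v ->
  (v + c *: w)^† ⋅ (v + c *: w) = v^† ⋅ v + w^† ⋅ w.
Proof.
move=> cJ cc vw; rewrite cadjD cadjZ cmulDl !cmulDr !cmulZl !cmulZr cJ vw scalerA.
by rewrite mulNr cc opprK scale1r scaleNr; module.
Qed.

Lemma conj_imaginary : ('i%C : C)^* = - 'i%C.
Proof. by apply/eqP; rewrite eq_complex /= oppr0 !eqxx. Qed.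

Lemma conjc_re (r : R) : (r%:C : C)^* = r%:C.
Proof. by apply/eqP; rewrite eq_complex /= oppr0 !eqxx. Qed.

Lemma mul_imaginary : 'i%C * 'i%C = -1 :> C.
Proof. by rewrite -expr2 sqr_i. Qed.

Lemma normc_re (r : R) : normc (r%:C) = `|r|.
Proof. by rewrite /= expr0n addr0 sqrtr_sqr. Qed.

Lemma nrm_scale A (r : R) (x : A) : nrm (r%:C *: x) = `|r| * nrm x.
Proof. by rewrite nrmZ normc_re. Qed.

(* The left multiplications by a ± i (1 - b) are isometric and a is their
   half sum. *)
Lemma unitary_re_contractive A (a b : A) : a^† = a -> b^† = b -> a ⋅ b = b ⋅ a ->
  a ⋅ a = b + b - b ⋅ b -> forall y, nrm (a ⋅ y) <= nrm y.
Proof.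
move=> aa bb ab eq y; set v := a ⋅ y; set w := y - b ⋅ y.
have wE : w^† = y^† - y^† ⋅ b by rewrite cadjB cadjM bb.
have vE : v^† = y^† ⋅ a by rewrite cadjM aa.
have vw : v^† ⋅ w = w^† ⋅ v.
  by rewrite wE vE cmulBr cmulBl /v !cmulA -(cmulA y^† a b) ab cmulA.
have vv : v^† ⋅ v + w^† ⋅ w = y^† ⋅ y.
  rewrite vE wE /v cmulBl !cmulBr !cmulA -(cmulA y^† a a) -(cmulA y^† b b) eq.
  by rewrite cmulBr cmulDr cmulBl cmulDl; module.
have n (c : C) : c^* = - c -> c * c = -1 -> nrm (v + c *: w) = nrm y.
  move=> cJ cc; apply/eqP; rewrite -(@eqrXn2 _ 2) ?nrm_ge0//.
  by rewrite -!nrm_star rotated_norm// vv.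
have n1 := n _ conj_imaginary mul_imaginary; have := n (- 'i%C).
rewrite rmorphN /= conj_imaginary mulrNN mul_imaginary => /(_ erefl erefl) n2.
have := nrmD (v + 'i%C *: w) (v + - 'i%C *: w); rewrite n1 n2.
have -> : v + 'i%C *: w + (v + - 'i%C *: w) = (2 : R)%:C *: v.
  have -> : (2 : R)%:C = 1 + 1 :> C by rewrite rmorph_nat.
  module.
by rewrite nrm_scale ger0_norm//; lra.
Qed.

(** At y = a the preceding bound reads |a|² ≤ |a|. *)
Lemma unitary_re_le1 A (a b : A) : a^† = a -> b^† = b -> a ⋅ b = b ⋅ a ->
  a ⋅ a = b + b - b ⋅ b -> nrm a <= 1.
Proof.
move=> aa bb ab eq; have := unitary_re_contractive aa bb ab eq a.
rewrite -{1}aa nrm_star => h; rewrite leNgt; apply/negP => a1.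
by clear -h a1; nra.
Qed.

(** Serves maps that are homomorphisms on a part of the algebra only, such as the truncations [fext]
    below, which are known to be multiplicative on a corner. *)
Definition star_hom_on A B (S : set A) (f : A -> B) : Prop :=
  [/\ forall (c : C) x y, S x -> S y -> f (c *: x + y) = c *: f x + f y,
      forall x y, S x -> S y -> f (x ⋅ y) = f x ⋅ f y
    & forall x, S x -> f x^† = (f x)^†].

(** For a self-adjoint contraction x in [S], the element b with (1 - b)² = 1 - x² lies in [S] too,
    so [f x] and [f b] satisfy the relation that bounds [f x] by 1. Scaling and the C*-identity
    reduce the general case to [x^† ⋅ x]. *)
Lemma star_hom_on_contractive A B (S : set A) (f : A -> B) :
  closed S -> is_star_subalgebra S -> star_hom_on S f ->
  forall x, S x -> nrm (f x) <= nrm x.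
Proof.
move=> cS sS [fL fM fJ]; have [S0 SL SM SJ] := sS.
have f0 : f 0 = 0.
  apply: (@addrI _ (f 0)); rewrite addr0 -[X in X + _]scale1r -fL//.
  by rewrite scale1r addr0.
have fZ (c : C) x : S x -> f (c *: x) = c *: f x.
  by move=> Sx; rewrite -[c *: x]addr0 fL// f0 addr0.
have fD x y : S x -> S y -> f (x + y) = f x + f y.
  by move=> Sx Sy; rewrite -[x]scale1r fL// !scale1r.
have SZ (c : C) x : S x -> S (c *: x) by move=> Sx; rewrite -[_ *: _]addr0; exact: SL.
have SD x y : S x -> S y -> S (x + y) by move=> Sx Sy; rewrite -[x]scale1r; exact: SL.
have SN x : S x -> S (- x) by move=> Sx; rewrite -scaleN1r; exact: SZ.
have fN x : S x -> f (- x) = - f x by move=> Sx; rewrite -scaleN1r fZ// scaleN1r.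
have sa x : S x -> x^† = x -> nrm x <= 1 -> nrm (f x) <= 1.
  move=> Sx xx x1.
  have xx1 : nrm (x ⋅ x) <= 1 by rewrite -{1}xx nrm_star expr_le1// nrm_ge0.
  have [|b [eb b1 bb bC bS]] := sqrt_compl_sa xx1; first by rewrite cadjM xx.
  have Sb : S b by apply: bS => //; exact: SM.
  apply: (@unitary_re_le1 _ (f x) (f b)); rewrite -?fJ ?xx ?bb//.
    by rewrite -!fM// bC// cmulA.
  by rewrite -!fM// {1}eb !fD ?fN//; [exact: SM|exact: SD|exact/SN/SM].
move=> x Sx; have [x0|x0] := eqVneq (nrm x) 0.
  by rewrite (nrm_eq0 x0) f0 !nrm0.
have xp : 0 < nrm x by rewrite lt_neqAle eq_sym x0 nrm_ge0.
set z := (nrm x)^-1%:C *: x; have Sz : S z by exact: SZ.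
have z1 : nrm z = 1 by rewrite nrm_scale ger0_norm ?mulVf// invr_ge0 ltW.
have xE : x = (nrm x)%:C *: z.
  by rewrite scalerA -rmorphM /= mulfV// scale1r.
rewrite [X in f X]xE fZ// nrm_scale ger0_norm ?nrm_ge0// -[leRHS]mulr1.
rewrite ler_wpM2l ?nrm_ge0// -(@ler_pXn2r _ 2) ?nnegrE ?nrm_ge0// expr1n.
rewrite -nrm_star -fJ// -fM//; last exact: SJ.
apply: sa; first by apply: SM => //; exact: SJ.
  by rewrite cadjM cadjK.
by rewrite nrm_star z1 expr1n.
Qed.

Lemma star_hom_on_setT A B (f : A -> B) : is_star_hom f -> star_hom_on setT f.
Proof. by case=> fL fM fJ; split=> // *; rewrite ?fL. Qed.

Lemma is_star_subalgebraT A : is_star_subalgebra [set: A].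
Proof. by []. Qed.

Lemma star_hom_contractive A B (f : A -> B) : is_star_hom f ->
  forall x, nrm (f x) <= nrm x.
Proof.
move=> hf x; have := star_hom_on_setT hf.
by move/(star_hom_on_contractive closedT (@is_star_subalgebraT A)); apply.
Qed.

Lemma star_hom_badd A B (f : A -> B) : is_star_hom f -> badd f.
Proof.
move=> hf; split; first by case: hf => /linear_morphD.
by exists 1 => x; rewrite mul1r star_hom_contractive.
Qed.

(** By [rotated_norm], the elements v + i w and v - i w both satisfy [x^† ⋅ x = 0]. *)
Lemma commuting_sqr_sum_eq0 A (v w : A) : v^† = v -> w^† = w -> v ⋅ w = w ⋅ v ->
  v ⋅ v + w ⋅ w = 0 -> v = 0 /\ w = 0.
Proof.
move=> vv ww vw s0.
have n (c : C) : c^* = - c -> c * c = -1 -> v + c *: w = 0.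
  by move=> cJ cc; apply: cstar_eq0; rewrite rotated_norm ?vv ?ww.
have n1 := n _ conj_imaginary mul_imaginary; have := n (- 'i%C).
rewrite rmorphN /= conj_imaginary mulrNN mul_imaginary => /(_ erefl erefl) n2.
have v0 : v = 0.
  have /(congr1 (fun x => 2^-1 *: x)) : (2 : C) *: v = 0.
    by rewrite -[RHS](addr0 0) -{1}n1 -n2 (_ : 2 = 1 + 1 :> C)//; module.
  by rewrite scalerA mulVf ?pnatr_eq0// scale1r scaler0.
split=> //; have /(congr1 (fun x => - 'i%C *: x)) := n1.
by rewrite v0 add0r scalerA mulNr mul_imaginary opprK scale1r scaler0.
Qed.

(* Both 1 - x and 1 - y are squares of self-adjoint elements, hence positive,
   and they have the same square. *)
Lemma positive_sqrt_unique A (x y : A) : x^† = x -> y^† = y -> x ⋅ y = y ⋅ x ->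
  nrm x <= 1 -> nrm y <= 1 -> x + x - x ⋅ x = y + y - y ⋅ y -> x = y.
Proof.
move=> xx yy xy x1 y1 eq.
have [r [er _ rr rC _]] := sqrt_compl_sa x1 xx.
have [q [eq' _ qq qC _]] := sqrt_compl_sa y1 yy.
have yr : y ⋅ r = r ⋅ y by apply: rC.
have xr : x ⋅ r = r ⋅ x by apply: rC.
have xq : x ⋅ q = q ⋅ x by apply: qC.
have yq : y ⋅ q = q ⋅ y by apply: qC.
have rq : r ⋅ q = q ⋅ r by apply: qC; rewrite yr.
set d := x - y.
have dd : d^† = d by rewrite cadjB xx yy.
have dr : d ⋅ r = r ⋅ d by rewrite cmulBl cmulBr xr yr.
have dq : d ⋅ q = q ⋅ d by rewrite cmulBl cmulBr xq yq.
have dE : d = x - y by [].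
clearbody d.
(* As t = 2s - s², the square equals (1 - s)²d² = (1 - t)d². For (r, x) and (q, y) the two squares
   add up to (2 - x - y)d², and (2 - x - y)d is the difference of the two sides of [eq], hence 0. *)
have sq s t : d ⋅ s = s ⋅ d -> t = s + s - s ⋅ s ->
    (d - s ⋅ d) ⋅ (d - s ⋅ d) = d ⋅ d - t ⋅ (d ⋅ d).
  move=> ds ->; rewrite cmulBl !cmulBr [in RHS]cmulBl cmulDl.
  rewrite (cmulA d s d) ds !cmulA -(cmulA s d s) ds !cmulA; module.
have [v0 w0] : d - r ⋅ d = 0 /\ d - q ⋅ d = 0.
  apply: commuting_sqr_sum_eq0.
  - by rewrite cadjB cadjM dd rr dr.
  - by rewrite cadjB cadjM dd qq dq.
  - have dqr : d ⋅ (q ⋅ d) = q ⋅ d ⋅ d by rewrite cmulA dq.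
    have drr : d ⋅ (r ⋅ d) = r ⋅ d ⋅ d by rewrite cmulA dr.
    rewrite !cmulBl !cmulBr dqr drr.
    have -> : r ⋅ d ⋅ (q ⋅ d) = q ⋅ d ⋅ (r ⋅ d).
      by rewrite -!cmulA dqr drr !cmulA rq.
    module.
  - rewrite (sq r x)// (sq q y)//.
    have -> : d ⋅ d - x ⋅ (d ⋅ d) + (d ⋅ d - y ⋅ (d ⋅ d)) =
        (d + d - (x + y) ⋅ d) ⋅ d.
      by rewrite cmulBl !cmulDl !cmulA; module.
    have -> : d + d - (x + y) ⋅ d = 0; last exact: cmul0l.
    have -> : d + d - (x + y) ⋅ d = (x + x - x ⋅ x) - (y + y - y ⋅ y).
      by rewrite dE cmulDl !cmulBr xy; module.
    by rewrite eq subrr.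
have kill s t : t = s + s - s ⋅ s -> d - s ⋅ d = 0 -> t ⋅ d = d.
  move=> -> /eqP; rewrite subr_eq0 => /eqP h.
  by rewrite cmulBl cmulDl -cmulA -!h; module.
have := cstar_eq0 (x := d); rewrite dd {1}dE cmulBl (kill r x)// (kill q y)//.
by rewrite subrr => /(_ erefl) /eqP; rewrite dE subr_eq0 => /eqP.
Qed.

(** If [f] shrank a self-adjoint element, rescaling would put 1 between the two norms, and [f] would
    identify a square with its truncation at 1. The general case follows from the C*-identity. *)
Lemma injective_star_hom_isometric A B (f : A -> B) : is_star_hom f ->
  injective f -> forall x, nrm (f x) = nrm x.
Proof.
move=> hf fi; have fc := star_hom_contractive hf; have [fL fM fJ] := hf.
have fD := linear_morphD fL; have fB := morphDB fD; have fZ := linear_morphZ fL.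
(* For h = a ⋅ a, the element y below has y ⋅ y = 2 h - h ⋅ h = 1 - (1 - h)^2,
   so that g is 1 - |1 - h|; its image is that of h because h maps below 1. *)
have key (a : A) : a^† = a -> nrm (f a) <= 1 -> nrm a ^+ 2 <= 2 -> nrm a <= 1.
  move=> aa fa1 a2; set h := a ⋅ a.
  have hh : h^† = h by rewrite cadjM aa.
  have nh : nrm h = nrm a ^+ 2 by rewrite -nrm_star aa.
  have h2 : nrm (2^-1 *: h) <= 1 by rewrite nrm_half nh; lra.
  have [|c [ec _ cc cC _]] := sqrt_compl_sa h2.
    by rewrite cadjZ hh fmorphV rmorph_nat.
  have ac : a ⋅ c = c ⋅ a.
    by apply: cC; rewrite cmulZl cmulZr cmulA.
  set s : R := Num.sqrt 2; have ss : s%:C * s%:C = 2 :> C.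
    by rewrite -rmorphM /= -expr2 sqr_sqrtr// rmorph_nat.
  (* [y] is a times the square root of 2 - h, written as √2 (1 - c) with (1 - c)² = 1 - h/2; the
     bound |a|² ≤ 2 makes h/2 a contraction. *)
  set y := s%:C *: (a - a ⋅ c).
  have yy : y^† = y.
    by rewrite cadjZ cadjB cadjM aa cc -ac; rewrite conjc_re.
  have y2 : y ⋅ y = h + h - h ⋅ h.
    rewrite cmulZl cmulZr scalerA ss cmulBl !cmulBr.
    have -> : a ⋅ (a ⋅ c) = h ⋅ c by rewrite cmulA.
    have -> : a ⋅ c ⋅ a = h ⋅ c by rewrite -cmulA -ac cmulA.
    have -> : a ⋅ c ⋅ (a ⋅ c) = h ⋅ (c ⋅ c).
      by rewrite -(cmulA a c) (cmulA c a c) -ac -(cmulA a c c) cmulA.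
    have -> : h ⋅ h = 2 *: (h ⋅ (2^-1 *: h)).
      by rewrite cmulZr scalerA mulfV ?pnatr_eq0// scale1r.
    by rewrite ec cmulBr cmulDr (_ : 2 = 1 + 1 :> C)//; module.
  have yh : y ⋅ h = h ⋅ y.
    rewrite cmulZl cmulZr cmulBl cmulBr /h !cmulA; congr (_ *: (_ - _)).
    by rewrite -!cmulA; congr (a ⋅ _); rewrite cmulA -ac -cmulA -ac.
  have y1 : nrm y <= 1 by apply: (unitary_re_le1 yy hh yh y2).
  have yy1 : nrm (y ⋅ y) <= 1 by rewrite -{1}yy nrm_star expr_le1// nrm_ge0.
  have [|g [eg g1 gg gC _]] := sqrt_compl_sa yy1; first by rewrite cadjM yy.
  have gh : h ⋅ g = g ⋅ h.
    by apply: gC; rewrite cmulA -yh -cmulA -yh cmulA.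
  suff fgh : f g = f h.
    by rewrite -(@ler_pXn2r _ 2) ?nnegrE ?nrm_ge0// expr1n -nh -(fi _ _ fgh).
  apply: positive_sqrt_unique; rewrite -?fJ ?gg ?hh -?fM ?gh//.
  - exact: le_trans (fc _) g1.
  - by rewrite fM -{1}aa fJ nrm_star expr_le1// nrm_ge0.
  - by rewrite -!fD -!fB -eg -y2.
have sa (a : A) : a^† = a -> nrm a <= nrm (f a).
  move=> aa; rewrite leNgt; apply/negP => fa.
  have a0 : 0 < nrm a by exact: le_lt_trans (nrm_ge0 _) fa.
  (* scale so that the norm of a is above 1 and that of f a below 1 *)
  set t := Num.max (nrm (f a)) (nrm a / Num.sqrt 2).
  have s1 : 1 < Num.sqrt 2 :> R by rewrite -{1}sqrtr1 ltr_sqrt// ltr1n.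
  have s0 : 0 < Num.sqrt 2 :> R by rewrite (lt_trans ltr01).
  have ta : t < nrm a by rewrite gt_max fa ltr_pdivrMr// ltr_pMr.
  have t0 : 0 < t by rewrite lt_max divr_gt0// orbT.
  have tV : `|t^-1| = t^-1 by rewrite ger0_norm// invr_ge0 ltW.
  have := key (t^-1%:C *: a); rewrite cadjZ aa fZ !nrm_scale tV.
  rewrite ![t^-1 * _]mulrC !ler_pdivrMr// !mul1r => h.
  suff : nrm a <= t by rewrite leNgt ta.
  apply: h.
  - by rewrite conjc_re.
  - by rewrite le_max lexx.
  - rewrite -(@sqr_sqrtr _ 2)// ler_pXn2r ?nnegrE ?divr_ge0 ?nrm_ge0 ?(ltW t0) ?(ltW s0)//.
    by rewrite ler_pdivrMr// mulrC -ler_pdivrMr// le_max lexx orbT.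
move=> x; apply/eqP; rewrite eq_le fc/= -(@ler_pXn2r _ 2) ?nnegrE ?nrm_ge0//.
by rewrite -!nrm_star -fJ -fM sa// cadjM cadjK.
Qed.

End StarHom.

(** * Matrix units in the compact operators *)

Section LinSpan.
Variables (R : realType) (E : lmodType R[i]) (S : set E).

Lemma lin_span_incl x : S x -> lin_span S x.
Proof.
move=> Sx; exists 1%N, (fun=> 1), (fun=> x); split=> //.
by rewrite big_ord1 scale1r.
Qed.

Lemma lin_span0 : lin_span S 0.
Proof. by exists 0%N, (fun=> 0), (fun=> 0); split=> [[]//|]; rewrite big_ord0. Qed.

Lemma lin_spanD x y : lin_span S x -> lin_span S y -> lin_span S (x + y).
Proof.
move=> [n [c [u [Su ->]]]] [m [d [v [Sv ->]]]].
exists (n + m)%N, (fun i => match fintype.split i with inl j => c j | inr j => d j end),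
  (fun i => match fintype.split i with inl j => u j | inr j => v j end).
split=> [i|]; first by case: (fintype.split i).
rewrite big_split_ord /=; congr (_ + _); apply: eq_bigr => i _.
  by rewrite (unsplitK (inl i)).
by rewrite (unsplitK (inr i)).
Qed.

Lemma lin_spanZ a x : lin_span S x -> lin_span S (a *: x).
Proof.
move=> [n [c [u [Su ->]]]]; exists n, (fun i => a * c i), u; split=> //.
by rewrite scaler_sumr; apply: eq_bigr => i _; rewrite scalerA.
Qed.

Lemma lin_span_sum (I : Type) (r : seq I) (P : pred I) (F : I -> E) :
  (forall i, lin_span S (F i)) -> lin_span S (\sum_(i <- r | P i) F i).
Proof. by move=> h; elim/big_ind: _ => // *; [exact: lin_span0|exact: lin_spanD]. Qed.

End LinSpan.

Section Hilbert.
Variables (R : realType) (H : hilbert_space R).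
Local Notation C := R[i].
Implicit Types x y z : H.

Lemma hdotDr x y z : hdot x (y + z) = hdot x y + hdot x z.
Proof. by have := hdot_linear 1 x y z; rewrite scale1r mul1r. Qed.

Lemma hdot0r x : hdot x 0 = 0.
Proof. by apply: (addrI (hdot x 0)); rewrite -hdotDr !addr0. Qed.

Lemma hdotZr (c : C) x y : hdot x (c *: y) = c * hdot x y.
Proof. by have := hdot_linear c x y 0; rewrite hdot0r !addr0. Qed.

Lemma hdotNr x y : hdot x (- y) = - hdot x y.
Proof. by rewrite -scaleN1r hdotZr mulN1r. Qed.

Lemma hdot_sumr x (I : Type) (r : seq I) (P : pred I) (F : I -> H) :
  hdot x (\sum_(i <- r | P i) F i) = \sum_(i <- r | P i) hdot x (F i).
Proof. by apply: (big_morph (hdot x)); [exact: hdotDr|exact: hdot0r]. Qed.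

Lemma hdotDl x y z : hdot (x + y) z = hdot x z + hdot y z.
Proof. by rewrite -hdot_conj hdotDr rmorphD /= !hdot_conj. Qed.

Lemma hdotZl (c : C) x y : hdot (c *: x) y = c^* * hdot x y.
Proof. by rewrite -hdot_conj hdotZr rmorphM /= hdot_conj. Qed.

Lemma hdot0l x : hdot 0 x = 0.
Proof. by rewrite -hdot_conj hdot0r rmorph0. Qed.

Lemma hdot_suml x (I : Type) (r : seq I) (P : pred I) (F : I -> H) :
  hdot (\sum_(i <- r | P i) F i) x = \sum_(i <- r | P i) hdot (F i) x.
Proof.
elim/big_rec2: _ => [|i a b _ <-]; [exact: hdot0l|exact: hdotDl].
Qed.

Lemma hdot_nrm x : hdot x x = (nrm x ^+ 2)%:C.
Proof. by rewrite -hdot_norm nrmE rmorphXn. Qed.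

Lemma hdot_ext x y : (forall z, hdot z x = hdot z y) -> x = y.
Proof.
move=> h; apply/eqP; rewrite -subr_eq0; apply/eqP/nrm_eq0/eqP.
rewrite -sqrf_eq0; apply/eqP/complexI.
by rewrite -hdot_nrm hdotDr hdotNr h subrr.
Qed.

Lemma pythagoras x y : hdot x y = 0 -> nrm (x + y) ^+ 2 = nrm x ^+ 2 + nrm y ^+ 2.
Proof.
move=> xy; apply: complexI; rewrite rmorphD /= -!hdot_nrm hdotDl !hdotDr xy.
by rewrite -[hdot y x]hdot_conj xy rmorph0 addr0 add0r.
Qed.

Lemma pythagoras_le x y : hdot x y = 0 -> nrm x <= nrm (x + y) /\ nrm y <= nrm (x + y).
Proof.
move=> /pythagoras h; split; rewrite -(@ler_pXn2r _ 2) ?nnegrE ?nrm_ge0// h.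
  by rewrite lerDl sqr_ge0.
by rewrite lerDr sqr_ge0.
Qed.

Lemma hdot_unit_le e x : hdot e e = 1 -> normc (hdot e x) <= nrm x.
Proof.
move=> ee; have ne : nrm e = 1.
  move: ee; rewrite hdot_nrm => /complexI /eqP.
  by rewrite sqrf_eq1 => /predU1P[//|/eqP e1]; have := nrm_ge0 e; rewrite e1 ler0N1.
have := (@pythagoras_le (hdot e x *: e) (x - hdot e x *: e)).
rewrite subrKC nrmZ ne mulr1 => h; apply: (h _).1.
by rewrite hdotZl hdotDr hdotNr hdotZr ee mulr1 subrr mulr0.
Qed.

Section Projections.
Variable e : nat -> H.
Hypothesis e_orth : forall i j, hdot (e i) (e j) = (i == j)%:R.

Definition fproj n x : H := \sum_(i < n) hdot (e i) x *: e i.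

Lemma hdot_fproj n x i : (i < n)%N -> hdot (e i) (fproj n x) = hdot (e i) x.
Proof.
move=> i_n; rewrite hdot_sumr (bigD1 (Ordinal i_n))//= hdotZr e_orth eqxx mulr1.
rewrite big1 ?addr0// => j ji; rewrite hdotZr e_orth.
by rewrite (_ : (i == j :> nat) = false) ?mulr0// eq_sym; apply/negbTE.
Qed.

Lemma fproj_orth n x : hdot (fproj n x) (x - fproj n x) = 0.
Proof.
rewrite hdot_suml big1// => i _.
by rewrite hdotZl hdotDr hdotNr hdot_fproj// subrr mulr0.
Qed.

Lemma fproj_le n x : nrm (fproj n x) <= nrm x.
Proof. by have := (pythagoras_le (fproj_orth n x)).1; rewrite subrKC. Qed.

Lemma fproj_compl_le n x : nrm (x - fproj n x) <= nrm x.
Proof. by have := (pythagoras_le (fproj_orth n x)).2; rewrite subrKC. Qed.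

Lemma fproj_linear n : linear (fproj n).
Proof.
move=> c x y; rewrite scaler_sumr -big_split; apply: eq_bigr => i _.
by rewrite hdotDr hdotZr scalerDl scalerA.
Qed.

Lemma fproj_basis n i : (i < n)%N -> fproj n (e i) = e i.
Proof.
move=> i_n; rewrite /fproj (bigD1 (Ordinal i_n))//= e_orth eqxx scale1r.
rewrite big1 ?addr0// => j ji; rewrite e_orth.
by rewrite (_ : (j == i :> nat) = false) ?scale0r//; apply/negbTE.
Qed.

Lemma fproj_mono m n x : (m <= n)%N -> fproj m x = x -> fproj n x = x.
Proof.
move=> mn xm; rewrite -xm (linear_comb (fproj_linear n)); apply: eq_bigr => i _.
by rewrite fproj_basis// (leq_trans (ltn_ord i)).
Qed.

(** A vector [u m] close to x is fixed by all projections from [m.+1] on, so the error at x is the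
    error at x - [u m], which is at most the norm of that vector. *)
Lemma fproj_cvg (u : nat -> H) : nrm_dense (range u) ->
  (forall m, fproj m.+1 (u m) = u m) ->
  forall x (d : R), 0 < d ->
    exists N, forall n, (N <= n)%N -> nrm (x - fproj n x) < d.
Proof.
move=> du hu x d d0; have [_ [m _ <-] xm] := du x d d0.
exists m.+1 => n mn; apply: le_lt_trans xm.
have -> : x - fproj n x = (x - u m) - fproj n (x - u m).
  rewrite (morphDB (linear_morphD (fproj_linear n))) (fproj_mono mn (hu m)).
  by rewrite opprB addrA subrK.
exact: fproj_compl_le.
Qed.

End Projections.

Section GramSchmidt.
Hypothesis infH : infinite_dimensional H.
Variable u : nat -> H.

Definition gs_res (l : seq H) x : H := x - \sum_(v <- l) hdot v x *: v.

(** If x already lies in the span of [l], a vector outside the span takes its place; infinite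
    dimension provides one. Each step thus adds a vector, and [gs] is an infinite orthonormal
    sequence even when [u] is dependent. *)
Definition gs_new l x : H :=
  let r := gs_res l (if gs_res l x == 0 then xget 0 [set z | gs_res l z != 0] else x)
  in (nrm r)^-1%:C *: r.

Fixpoint gs_list n : seq H :=
  if n is n'.+1 then rcons (gs_list n') (gs_new (gs_list n') (u n')) else [::].

Definition gs n : H := gs_new (gs_list n) (u n).

Lemma gs_listE n : gs_list n = mkseq gs n.
Proof. by elim: n => [//|n IH]; rewrite mkseqS -IH. Qed.

Lemma gs_resE n x : gs_res (gs_list n) x = x - fproj gs n x.
Proof.
rewrite /gs_res gs_listE big_map (_ : iota 0 n = index_iota 0 n) ?big_mkord//.
by rewrite /index_iota subn0.
Qed.

Lemma gs_res_ex n : exists z, gs_res (gs_list n) z != 0.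
Proof.
have [z hz] := infH (fun i : 'I_n => gs i); exists z.
apply/eqP => /eqP; rewrite gs_resE subr_eq0 => /eqP; exact: hz.
Qed.

(** Covers both cases of [gs_new]: [c] is 0 when [u n] was already in the span and 1 otherwise. *)
Lemma gs_spec n : exists r c, [/\ r != 0, (exists y, r = y - fproj gs n y),
  gs n = (nrm r)^-1%:C *: r & u n = fproj gs n (u n) + c%:C *: r].
Proof.
rewrite /gs /gs_new; case: ifPn => [/eqP h0|h0].
  have /(xgetPex 0) /= := gs_res_ex n; set z := xget _ _ => hz.
  exists (gs_res (gs_list n) z), 0; split=> //; first by exists z; rewrite gs_resE.
  by rewrite scale0r addr0; move: h0; rewrite gs_resE => /eqP; rewrite subr_eq0 => /eqP.
exists (gs_res (gs_list n) (u n)), 1; split=> //; first by exists (u n); rewrite gs_resE.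
by rewrite scale1r gs_resE addrC subrK.
Qed.

Lemma gs_orth i j : hdot (gs i) (gs j) = (i == j)%:R.
Proof.
suff h n : forall i j, (i < n)%N -> (j < n)%N -> hdot (gs i) (gs j) = (i == j)%:R.
  by apply: (h (maxn i j).+1); rewrite ltnS ?leq_maxl ?leq_maxr.
elim: n => [//|n IH] {}i {}j.
have [r [c [r0 [y ry] gr _]]] := gs_spec n.
have orth k : (k < n)%N -> hdot (gs k) (gs n) = 0.
  move=> kn; rewrite gr hdotZr ry hdotDr hdotNr hdot_sumr (bigD1 (Ordinal kn))//=.
  rewrite hdotZr IH// eqxx mulr1 big1 ?addr0 ?subrr ?mulr0// => l lk.
  by rewrite hdotZr IH// (_ : (k == l :> nat) = false) ?mulr0// eq_sym; apply/negbTE.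
rewrite !ltnS leq_eqVlt => /predU1P[->|i_n]; rewrite leq_eqVlt => /predU1P[->|jn].
- rewrite eqxx gr hdotZl hdotZr hdot_nrm conjc_re -!rmorphM /=.
  rewrite mulrA -expr2 -exprMn mulVf ?expr1n// -?rmorph1//.
  by apply: contra_neq r0 => /nrm_eq0.
- by rewrite -hdot_conj orth// rmorph0 gtn_eqF.
- by rewrite orth// ltn_eqF.
- exact: IH.
Qed.

Lemma gs_span n : fproj gs n.+1 (u n) = u n.
Proof.
have [r [c [r0 [y ry] gr un]]] := gs_spec n.
have rg : r = (nrm r)%:C *: gs n.
  rewrite gr scalerA -rmorphM /= mulfV ?scale1r//.
  by apply: contra_neq r0 => /nrm_eq0.
have fD := linear_morphD (fproj_linear gs n.+1).
have fZ := linear_morphZ (fproj_linear gs n.+1).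
rewrite {1}un rg fD 2!fZ (fproj_basis gs_orth)// -rg [in RHS]un; congr (_ + _).
by rewrite (linear_comb (fproj_linear gs n.+1)); apply: eq_bigr => i _;
  rewrite (fproj_basis gs_orth)// ltnW// ltnS.
Qed.

End GramSchmidt.

Lemma orthonormal_basis : separable H -> infinite_dimensional H ->
  exists e : nat -> H, (forall i j, hdot (e i) (e j) = (i == j)%:R) /\
    forall x (d : R), 0 < d ->
      exists N, forall n, (N <= n)%N -> nrm (x - fproj e n x) < d.
Proof.
move=> [D [cD /dense_nrmP dD]] infH; have /countable_injP[f fi] := cD.
pose u n := xget 0 [set d | D d /\ f d = n].
have uf d : D d -> u (f d) = d.
  move=> Dd; have [|Du fu] := @xgetPex _ 0 [set d' | D d' /\ f d' = f d].
    by exists d.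
  by apply: fi => //; rewrite in_setE.
have du : nrm_dense (range u).
  by move=> x d /(dD x)[y Dy xy]; exists y => //; exists (f y) => //; rewrite uf.
exists (gs u); split; first exact: gs_orth.
by apply: fproj_cvg du _; [exact: gs_orth|exact: gs_span].
Qed.

End Hilbert.

Section MatrixUnits.
Variables (R : realType) (H : hilbert_space R) (K : compact_operators H).
Local Notation C := R[i].

Definition is_matrix_units (D : cstar_algebra R) (u : nat -> nat -> D) :=
  [/\ forall i j k l, u i j ⋅ u k l = (j == k)%:R *: u i l,
      forall i j, (u i j)^† = u j i,
      u 0%N 0%N <> 0
    & nrm_dense (lin_span [set x | exists i j, x = u i j])].

Lemma normc_le_sum (s t : R) : normc (s +i* t) <= `|s| + `|t|.
Proof.
rewrite -(ler_pXn2r (n := 2)) ?nnegrE ?normc_ge0 ?addr_ge0// /= sqr_sqrtr.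
  by rewrite sqrrD !real_normK ?num_real// lerD2r lerDl mulrn_wge0// mulr_ge0.
by rewrite addr_ge0// sqr_ge0.
Qed.

(** The coefficients fill a square around the unit disc: a square is a product of segments, so its
    image is compact by continuity. *)
Lemma closed_disc_compact (y : H) :
  compact [set x | exists s t : R, [/\ `|s| <= 1, `|t| <= 1 & x = (s +i* t) *: y]].
Proof.
set g := fun p : R * R => (p.1 +i* p.2) *: y.
have -> : [set x | exists s t : R, [/\ `|s| <= 1, `|t| <= 1 & x = (s +i* t) *: y]] =
    g @` ([set` `[(-1 : R), 1]] `*` [set` `[(-1 : R), 1]]).
  apply/seteqP; split=> x /=.
    by move=> [s [t [s1 t1 ->]]]; exists (s, t); rewrite //= !in_itv /= -!ler_norml.
  move=> [[s t] /=]; rewrite !in_itv /= -!ler_norml => -[s1 t1] <-.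
  by exists s, t.
apply: continuous_compact; last by apply: compact_setX; exact: segment_compact.
apply: continuous_subspaceT => -[s t]; apply/cvgrPdist_lt => e /gt0_complexP[e0 ->].
have gB p q : g p - g q = ((p.1 - q.1) +i* (p.2 - q.2)) *: y.
  by rewrite /g -scalerBl; congr (_ *: _); apply/eqP; rewrite eq_complex /= !eqxx.
pose d := complex.Re e / (nrm y + 1) / 2.
have y1 : 0 < nrm y + 1 by rewrite ltr_wpDl ?nrm_ge0.
have d0 : 0 < d by rewrite !divr_gt0.
near=> p; rewrite gB nrmE ltcR nrmZ.
have h1 : `|s - p.1| < d.
  near: p; exists (ball s d, setT); last by case=> a b /= [].
  by split; [exact: nbhsx_ballx|exact: filterT].
have h2 : `|t - p.2| < d.
  near: p; exists (setT, ball t d); last by case=> a b /= [].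
  by split; [exact: filterT|exact: nbhsx_ballx].
have : normc ((s - p.1) +i* (t - p.2)) <= `|s - p.1| + `|t - p.2|.
  exact: normc_le_sum.
have dE : d * 2 * (nrm y + 1) = complex.Re e.
  by rewrite /d; field; rewrite gt_eqF.
set a := normc _; move: (normc_ge0 ((s - p.1) +i* (t - p.2))); rewrite -/a.
have := nrm_ge0 y; clear -h1 h2 dE; nra.
Unshelve. all: end_near. Qed.

Lemma rank_one_compact (x y : H) : hdot x x = 1 ->
  is_compact_operator (fun z : H => hdot x z *: y).
Proof.
move=> xx; split.
  by move=> c a b; rewrite hdotDr hdotZr scalerDl scalerA.
have hc : compact _ := @closed_disc_compact y.
apply: (@subclosed_compact _ _ _ (@closed_closure _ _) hc).
have hcl := compact_closed (@norm_hausdorff _ _) hc.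
move/closure_id : hcl => hcl; rewrite [X in _ `<=` X]hcl.
apply: closure_subset => _ [z /= z1 <-].
have := hdot_unit_le z xx; case: (hdot x z) => s t st.
have le1 : normc (s +i* t) <= 1.
  by apply: le_trans st _; rewrite -lecR -nrmE.
have c2 : s ^+ 2 + t ^+ 2 <= 1.
  move: le1; rewrite -(ler_pXn2r (n := 2)) ?nnegrE ?normc_ge0// expr1n /=.
  by rewrite sqr_sqrtr// addr_ge0// sqr_ge0.
exists s, t; split=> //; rewrite -(ler_pXn2r (n := 2)) ?nnegrE// expr1n real_normK ?num_real//.
  by apply: le_trans c2; rewrite lerDl sqr_ge0.
by apply: le_trans c2; rewrite lerDr sqr_ge0.
Qed.

Lemma kop_nrm (a : K) x : nrm (kop a x) <= nrm a * nrm x.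
Proof. by rewrite -lecR rmorphM /= -!nrmE kop_norm. Qed.

Lemma kop_nrm_le (a : K) (m : R) : 0 <= m ->
  (forall x, nrm (kop a x) <= m * nrm x) -> nrm a <= m.
Proof.
move=> m0 h; rewrite -lecR -nrmE; apply: kop_norm_le; first by rewrite lecR.
by move=> x; rewrite !nrmE -rmorphM lecR.
Qed.

Lemma kop_sum (I : Type) (r : seq I) (P : pred I) (F : I -> K) x :
  kop (\sum_(i <- r | P i) F i) x = \sum_(i <- r | P i) kop (F i) x.
Proof.
have D (a b : K) : kop (a + b) x = kop a x + kop b x.
  by have := kop_linear 1 a b x; rewrite !scale1r.
by apply: (big_morph (fun a : K => kop a x)) => //; apply: (addrI (kop (0 : K) x)); rewrite -D !addr0.
Qed.

Lemma kopZ (c : C) (a : K) x : kop (c *: a) x = c *: kop a x.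
Proof.
have := kop_linear c a 0 x; rewrite addr0 => ->.
have := kop_linear 1 (0 : K) 0 x; rewrite !scale1r addr0 => /eqP.
by rewrite eq_sym -subr_eq0 addrK => /eqP ->; rewrite addr0.
Qed.

Lemma kopE (a : K) (c : C) x : kop a (c *: x) = c *: kop a x.
Proof. exact: (linear_morphZ (kop_compact a).1). Qed.

Lemma kopB (a b : K) x : kop (a - b) x = kop a x - kop b x.
Proof. by rewrite addrC -scaleN1r kop_linear scaleN1r addrC. Qed.

Section Units.
Variable e : nat -> H.
Hypothesis e_orth : forall i j, hdot (e i) (e j) = (i == j)%:R.
Hypothesis e_cvg : forall x (d : R), 0 < d ->
  exists N, forall n, (N <= n)%N -> nrm (x - fproj e n x) < d.
Variable u : nat -> nat -> K.
Hypothesis kop_u : forall i j x, kop (u i j) x = hdot (e j) x *: e i.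

Definition kproj n : K := \sum_(i < n) u i i.

Lemma kop_kproj n x : kop (kproj n) x = fproj e n x.
Proof. by rewrite kop_sum; apply: eq_bigr => i _; rewrite kop_u. Qed.

(** Otherwise, for every N the compact closure of the image of the unit ball contains a point [y N]
    moved by more than d by some projection of index at least N. At a cluster point p the
    projections converge, and they move [y N] at most as far as p, up to |p - [y N]|: a
    contradiction. *)
Lemma kproj_approx (a : K) (d : R) : 0 < d ->
  exists N, forall n, (N <= n)%N -> nrm (a - kproj n ⋅ a) <= d.
Proof.
move=> d0; apply: contrapT => hN.
have H1 N : exists y, (closure (kop a @` [set x | `|x| <= 1])) y /\
    exists2 n, (N <= n)%N & d < nrm (y - fproj e n y).
  have [n Nn hn] : exists2 n, (N <= n)%N & ~ (nrm (a - kproj n ⋅ a) <= d).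
    apply: contrapT => h; apply: hN; exists N => n Nn.
    by apply: contrapT => h'; apply: h; exists n.
  have [x hx] : exists x, ~ (nrm (kop (a - kproj n ⋅ a) x) <= d * nrm x).
    apply: contrapT => h; apply: hn; apply: kop_nrm_le; first exact: ltW.
    by move=> x; apply: contrapT => h'; apply: h; exists x.
  have x0 : 0 < nrm x.
    rewrite lt_neqAle nrm_ge0 andbT eq_sym; apply/eqP => x0; apply: hx.
    by rewrite (le_trans (kop_nrm _ _))// x0 !mulr0.
  set z := (nrm x)^-1%:C *: x.
  have nz : nrm z = 1.
    by rewrite nrmZ normc_re ger0_norm ?invr_ge0 ?ltW// mulVf// gt_eqF.
  have xE : x = (nrm x)%:C *: z.
    by rewrite scalerA -rmorphM /= mulfV ?scale1r// gt_eqF.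
  clearbody z; exists (kop a z); split.
    by apply: subset_closure; exists z => //=; rewrite nrmE nz.
  exists n => //; rewrite -kop_kproj -kopM -kopB ltNge; apply/negP => h.
  apply: hx; rewrite xE.
  by rewrite kopE !nrmZ nz mulr1 [d * _]mulrC ler_wpM2l// normc_ge0.
have [y Hy] := choice H1.
have cpt := (kop_compact a).2.
have [|p [_ clp]] := cpt (y @ \oo) _.
  by exists 0%N => // n _ /=; have [] := Hy n.
have d3 : 0 < d / 3 by rewrite divr_gt0.
have [N hp] := e_cvg p d3.
have [||q [[n /= Nn <-] pq]] := clp [set y n | n in [set n | (N <= n)%N]] (fun q => nrm (p - q) < d / 3).
- by exists N => // n /= Nn; exists n.
- by apply/nbhs_nrmP; exists (d / 3).
have [_ [m nm hm]] := Hy n.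
have := hp m (leq_trans Nn nm); move: hm.
have -> : y n - fproj e m (y n) = (p - fproj e m p) - ((p - y n) - fproj e m (p - y n)).
  rewrite (morphDB (linear_morphD (fproj_linear e m))); module.
have := nrmB (p - fproj e m p) ((p - y n) - fproj e m (p - y n)).
have := fproj_compl_le e_orth m (p - y n); clear -pq d0; lra.
Qed.

End Units.

Lemma compact_matrix_units : separable H -> infinite_dimensional H ->
  exists u : nat -> nat -> K, is_matrix_units u.
Proof.
move=> sepH infH; have [e [e_orth e_cvg]] := orthonormal_basis sepH infH.
have eu i : hdot (e i) (e i) = 1 by rewrite e_orth eqxx.
have /choice[u ku] : forall p : nat * nat, exists a : K,
    forall x, kop a x = hdot (e p.2) x *: e p.1.
  move=> p; have [a ha] := kop_surj K (rank_one_compact (e p.1) (eu p.2)).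
  by exists a => x; rewrite ha.
pose v i j := u (i, j).
have kv i j x : kop (v i j) x = hdot (e j) x *: e i by rewrite /v ku.
have ext (a b : K) : (forall x, kop a x = kop b x) -> a = b.
  by move=> h; apply: kop_inj; apply/funext.
exists v; split.
- move=> i j k l; apply: ext => x.
  by rewrite kopM kopZ !kv hdotZr e_orth scalerA mulrC.
- move=> i j; apply: ext => x; apply: hdot_ext => z.
  by rewrite -kop_adj !kv hdotZl hdotZr hdot_conj mulrC.
- move=> /(congr1 (fun a => kop a (e 0%N))); rewrite kv eu scale1r => e0.
  have := kopZ 0 (0 : K) (e 0%N); rewrite !scale0r -e0 => e00.
  by have := eu 0%N; rewrite e00 hdot0r => /esym/eqP; rewrite oner_eq0.
move=> a d d0; have d2 : 0 < d / 3 by rewrite divr_gt0.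
have [N1 h1] := kproj_approx e_orth e_cvg kv a d2.
(* [kproj_approx] controls multiplication by [p] on the left; the estimate on the right is the
   adjoint of one for [a^†]. *)
have [N2 h2] := kproj_approx e_orth e_cvg kv a^† d2.
set n := maxn N1 N2; set p := kproj v n.
have pJ : p^† = p.
  rewrite cadj_sum; apply: eq_bigr => i _; apply: ext => x; apply: hdot_ext => z.
  by rewrite -kop_adj !kv hdotZl hdotZr hdot_conj mulrC.
have p1 : nrm p <= 1.
  apply: kop_nrm_le => // x; rewrite (kop_kproj kv) mul1r.
  exact: fproj_le.
exists (p ⋅ a ⋅ p).
  rewrite cmul_sumr; apply: lin_span_sum => j.
  rewrite cmul_suml cmul_suml; apply: lin_span_sum => i.
  suff -> : v i i ⋅ a ⋅ v j j = hdot (e i) (kop a (e j)) *: v i j.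
    by apply: lin_spanZ; apply: lin_span_incl; exists i, j.
  apply: ext => x; rewrite !kopM kopZ !kv kopE hdotZr scalerA.
  by rewrite mulrC.
have -> : a - p ⋅ a ⋅ p = (a - p ⋅ a) + p ⋅ (a^† - p ⋅ a^†)^†.
  by rewrite cadjB cadjM pJ cadjK cmulBr cmulA addrA subrK.
have := h1 n (leq_maxl _ _); have := h2 n (leq_maxr _ _); rewrite -/p => g2 g1.
have t1 := nrmD (a - p ⋅ a) (p ⋅ (a^† - p ⋅ a^†)^†).
have t2 := nrmM p (a^† - p ⋅ a^†)^†; move: t2; rewrite nrm_adj => t2.
have := nrm_ge0 (a^† - p ⋅ a^†); clear -g1 g2 t1 t2 p1 d0; nra.
Qed.

End MatrixUnits.

(** * Stable C*-algebras *)

Lemma sum_delta (K : pzRingType) (E : lmodType K) (I : finType) (F : I -> E) i :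
  \sum_j (i == j)%:R *: F j = F i.
Proof.
rewrite (bigD1 i)//= eqxx scale1r big1 ?addr0// => j ji.
by rewrite eq_sym (negbTE ji) scale0r.
Qed.

Lemma sum_deltar (K : pzRingType) (E : lmodType K) (I : finType) (F : I -> E) i :
  \sum_j (j == i)%:R *: F j = F i.
Proof. by under eq_bigr do rewrite eq_sym; exact: sum_delta. Qed.

Section StarHomRange.
Variable R : realType.
Implicit Types A B : cstar_algebra R.

Lemma seq_lim_ex (E : normedModType R[i]) (S : set E) x :
  (forall e : R, 0 < e -> exists2 y, S y & nrm (x - y) < e) ->
  exists u : nat -> E, (forall n, S (u n)) /\ seq_lim u x.
Proof.
move=> h; have /choice[u hu] : forall n : nat, exists y, S y /\ nrm (x - y) < n.+1%:R^-1.
  move=> n; have [|y Sy xy] := h n.+1%:R^-1; first by rewrite invr_gt0.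
  by exists y.
exists u; split=> [n|e e0]; first exact: (hu n).1.
exists (Num.truncn e^-1) => n Nn; rewrite nrm_dist (lt_le_trans (hu n).2)//.
rewrite invf_ple ?posrE// ltW// (lt_le_trans (truncnS_gt _))//.
by rewrite ler_nat ltnS.
Qed.

Lemma isometry_range_closed (E F : completeNormedModType R[i]) (f : E -> F) :
  {morph f : x y / x + y} -> (forall x, nrm (f x) = nrm x) -> closed (range f).
Proof.
move=> fD fn; apply/closed_nrmP => y /seq_lim_ex[v [fv vy]].
have /choice[u hu] : forall n, exists x, f x = v n by move=> n; have [x _ <-] := fv n; exists x.
have [l ul] : exists l, seq_lim u l.
  apply: nrm_complete => e e0; have e2 : 0 < e / 2 by rewrite divr_gt0.
  have [N hN] := vy _ e2; exists N => m n Nn nm.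
  rewrite -fn (morphDB fD) !hu; apply: le_lt_trans (nrm_triangle y _ _) _.
  by rewrite [e]splitr ltrD ?[nrm (y - _)]nrm_dist ?hN// (leq_trans Nn).
exists l => //; apply: (@seq_lim_unique _ _ (f \o u)).
  by apply: badd_lim => //; split=> //; exists 1 => x; rewrite fn mul1r.
by move=> e /vy[N hN]; exists N => n /hN; rewrite /= hu.
Qed.

Lemma star_hom_range_closed A B (f : A -> B) : is_star_hom f -> injective f ->
  closed (range f).
Proof.
move=> hf fi; apply: isometry_range_closed; first by case: hf => /linear_morphD.
exact: injective_star_hom_isometric.
Qed.

Lemma is_star_hom_injP A B (f : A -> B) : is_star_hom f ->
  (forall x, f x = 0 -> x = 0) -> injective f.
Proof.
move=> [/linear_morphD fD _ _] f0 x y fxy; apply/eqP; rewrite -subr_eq0; apply/eqP.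
by apply: f0; rewrite (morphDB fD) fxy subrr.
Qed.

Definition is_unit (A : cstar_algebra R) (e : A) := forall x, e ⋅ x = x /\ x ⋅ e = x.

Lemma unit_adj A (e : A) : is_unit e -> e^† = e.
Proof. by move=> eu; rewrite -[RHS]cadjK -[in RHS](eu e^†).1 cadjM cadjK (eu _).1. Qed.

End StarHomRange.

Section MatrixSystems.
Variable R : realType.
Local Notation C := R[i].

(* theta d i j stands for d ⊗ e_ij, for matrix units e_ij. *)
Definition mx_system (D E : cstar_algebra R) (theta : D -> nat -> nat -> E) :=
  [/\ forall i j, linear (fun d => theta d i j),
      forall d i j d' k l,
        theta d i j ⋅ theta d' k l = (j == k)%:R *: theta (d ⋅ d') i l
    & forall d i j, (theta d i j)^† = theta d^† j i].

Definition theta_range (D E : cstar_algebra R) (theta : D -> nat -> nat -> E) :=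
  [set x | exists d i j, x = theta d i j].

(** The form in which D ⊗ K enters the argument. Injectivity at the place (0, 0) is enough because,
    for unital D, matrix units move every entry there. *)
Definition stable_system (D E : cstar_algebra R) (theta : D -> nat -> nat -> E) :=
  [/\ mx_system theta, forall d, theta d 0%N 0%N = 0 -> d = 0
    & nrm_dense (lin_span (theta_range theta))].

Section Basics.
Variables (D E : cstar_algebra R) (theta : D -> nat -> nat -> E).
Hypothesis mxt : mx_system theta.

Lemma thetaD i j : {morph (fun d => theta d i j) : x y / x + y}.
Proof. by case: mxt => h _ _; apply: linear_morphD. Qed.

Lemma thetaZ c d i j : theta (c *: d) i j = c *: theta d i j.
Proof. by case: mxt => h _ _; apply: (linear_morphZ (h i j)). Qed.

Lemma theta0 i j : theta 0 i j = 0.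
Proof. exact: (morphD0 (thetaD i j)). Qed.

Lemma thetaM d i j d' k l :
  theta d i j ⋅ theta d' k l = (j == k)%:R *: theta (d ⋅ d') i l.
Proof. by case: mxt. Qed.

Lemma thetaMe d i j d' l : theta d i j ⋅ theta d' j l = theta (d ⋅ d') i l.
Proof. by rewrite thetaM eqxx scale1r. Qed.

Lemma thetaJ d i j : (theta d i j)^† = theta d^† j i.
Proof. by case: mxt. Qed.

Lemma theta_sum i j (I : Type) (r : seq I) (P : pred I) (F : I -> D) :
  theta (\sum_(k <- r | P k) F k) i j = \sum_(k <- r | P k) theta (F k) i j.
Proof. exact: (morphD_sum (thetaD i j)). Qed.

Lemma theta_star_hom i : is_star_hom (fun d => theta d i i).
Proof.
split=> [c x y|x y|x]; first by rewrite thetaD thetaZ.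
  by rewrite thetaMe.
by rewrite thetaJ.
Qed.

(** Multiplying by the adjoint moves the entry to the diagonal, where [theta] is a homomorphism and
    hence contractive. *)
Lemma theta_badd i j : badd (fun d => theta d i j).
Proof.
split; first exact: thetaD.
exists 1 => d; rewrite mul1r -(ler_pXn2r (n := 2)) ?nnegrE ?nrm_ge0//.
rewrite -!nrm_star thetaJ thetaMe; exact: (star_hom_contractive (theta_star_hom j)).
Qed.

(* The column of the a_k is an element whose square vanishes. *)
Lemma sum_adj_mul_eq0 (I : finType) (a : I -> D) :
  (forall d, theta d 0%N 0%N = 0 -> d = 0) ->
  \sum_k (a k)^† ⋅ a k = 0 -> forall k, a k = 0.
Proof.
move=> inj s0; pose c := \sum_k theta (a k) (enum_rank k) 0.
have c0 : c = 0.
  apply: cstar_eq0; transitivity (theta (\sum_k (a k)^† ⋅ a k) 0 0); last by rewrite s0 theta0.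
  rewrite theta_sum cadj_sum cmul_suml; apply: eq_bigr => k _.
  rewrite cmul_sumr -(sum_delta (fun l => theta ((a k)^† ⋅ a l) 0 0) k).
  apply: eq_bigr => l _; rewrite thetaJ thetaM; congr (_%:R *: _); congr (nat_of_bool _).
  by rewrite -(inj_eq enum_rank_inj k l) -val_eqE.
move=> k; apply: cstar_eq0; apply: inj.
have : theta (a k)^† 0 (enum_rank k) ⋅ c = 0 by rewrite c0 cmul0r.
rewrite cmul_sumr => <-; rewrite -[LHS](sum_delta (fun l => theta ((a k)^† ⋅ a l) 0 0) k).
apply: eq_bigr => l _; rewrite thetaM; congr (_%:R *: _); congr (nat_of_bool _).
by rewrite -(inj_eq enum_rank_inj k l) -val_eqE.
Qed.

End Basics.

Section Extension.
Variables (D E : cstar_algebra R) (theta : D -> nat -> nat -> E) (e : D).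
Hypothesis st : stable_system theta.
Hypothesis eu : is_unit e.

Let mxt : mx_system theta. Proof. by case: st. Qed.

Lemma stable_ext_eq (F : normedModType C) (f g : E -> F) : badd f -> badd g ->
  (forall d i j, f (theta d i j) = g (theta d i j)) -> f =1 g.
Proof.
case: st => _ _ dS bf bg fg; apply: (badd_dense_eq bf bg dS).
by move=> c _ [d [i [j ->]]]; rewrite -(thetaZ mxt).
Qed.

(** The d on which [f] and [g] agree form a closed *-subalgebra. Agreement is asked at all places
    (i, j) simultaneously because the adjoint exchanges the indices. *)
Lemma stable_star_hom_eq (F : cstar_algebra R) (G : set D) (f g : E -> F) :
  generates G -> is_star_hom f -> is_star_hom g ->
  (forall d, G d -> forall i j, f (theta d i j) = g (theta d i j)) -> f =1 g.
Proof.
move=> genG hf hg fg.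
have bf := star_hom_badd hf; have bg := star_hom_badd hg.
apply: stable_ext_eq => // d i j.
have [fL fM fJ] := hf; have [gL gM gJ] := hg.
suff : [set d | forall i j, f (theta d i j) = g (theta d i j)] = setT.
  by move=> /seteqP[_ /(_ d I)].
apply: genG => //.
- apply/closed_nrmP => x hx k l.
  have bt := theta_badd mxt k l.
  have /closed_nrmP := badd_eq_closed (badd_comp bf bt) (badd_comp bg bt).
  by apply=> r /hx[y hy xy]; exists y => //=; exact: hy.
- split=> /= [k l|c x y hx hy k l|x y hx hy k l|x hx k l].
  + by rewrite (theta0 mxt) (morphD0 bf.1) (morphD0 bg.1).
  + by rewrite (thetaD mxt) (thetaZ mxt) fL gL hx hy.
  + by rewrite -(thetaMe mxt _ k k) fM gM hx hy.
  + by rewrite -(thetaJ mxt) fJ gJ hx.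
Qed.

Lemma theta_unitl d i j k l : theta e i j ⋅ theta d k l = (j == k)%:R *: theta d i l.
Proof. by rewrite (thetaM mxt) (eu d).1. Qed.

Lemma theta_unitr d i j k l : theta d i j ⋅ theta e k l = (j == k)%:R *: theta d i l.
Proof. by rewrite (thetaM mxt) (eu d).2. Qed.

Definition approx_unit n : E := \sum_(i < n) theta e i i.
Local Notation P := approx_unit.

Lemma approx_unitJ n : (P n)^† = P n.
Proof.
by rewrite cadj_sum; apply: eq_bigr => i _; rewrite (thetaJ mxt) unit_adj.
Qed.

Lemma sum_ord_delta (F : normedModType C) n k (G : nat -> F) :
  \sum_(i < n) (i == k :> nat)%:R *: G i = (k < n)%:R *: G k.
Proof.
case: (ltnP k n) => kn.
  rewrite (bigD1 (Ordinal kn))//= eqxx !scale1r big1 ?addr0// => i ik.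
  by rewrite (_ : (i == k :> nat) = false) ?scale0r//; apply/negbTE.
by rewrite scale0r big1// => i _; rewrite ltn_eqF ?scale0r// (leq_trans _ kn).
Qed.

Lemma approx_unit_theta n d i j : P n ⋅ theta d i j = (i < n)%:R *: theta d i j.
Proof.
rewrite cmul_suml -(sum_ord_delta n i (fun k => theta d k j)).
by apply: eq_bigr => k _; rewrite theta_unitl.
Qed.

Lemma theta_approx_unit n d i j : theta d i j ⋅ P n = (j < n)%:R *: theta d i j.
Proof.
rewrite cmul_sumr -(sum_ord_delta n j (fun k => theta d i k)).
by apply: eq_bigr => k _; rewrite theta_unitr eq_sym.
Qed.

Lemma approx_unitM m n : P m ⋅ P n = P (minn m n).
Proof.
rewrite cmul_sumr; apply: esym; have h := geq_minr m n.
rewrite /approx_unit (big_ord_widen n (fun i => theta e i i) h).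
rewrite big_mkcond; apply: eq_bigr => i _; rewrite approx_unit_theta leq_min ltn_ord andbT.
by case: (i < m)%N; rewrite ?scale1r ?scale0r.
Qed.

Lemma projection_le1 (A : cstar_algebra R) (p : A) : p^† = p -> p ⋅ p = p -> nrm p <= 1.
Proof.
move=> pJ pp; have := nrm_star p; rewrite pJ pp => h; have := nrm_ge0 p.
by move: (nrm p) h => r; clear pJ pp; nra.
Qed.

Lemma approx_unit_le1 n : nrm (P n) <= 1.
Proof. by apply: projection_le1; [exact: approx_unitJ|rewrite approx_unitM minnn]. Qed.

Definition corner n x : E := P n ⋅ x ⋅ P n.

Lemma cornerD n : {morph corner n : x y / x + y}.
Proof. by move=> x y; rewrite /corner cmulDr cmulDl. Qed.

Lemma cornerZ n c x : corner n (c *: x) = c *: corner n x.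
Proof. by rewrite /corner cmulZr cmulZl. Qed.

Lemma corner_le n x : nrm (corner n x) <= nrm x.
Proof.
have p1 := approx_unit_le1 n; have h1 := nrmM (P n ⋅ x) (P n).
have h2 := nrmM (P n) x; rewrite /corner.
have := nrm_ge0 x; have := nrm_ge0 (P n); have := nrm_ge0 (P n ⋅ x).
by nra.
Qed.

Lemma corner_badd n : badd (corner n).
Proof. by split; [exact: cornerD|exists 1 => x; rewrite mul1r corner_le]. Qed.

Lemma corner_corner m n x : corner m (corner n x) = corner (minn m n) x.
Proof.
by rewrite /corner !cmulA approx_unitM -(cmulA _ (P n) (P m)) approx_unitM minnC.
Qed.

Lemma corner_lim x : seq_lim (fun n => corner n x) x.
Proof.
move=> d d0; case: st => _ _ dS; have [y Sy xy] := dS x (d / 2) (divr_gt0 d0 (ltr0Sn _ 1)).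
have [N hN] : exists N, forall n, (N <= n)%N -> corner n y = y.
  have [m [c [u [Su ->]]]] := Sy.
  have /choice[N hN] : forall i : 'I_m, exists N, forall n, (N <= n)%N -> corner n (u i) = u i.
    move=> i; have [a [k [l ->]]] := Su i; exists (maxn k l).+1 => n.
    rewrite gtn_max => /andP[kn ln].
    by rewrite /corner approx_unit_theta kn scale1r theta_approx_unit ln scale1r.
  exists (\max_i N i) => n Nn; rewrite (morphD_sum (cornerD n)); apply: eq_bigr => i _.
  by rewrite cornerZ hN// (leq_trans _ Nn)// leq_bigmax.
exists N => n /hN cy; apply: le_lt_trans (nrm_triangle y _ _) _.
rewrite -{1}cy -(morphDB (cornerD n)) [d]splitr [nrm (y - x)]nrm_dist ltr_leD// 1?ltW//.
by rewrite (le_lt_trans (corner_le _ _))// nrm_dist.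
Qed.

(** The compression sends the dense span into the range of [theta _ 0 0], and this range is closed
    because an injective homomorphism is isometric. *)
Lemma corner_range x : exists d, theta e 0 0 ⋅ x ⋅ theta e 0 0 = theta d 0 0.
Proof.
have inj : injective (fun d => theta d 0%N 0%N).
  by apply: (is_star_hom_injP (theta_star_hom mxt 0)); case: st.
have cl := star_hom_range_closed (theta_star_hom mxt 0) inj.
suff : [set x | range (fun d => theta d 0%N 0%N) (theta e 0 0 ⋅ x ⋅ theta e 0 0)] x.
  by move=> [d _ hd]; exists d.
move: cl => /closed_nrmP cl; apply: cl => d d0; case: st => _ _ dS.
have bb : badd (fun x => theta e 0 0 ⋅ x ⋅ theta e 0 0).
  by apply: (badd_comp (badd_cmulr _)); exact: badd_cmull.
have [K K0 hK] := baddK bb.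
have [y [m [c [u [Su ->]]]] xy] := dS x (d / K) (divr_gt0 d0 K0).
exists (theta e 0 0 ⋅ (\sum_i c i *: u i) ⋅ theta e 0 0).
  have /choice[w hw] : forall i, exists w, theta e 0 0 ⋅ u i ⋅ theta e 0 0 = theta w 0 0.
    move=> i; have [a [k [l ->]]] := Su i.
    exists ((0%N == k)%:R *: ((l == 0%N)%:R *: a)).
    by rewrite theta_unitl cmulZl theta_unitr !(thetaZ mxt).
  exists (\sum_i c i *: w i) => //; rewrite (theta_sum mxt) (morphD_sum bb.1).
  by apply: eq_bigr => i _; rewrite (thetaZ mxt) cmulZr cmulZl hw.
rewrite -(morphDB bb.1); apply: le_lt_trans (hK _) _.
by move: xy; rewrite ltr_pdivlMr// mulrC.
Qed.

Lemma coord_ex : exists co : nat -> nat -> E -> D,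
  forall i j x, theta e 0 i ⋅ x ⋅ theta e j 0 = theta (co i j x) 0 0.
Proof.
have /choice[co hco] : forall p : nat * nat * E, exists d,
    theta e 0 p.1.1 ⋅ p.2 ⋅ theta e p.1.2 0 = theta d 0 0.
  move=> [[i j] x] /=.
  have [d hd] := corner_range (theta e 0 i ⋅ x ⋅ theta e j 0).
  exists d; rewrite -hd !cmulA theta_unitl scale1r -!cmulA.
  by rewrite theta_unitr scale1r.
by exists (fun i j x => co (i, j, x)) => i j x; rewrite -(hco (i, j, x)).
Qed.

End Extension.
End MatrixSystems.

(** * Homomorphisms prescribed on matrix entries *)

Section StableExtension.
Variable R : realType.
Local Notation C := R[i].
Variables (D E E' : cstar_algebra R) (theta : D -> nat -> nat -> E) (e : D).
Variable theta' : D -> nat -> nat -> E'.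
Hypothesis st : stable_system theta.
Hypothesis eu : is_unit e.
Hypothesis mxt' : mx_system theta'.

Let mxt : mx_system theta. Proof. by case: st. Qed.
Let inj d : theta d 0%N 0%N = 0 -> d = 0.
Proof. by case: st => _ h _; exact: h. Qed.

Lemma theta00_inj : injective (fun d => theta d 0%N 0%N).
Proof. exact: (is_star_hom_injP (theta_star_hom mxt 0) inj). Qed.

Section Coordinates.
Variable co : nat -> nat -> E -> D.
Hypothesis coE : forall i j x, theta e 0 i ⋅ x ⋅ theta e j 0 = theta (co i j x) 0 0.
Local Notation P := (approx_unit theta e).
Local Notation corner := (corner theta e).

Lemma coD i j : {morph co i j : x y / x + y}.
Proof.
move=> x y; apply: theta00_inj; rewrite /= (thetaD mxt) -!coE.
by rewrite cmulDr cmulDl.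
Qed.

Lemma coZ i j (c : C) x : co i j (c *: x) = c *: co i j x.
Proof. by apply: theta00_inj; rewrite /= (thetaZ mxt) -!coE cmulZr cmulZl. Qed.

Lemma coJ i j x : co i j x^† = (co j i x)^†.
Proof.
apply: theta00_inj; rewrite /= -(thetaJ mxt) -!coE !cadjM !(thetaJ mxt).
by rewrite (unit_adj eu) cmulA.
Qed.

Lemma co_theta i j d k l : co i j (theta d k l) = (i == k)%:R *: ((l == j)%:R *: d).
Proof.
apply: theta00_inj; rewrite /= !(thetaZ mxt) -coE.
by rewrite (theta_unitl st eu) cmulZl (theta_unitr st eu).
Qed.

Lemma co_corner n i j x : co i j (corner n x) = (i < n)%:R *: ((j < n)%:R *: co i j x).
Proof.
apply: theta00_inj; rewrite /= !(thetaZ mxt) -!coE /corner !cmulA.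
rewrite (theta_approx_unit st eu) -!cmulA (approx_unit_theta st eu).
by rewrite !cmulZr !cmulZl !cmulA scalerA [RHS]scalerA mulrC.
Qed.

Lemma co_mul n i k x y : co i k (x ⋅ P n ⋅ y) = \sum_(j < n) co i j x ⋅ co j k y.
Proof.
apply: theta00_inj; rewrite /= (theta_sum mxt) -coE.
rewrite cmul_sumr !(cmul_suml, cmul_sumr); apply: eq_bigr => j _.
rewrite -(thetaMe mxt _ 0 0) -!coE !cmulA; congr (_ ⋅ _ ⋅ _).
by rewrite -[in RHS](cmulA _ (theta e j 0)) (thetaMe mxt) (eu e).1.
Qed.

(** [co i j x] is the (i, j) entry of x; the n x n truncation of x is rebuilt from its entries
    inside E'. *)
Definition fext n x : E' := \sum_(i < n) \sum_(j < n) theta' (co i j x) i j.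

Lemma fextD n : {morph fext n : x y / x + y}.
Proof.
move=> x y; rewrite /fext -big_split; apply: eq_bigr => i _.
by rewrite -big_split; apply: eq_bigr => j _; rewrite coD (thetaD mxt').
Qed.

Lemma fextZ n c x : fext n (c *: x) = c *: fext n x.
Proof.
rewrite /fext scaler_sumr; apply: eq_bigr => i _.
by rewrite scaler_sumr; apply: eq_bigr => j _; rewrite coZ (thetaZ mxt').
Qed.

Lemma fextJ n x : fext n x^† = (fext n x)^†.
Proof.
rewrite /fext exchange_big cadj_sum; apply: eq_bigr => i _.
by rewrite cadj_sum; apply: eq_bigr => j _; rewrite coJ (thetaJ mxt').
Qed.

Lemma fextM n x y : fext n (x ⋅ P n ⋅ y) = fext n x ⋅ fext n y.
Proof.
rewrite /fext cmul_suml; apply: eq_bigr => i _; rewrite cmul_suml.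
under eq_bigr => k _ do rewrite co_mul (theta_sum mxt').
rewrite exchange_big; apply: eq_bigr => j _ /=; apply: esym; rewrite cmul_sumr.
rewrite (eq_bigr (fun k : 'I_n => (j == k :> nat)%:R *: \sum_(l < n)
   theta' (co i j x ⋅ co k l y) i l)); last first.
  move=> k _; rewrite cmul_sumr scaler_sumr; apply: eq_bigr => l _.
  by rewrite (thetaM mxt').
under eq_bigr do rewrite eq_sym.
rewrite (sum_ord_delta n j (fun k => \sum_(l < n) theta' (co i j x ⋅ co k l y) i l)).
by rewrite ltn_ord scale1r.
Qed.

Lemma fext_theta n d i j : (i < n)%N -> (j < n)%N -> fext n (theta d i j) = theta' d i j.
Proof.
move=> i_n jn; rewrite /fext (eq_bigr (fun k : 'I_n => (k == i :> nat)%:R *: theta' d k j)).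
  by rewrite (sum_ord_delta n i (fun k => theta' d k j)) i_n scale1r.
move=> k _; under eq_bigr do rewrite co_theta !(thetaZ mxt').
rewrite -scaler_sumr; congr (_ *: _).
rewrite (eq_bigr (fun l : 'I_n => (l == j :> nat)%:R *: theta' d k l)).
  by rewrite (sum_ord_delta n j (fun l => theta' d k l)) jn scale1r.
by move=> l _; rewrite eq_sym.
Qed.

Lemma fext_corner m n x : (n <= m)%N -> fext m (corner n x) = fext n x.
Proof.
move=> nm; rewrite /fext (big_ord_widen m (fun i => \sum_(j < n) theta' (co i j x) i j) nm).
rewrite [RHS]big_mkcond; apply: eq_bigr => i _.
case: ifP => i_n; last first.
  by rewrite big1// => j _; rewrite co_corner i_n scale0r (theta0 mxt').
rewrite (big_ord_widen m (fun j => theta' (co i j x) i j) nm) [RHS]big_mkcond.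
apply: eq_bigr => j _; rewrite co_corner i_n scale1r.
by case: ifP => _; rewrite ?scale1r// scale0r (theta0 mxt').
Qed.

(** The n-th corner is a closed *-subalgebra on which [fext n] is a homomorphism. Contractivity is
    then automatic, whereas estimating the double sum would give a bound growing with n. *)
Lemma fext_contractive n x : corner n x = x -> nrm (fext n x) <= nrm x.
Proof.
move=> cx; pose S := [set y | corner n y = y].
have cornerP y : corner n y = y -> P n ⋅ y = y /\ y ⋅ P n = y.
  move=> <-; rewrite /corner !cmulA (approx_unitM st eu) minnn; split=> //.
  by rewrite -!cmulA (approx_unitM st eu) minnn.
apply: (@star_hom_on_contractive _ _ _ S) => //.
- by apply: badd_eq_closed; [exact: corner_badd|exact: badd_id].
- split=> /= [|c y z hy hz|y z /cornerP[hy _] /cornerP[_ hz]|y /cornerP[h1 h2]].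
  + exact: (morphD0 (cornerD _ _ _)).
  + by rewrite /S /= cornerD cornerZ hy hz.
  + by rewrite /S /= /corner cmulA hy -cmulA hz.
  + rewrite /S /= /corner -[X in X ⋅ _ ⋅ _](approx_unitJ st eu) -cadjM h2.
    by rewrite -[X in _ ⋅ X](approx_unitJ st eu) -cadjM h1.
- split=> /= [c y z _ _|y z /cornerP[_ hy] _|y _]; last exact: fextJ.
    by rewrite fextD fextZ.
  by rewrite -fextM hy.
Qed.

Lemma fext_le n x : nrm (fext n x) <= nrm x.
Proof.
rewrite -(fext_corner x (leqnn n)); apply: le_trans (corner_le st eu n x).
by apply: fext_contractive; rewrite (corner_corner st eu) minnn.
Qed.

Lemma fext_cauchy x (d : R) : 0 < d -> exists N, forall m n, (N <= n)%N -> (n <= m)%N ->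
  nrm (fext m x - fext n x) < d.
Proof.
move=> d0; have [N hN] := corner_lim st eu x (divr_gt0 d0 (ltr0Sn _ 1)).
exists N => m n Nn nm.
rewrite -(fext_corner x (leqnn m)) -(fext_corner x nm) -(morphDB (fextD m)).
apply: le_lt_trans (fext_le _ _) _.
apply: le_lt_trans (nrm_triangle x _ _) _.
by rewrite [d]splitr ltrD ?hN// 1?[nrm (x - _)]nrm_dist ?hN// (leq_trans Nn).
Qed.

End Coordinates.

(* Nuclearity of the compact operators in disguise: all C*-norms on the span
   of the theta d i j agree. *)
Lemma stable_extension : exists F : E -> E',
  is_star_hom F /\ forall d i j, F (theta d i j) = theta' d i j.
Proof.
have [co coE] := coord_ex st eu.
have /choice[F hF] x : exists l, seq_lim (fun n => fext co n x) l.
  by apply: nrm_complete => d d0; exact: fext_cauchy.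
have bF : badd F.
  split=> [x y|].
    apply: (seq_lim_unique (hF _)) => d d0; have d2 : 0 < d / 2 by rewrite divr_gt0.
    have [N hN] := hF x _ d2; have [M hM] := hF y _ d2.
    exists (maxn N M) => n; rewrite geq_max => /andP[Nn Mn].
    rewrite (fextD coE) opprD addrACA; apply: le_lt_trans (nrmD _ _) _.
    by rewrite [d]splitr ltrD ?hN ?hM.
  exists 1 => x; rewrite mul1r; apply/ler_addgt0Pr => d d0.
  have [N /(_ N (leqnn N)) hN] := hF x d d0.
  rewrite -[F x](subrK (fext co N x)); apply: le_trans (nrmD _ _) _.
  by rewrite addrC lerD ?(fext_le coE)// nrm_dist ltW.
have Ft d i j : F (theta d i j) = theta' d i j.
  apply: (seq_lim_unique (hF _)) => r r0; exists (maxn i j).+1 => n.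
  by rewrite gtn_max => /andP[i_n jn]; rewrite (fext_theta coE)// subrr nrm0.
have FM x y : F (x ⋅ y) = F x ⋅ F y.
  move: x; apply: (stable_ext_eq st) => [||d i j].
  - by apply: (badd_comp bF); exact: badd_cmulr.
  - exact: (badd_comp (badd_cmulr _) bF).
  move: y; apply: (stable_ext_eq st) => [||d' k l].
  - by apply: (badd_comp bF); exact: badd_cmull.
  - exact: (badd_comp (badd_cmull _) bF).
  by rewrite (thetaM mxt) -(thetaZ mxt) !Ft (thetaM mxt') (thetaZ mxt').
exists F; split=> //; split=> //.
  move=> c x y; rewrite bF.1; congr (_ + _); move: x.
  apply: (stable_ext_eq st) => [||d i j].
  - by apply: (badd_comp bF); exact: badd_scale.
  - exact: (badd_comp (badd_scale _ _) bF).
  - by rewrite -(thetaZ mxt) !Ft (thetaZ mxt').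
apply: (stable_ext_eq st) => [||d i j].
- by apply: (badd_comp bF); exact: badd_cadj.
- exact: (badd_comp (@badd_cadj _ _) bF).
- by rewrite (thetaJ mxt) !Ft (thetaJ mxt').
Qed.

End StableExtension.

(** * Graph algebras and their stabilizations *)

Section GraphFamilies.
Variables (R : realType) (V : finType) (A : V -> V -> nat) (D : cstar_algebra R).
Variables (P : V -> D) (S : edge A -> D).
Hypothesis gf : is_graph_family P S.

Lemma vertex_adj v : (P v)^† = P v.
Proof. by case: gf => h _ _ _ _; case: (h v). Qed.

Lemma vertex_mul v w : P v ⋅ P w = (v == w)%:R *: P v.
Proof.
case: gf => h h' _ _ _; case: eqVneq => [<-|/h' ->]; last by rewrite scale0r.
by rewrite scale1r; case: (h v).
Qed.

Lemma edge_initial e : (S e)^† ⋅ S e = P (edge_range e).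
Proof. by case: gf. Qed.

Lemma edge_mul_range e : S e ⋅ P (edge_range e) = S e.
Proof. by case: gf => _ _ h _ _; rewrite -edge_initial cmulA h. Qed.

Lemma edge_mul_vertex e v : S e ⋅ P v = (edge_range e == v)%:R *: S e.
Proof. by rewrite -edge_mul_range -cmulA vertex_mul cmulZr. Qed.

Lemma vertex_sum v : P v = \sum_(e : edge A | edge_source e == v) S e ⋅ (S e)^†.
Proof. by case: gf. Qed.

(** Stands for the positivity of sums of elements [x^† ⋅ x]; for the algebras at hand it is supplied
    by [sum_adj_mul_eq0], that is, by matrix units. *)
Hypothesis pos : forall (a : edge A -> D),
  \sum_k (a k)^† ⋅ a k = 0 -> forall k, a k = 0.

(* With Q f = S f S_f^*, the projections (1 - P) and Q f compressed to Q e add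
   up to 0 when f runs over the other edges with the same source as e. *)
Lemma edge_projections e : P (edge_source e) ⋅ S e = S e /\
  forall f, f != e -> edge_source f = edge_source e -> (S f)^† ⋅ S e = 0.
Proof.
pose Q f := S f ⋅ (S f)^†; set v := edge_source e.
have QJ f : (Q f)^† = Q f by rewrite cadjM cadjK.
have SQ f : Q f ⋅ S f = S f by rewrite -cmulA edge_initial edge_mul_range.
have QQ f : Q f ⋅ Q f = Q f by rewrite {2}/Q cmulA SQ.
have QE f : S f ⋅ (S f)^† = Q f by [].
clearbody Q.
pose a f := if f == e then Q e - P v ⋅ Q e else
  if edge_source f == v then Q f ⋅ Q e else 0.
have QPQ : Q e ⋅ P v ⋅ Q e =
    Q e + \sum_(f | f != e) (if edge_source f == v then Q e ⋅ Q f ⋅ Q e else 0).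
  rewrite vertex_sum cmul_sumr cmul_suml (bigD1 e)//= QE !QQ; congr (_ + _).
  rewrite -big_mkcondr; apply: eq_big => f; first by rewrite andbC.
  by rewrite QE.
have a0 : forall k, a k = 0.
  apply: pos; rewrite (bigD1 e)//= {1 2}/a eqxx.
  have -> : (Q e - P v ⋅ Q e)^† ⋅ (Q e - P v ⋅ Q e) = Q e - Q e ⋅ P v ⋅ Q e.
    rewrite cadjB cadjM vertex_adj QJ cmulBl !cmulBr QQ !cmulA.
    rewrite -(cmulA (Q e) (P v) (P v)) vertex_mul eqxx scale1r.
    by rewrite -(cmulA (Q e) (P v)); module.
  rewrite QPQ opprD addrA subrr add0r addrC; apply/eqP; rewrite subr_eq0; apply/eqP.
  apply: eq_bigr => f /negbTE fe; rewrite /a fe; case: ifP => _; last by rewrite cmul0r.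
  by rewrite cadjM !QJ cmulA -(cmulA (Q e) (Q f) (Q f)) QQ.
have PS : P v ⋅ S e = S e.
  have := a0 e; rewrite /a eqxx => /eqP; rewrite subr_eq0 => /eqP h.
  by rewrite -{1}SQ cmulA -h SQ.
split=> // f fe sf; have := a0 f; rewrite /a (negbTE fe) sf eqxx => h.
have SJ g : (S g)^† ⋅ Q g = (S g)^† by rewrite -QJ -cadjM SQ.
by rewrite -SJ -(SQ e) cmulA -(cmulA _ (Q f)) h cmul0r cmul0l.
Qed.

Lemma vertex_mul_edge v e : P v ⋅ S e = (edge_source e == v)%:R *: S e.
Proof.
by rewrite -(edge_projections e).1 cmulA vertex_mul eq_sym cmulZl; case: eqVneq => [->|]; rewrite ?scale0r.
Qed.

Lemma edge_orth e f : (S e)^† ⋅ S f = (e == f)%:R *: P (edge_range e).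
Proof.
have [->|ef] := eqVneq e f; first by rewrite edge_initial scale1r.
rewrite scale0r; have [_ h] := edge_projections f.
have [sf|sf] := eqVneq (edge_source e) (edge_source f); first exact: h.
rewrite -(edge_projections e).1 -(edge_projections f).1 cadjM vertex_adj cmulA.
by rewrite -(cmulA (S e)^†) vertex_mul (negbTE sf) scale0r cmul0r cmul0l.
Qed.

End GraphFamilies.

Section GraphAlgebraUnit.
Variables (R : realType) (V : finType) (A : V -> V -> nat) (D : graph_algebra R A).
Local Notation P := (vertex_proj D).
Local Notation S := (edge_isom D).
Hypothesis pos : forall (a : edge A -> D),
  \sum_k (a k)^† ⋅ a k = 0 -> forall k, a k = 0.

(** The elements fixed by e on both sides form a closed *-subalgebra. That it contains the edges
    rests on [edge_projections]: the relations do not state that the source projection fixes an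
    edge. *)
Lemma graph_algebra_unit : is_unit (\sum_v P v).
Proof.
have gf := graph_familyP D; set e := \sum_v P v.
have eJ : e^† = e by rewrite cadj_sum; apply: eq_bigr => v _; rewrite (vertex_adj gf).
have eP v : e ⋅ P v = P v /\ P v ⋅ e = P v.
  rewrite cmul_suml cmul_sumr; split.
    rewrite -[RHS](sum_deltar (fun w => P w) v); apply: eq_bigr => w _.
    by rewrite (vertex_mul gf).
  rewrite -[RHS](sum_delta (fun w => P v) v); apply: eq_bigr => w _.
  by rewrite (vertex_mul gf).
have eS f : e ⋅ S f = S f /\ S f ⋅ e = S f.
  split.
    by rewrite -(edge_projections gf pos f).1 cmulA (eP _).1.
  by rewrite -(edge_mul_range gf) -cmulA (eP _).2.
have : [set x | e ⋅ x = x] `&` [set x | x ⋅ e = x] = setT; last first.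
  by move=> /seteqP[_ h] x; have := h x I; case.
apply: (graph_generated (g := D)).
- apply: closedI; apply: badd_eq_closed; try exact: badd_id.
    exact: badd_cmull.
  exact: badd_cmulr.
- split=> /= [|c x y [h1 h2] [h3 h4]|x y [h1 h2] [h3 h4]|x [h1 h2]]; rewrite /setI /=.
  + by rewrite cmul0l cmul0r.
  + by rewrite cmulDr cmulDl cmulZr cmulZl h1 h2 h3 h4.
  + by rewrite cmulA h1 -cmulA h4.
  + by rewrite -[in e ⋅ _]eJ -[in _ ⋅ e]eJ -!cadjM h1 h2.
- move=> x [[v _ <-]|[f _ <-]]; first exact: eP.
  exact: eS.
Qed.

End GraphAlgebraUnit.

(** * Matrix systems in an arbitrary completion of D ⊗ K *)

Section TensorSystems.
Variables (R : realType) (D K : cstar_algebra R) (T : cstar_tensor D K).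
Variable u : nat -> nat -> K.
Hypothesis mu : is_matrix_units u.
Local Notation C := R[i].

Definition tensor_theta d i j : T := ctens T d (u i j).

Lemma tensor_mx_system : mx_system tensor_theta.
Proof.
have [uM uJ _ _] := mu; split.
- by move=> i j; exact: ctens_linearl.
- move=> d i j d' k l; rewrite /tensor_theta ctensM uM.
  by rewrite (linear_morphZ (ctens_linearr T _)).
- by move=> d i j; rewrite /tensor_theta ctens_adj uJ.
Qed.

Lemma tensor_theta_inj d : tensor_theta d 0%N 0%N = 0 -> d = 0.
Proof.
have [_ _ u0 _] := mu => h; apply: contrapT => d0; apply: u0.
apply: (@ctens_inj _ _ _ T 1 (fun=> d) (fun=> u 0%N 0%N)).
- move=> c; rewrite big_ord1 => /eqP; rewrite scaler_eq0 => /orP[/eqP c0 i|/eqP//].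
  by rewrite ord1.
- by rewrite big_ord1.
- exact: ord0.
Qed.

Lemma ctensZl c d k : ctens T (c *: d) k = c *: ctens T d k.
Proof. exact: (linear_morphZ (ctens_linearl T k)). Qed.
Lemma ctensDl k : {morph (fun d => ctens T d k) : x y / x + y}.
Proof. exact: (linear_morphD (ctens_linearl T k)). Qed.

Variable e : D.
Hypothesis eu : is_unit e.

(* A self-adjoint contraction is the real part of a unitary w, and
   (w ⊗ k)^* (w ⊗ k) = 1 ⊗ k^* k. *)
Lemma ctens_sa_le d k : d^† = d -> nrm d <= 1 -> nrm (ctens T d k) <= nrm k.
Proof.
move=> dJ d1.
have dd1 : nrm (d ⋅ d) <= 1 by rewrite -{1}dJ nrm_star expr_le1// nrm_ge0.
have [|b [eb _ bb bC _]] := sqrt_compl_sa dd1; first by rewrite cadjM dJ.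
have db : d ⋅ b = b ⋅ d by apply: bC; rewrite cmulA.
set v := ctens T d k; set w := ctens T (e - b) k.
have ek : nrm (ctens T e (k^† ⋅ k)) <= nrm k ^+ 2.
  rewrite -nrm_star; apply: (@star_hom_contractive _ _ _ (fun a => ctens T e a)).
  split; first exact: ctens_linearr.
  by move=> x y; rewrite ctensM (eu e).1.
  by move=> x; rewrite ctens_adj (unit_adj eu).
have vw : v^† ⋅ w = w^† ⋅ v.
  rewrite !ctens_adj !ctensM cadjB (unit_adj eu) bb dJ cmulBl cmulBr.
  by rewrite (eu d).1 (eu d).2 db.
have vv : v^† ⋅ v + w^† ⋅ w = ctens T e (k^† ⋅ k).
  rewrite !ctens_adj !ctensM -ctensDl cadjB (unit_adj eu) bb dJ eb cmulBl !cmulBr.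
  rewrite (eu e).1 (eu b).1 (eu b).2; congr (ctens T _ _); module.
have n (c : C) : c^* = - c -> c * c = -1 -> nrm (v + c *: w) <= nrm k.
  move=> cJ cc; rewrite -(ler_pXn2r (n := 2)) ?nnegrE ?nrm_ge0//.
  by rewrite -nrm_star rotated_norm// vv.
have n1 := n _ (conj_imaginary R) (mul_imaginary R); have := n (- 'i%C).
rewrite rmorphN /= conj_imaginary mulrNN mul_imaginary => /(_ erefl erefl) n2.
have := nrmD (v + 'i%C *: w) (v + - 'i%C *: w).
have -> : v + 'i%C *: w + (v + - 'i%C *: w) = (2 : R)%:C *: v.
  have -> : (2 : R)%:C = 1 + 1 :> C by rewrite rmorph_nat.
  module.
by rewrite nrm_scale ger0_norm//; move: n1 n2; clear; lra.
Qed.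

(** Real and imaginary parts reduce d to self-adjoint x; dividing by |x| + 1 rather than |x| makes x
    a contraction without a case distinction at 0. *)
Lemma ctens_badd d : badd (ctens T d).
Proof.
split; first exact: (linear_morphD (ctens_linearr T d)).
have sa x : x^† = x -> exists L : R, forall k, nrm (ctens T x k) <= L * nrm k.
  move=> xJ; exists (nrm x + 1) => k.
  have x1 : 0 < nrm x + 1 by rewrite ltr_wpDl ?nrm_ge0.
  have xE : x = (nrm x + 1)%:C *: ((nrm x + 1)^-1%:C *: x).
    by rewrite scalerA -rmorphM /= mulfV ?scale1r// gt_eqF.
  rewrite [X in ctens T X]xE ctensZl nrm_scale gtr0_norm// ler_pM2l//.
  apply: ctens_sa_le; first by rewrite cadjZ conjc_re xJ.
  rewrite nrm_scale gtr0_norm ?invr_gt0// mulrC ler_pdivrMr// mul1r.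
  by rewrite lerDl.
have [L1 h1] : exists L : R, forall k, nrm (ctens T (d + d^†) k) <= L * nrm k.
  by apply: sa; rewrite cadjD cadjK addrC.
have [L2 h2] : exists L : R, forall k, nrm (ctens T ('i%C *: (d - d^†)) k) <= L * nrm k.
  by apply: sa; rewrite cadjZ conj_imaginary cadjB cadjK scaleNr -scalerN opprB.
exists ((L1 + L2) / 2) => k.
have -> : d = 2^-1 *: ((d + d^†) - 'i%C *: ('i%C *: (d - d^†))).
  rewrite scalerA mul_imaginary scaleN1r opprK addrACA subrr addr0.
  have -> : d + d = (2 : C) *: d by rewrite scaler_nat mulr2n.
  by rewrite scalerA mulVf ?pnatr_eq0// scale1r.
rewrite ctensZl nrm_half (morphDB (ctensDl k)) ctensZl mulrAC ler_pM2r//.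
apply: le_trans (nrmB _ _) _; rewrite nrmZ.
have -> : normc ('i%C : C) = 1 by rewrite /= expr0n expr1n add0r sqrtr1.
by rewrite mul1r mulrDl lerD.
Qed.

(** Density is the point: since k ↦ d ⊗ k is bounded, approximating k by combinations of matrix
    units approximates d ⊗ k. *)
Lemma tensor_stable_system : stable_system tensor_theta.
Proof.
split; [exact: tensor_mx_system|exact: tensor_theta_inj|].
have [_ _ _ dK] := mu; have /dense_nrmP dT : dense _ := @ctens_dense _ _ _ T.
move=> x r r0; have r2 : 0 < r / 2 by rewrite divr_gt0.
have [y [n [c [v [Sv ->]]]] xy] := dT x _ r2.
have r3 : 0 < r / 2 / (\sum_i normc (c i) + 1).
  by rewrite divr_gt0// ltr_wpDl// sumr_ge0// => i _; exact: normc_ge0.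
have /choice[w hw] : forall i, exists w, lin_span (theta_range tensor_theta) w /\
    nrm (v i - w) < r / 2 / (\sum_i normc (c i) + 1).
  move=> i; have [d _ [k _ <-]] := Sv i.
  have bd := ctens_badd d; have [L L0 hL] := baddK bd.
  have [z [m [c' [v' [Sv' ->]]]] kz] := dK k _ (divr_gt0 r3 L0).
  exists (ctens T d (\sum_i c' i *: v' i)); split.
    rewrite (linear_comb (ctens_linearr T d)); apply: lin_span_sum => j.
    apply: lin_spanZ; apply: lin_span_incl; have [a [b ->]] := Sv' j.
    by exists d, a, b.
  rewrite -(morphDB bd.1); apply: le_lt_trans (hL _) _.
  by move: kz; rewrite ltr_pdivlMr// mulrC.
exists (\sum_i c i *: w i).
  by apply: lin_span_sum => i; apply: lin_spanZ; exact: (hw i).1.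
apply: le_lt_trans (nrm_triangle (\sum_i c i *: v i) _ _) _.
rewrite [r]splitr ltr_leD// -sumrB; apply: le_trans (nrm_sum _ _ _) _.
apply: (@le_trans _ _ (\sum_i normc (c i) * (r / 2 / (\sum_i normc (c i) + 1)))).
  apply: ler_sum => i _; rewrite -scalerBr nrmZ ler_wpM2l ?normc_ge0//.
  exact: ltW (hw i).2.
rewrite -mulr_suml (mulrA _ (r / 2)) ler_pdivrMr.
  by rewrite mulrC ler_wpM2l ?lerDl// ltW.
by rewrite ltr_wpDl// sumr_ge0// => i _; exact: normc_ge0.
Qed.

End TensorSystems.

(** * Hilbert modules over c(V) *)

Section CfunEval.
Variables (R : realType) (V : finType).
Local Notation C := R[i].
Local Notation cV := (cfun_algebra R V).

Definition ev (a : cV) (v : V) : C := (a : cfun R V) v.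
Definition cfun1 : cV := [ffun=> 1] : cfun R V.
Definition cdelta (v : V) : cV := [ffun w => (w == v)%:R] : cfun R V.

Lemma ev_ext (a b : cV) : (forall v, ev a v = ev b v) -> a = b.
Proof. by move=> h; apply/ffunP. Qed.
Lemma evD a b v : ev (a + b) v = ev a v + ev b v.
Proof. exact: ffunE. Qed.
Lemma evN a v : ev (- a) v = - ev a v.
Proof. exact: ffunE. Qed.
Lemma ev0 v : ev 0 v = 0.
Proof. exact: ffunE. Qed.
Lemma evZ c a v : ev (c *: a) v = c * ev a v.
Proof. exact: ffunE. Qed.
Lemma evM a b v : ev (a ⋅ b) v = ev a v * ev b v.
Proof. exact: ffunE. Qed.
Lemma evJ a v : ev a^† v = (ev a v)^*.
Proof. exact: ffunE. Qed.
Lemma ev1 v : ev cfun1 v = 1.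
Proof. exact: ffunE. Qed.
Lemma ev_cdelta w v : ev (cdelta w) v = (v == w)%:R.
Proof. exact: ffunE. Qed.
Lemma ev_sum (I : Type) (r : seq I) (Q : pred I) (F : I -> cV) v :
  ev (\sum_(i <- r | Q i) F i) v = \sum_(i <- r | Q i) ev (F i) v.
Proof. by elim/big_rec2: _ => [|i a b _ <-]; [exact: ev0|exact: evD]. Qed.

Lemma cfun1_mull a : cfun1 ⋅ a = a.
Proof. by apply: ev_ext => v; rewrite evM ev1 mul1r. Qed.
Lemma cfun1_mulr a : a ⋅ cfun1 = a.
Proof. by apply: ev_ext => v; rewrite evM ev1 mulr1. Qed.
Lemma cdelta_adj v : (cdelta v)^† = cdelta v.
Proof.
apply: ev_ext => w; rewrite evJ ev_cdelta.
by case: (w == v); [exact: (conjc_re 1)|exact: (conjc_re 0)].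
Qed.
Lemma cdelta_mul v w : cdelta v ⋅ cdelta w = (v == w)%:R *: cdelta v.
Proof.
apply: ev_ext => u; rewrite evM evZ !ev_cdelta.
by case: (eqVneq u v) => [->|_]; rewrite ?mul1r ?mulr1 ?mul0r ?mulr0.
Qed.
Lemma cdelta_mulE v a : cdelta v ⋅ a = ev a v *: cdelta v.
Proof.
apply: ev_ext => u; rewrite evM evZ !ev_cdelta mulrC.
by case: (eqVneq u v) => [->|_]; rewrite ?mulr1 ?mulr0.
Qed.
Lemma cfun_mulC (a b : cV) : a ⋅ b = b ⋅ a.
Proof. by apply: ev_ext => v; rewrite !evM mulrC. Qed.
Lemma cfun_cdelta a : a = \sum_v ev a v *: cdelta v.
Proof.
apply: ev_ext => w; rewrite ev_sum.
under eq_bigr do rewrite evZ ev_cdelta.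
rewrite (bigD1 w)//= eqxx mulr1 big1 ?addr0// => v vw.
by rewrite eq_sym (negbTE vw) mulr0.
Qed.
Lemma nrm_ev a v : normc (ev a v) <= nrm a.
Proof. exact: (le_sup_fin (fun v => normc ((a : cfun R V) v))). Qed.
Lemma nrm_cfun_le (a : cV) (m : R) : 0 <= m -> (forall v, normc (ev a v) <= m) ->
  nrm a <= m.
Proof. exact: sup_fin_le. Qed.

End CfunEval.

Section HilbertModules.
Variables (R : realType) (B : cstar_algebra R) (X : hilbert_module B).
Local Notation C := R[i].
Implicit Types (x y z : X) (b : B).

Lemma innerDr x y z : inner x (y + z) = inner x y + inner x z.
Proof. exact: (linear_morphD (inner_linear x)). Qed.
Lemma innerZr x (c : C) y : inner x (c *: y) = c *: inner x y.
Proof. exact: (linear_morphZ (inner_linear x)). Qed.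
Lemma innerBr x y z : inner x (y - z) = inner x y - inner x z.
Proof. exact: (morphDB (linear_morphD (inner_linear x))). Qed.
Lemma inner0r x : inner x 0 = 0.
Proof. exact: (morphD0 (linear_morphD (inner_linear x))). Qed.
Lemma inner_sumr x (I : Type) (r : seq I) (P : pred I) (F : I -> X) :
  inner x (\sum_(i <- r | P i) F i) = \sum_(i <- r | P i) inner x (F i).
Proof. exact: (morphD_sum (linear_morphD (inner_linear x))). Qed.
Lemma innerDl x y z : inner (x + y) z = inner x z + inner y z.
Proof. by rewrite -inner_adj innerDr cadjD !inner_adj. Qed.
Lemma innerBl x y z : inner (x - y) z = inner x z - inner y z.
Proof. by rewrite -inner_adj innerBr cadjB !inner_adj. Qed.
Lemma inner0l x : inner 0 x = 0.
Proof. by rewrite -inner_adj inner0r cadj0. Qed.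
Lemma innerZl (c : C) x y : inner (c *: x) y = c^* *: inner x y.
Proof. by rewrite -inner_adj innerZr cadjZ inner_adj. Qed.
Lemma inner_ractl x b y : inner (ract x b) y = b^† ⋅ inner x y.
Proof. by rewrite -inner_adj inner_ract cadjM inner_adj. Qed.

Lemma nrm_inner x : nrm (inner x x) = nrm x ^+ 2.
Proof. by apply: complexI; rewrite rmorphXn /= -!nrmE inner_norm. Qed.

Lemma inner_eq0 x : inner x x = 0 -> x = 0.
Proof.
move=> h; apply: nrm_eq0; apply/eqP; rewrite -sqrf_eq0 -nrm_inner h nrm0.
exact: eqxx.
Qed.

Lemma ractDl b : {morph (fun x => ract x b) : x y / x + y}.
Proof. exact: (linear_morphD (ract_linearl b)). Qed.
Lemma ractDr x : {morph ract x : a b / a + b}.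
Proof. exact: (linear_morphD (ract_linearr x)). Qed.
Lemma ractZl (c : C) x b : ract (c *: x) b = c *: ract x b.
Proof. exact: (linear_morphZ (ract_linearl b)). Qed.
Lemma ractZr (c : C) x b : ract x (c *: b) = c *: ract x b.
Proof. exact: (linear_morphZ (ract_linearr x)). Qed.
Lemma ract_suml b (I : Type) (r : seq I) (P : pred I) (F : I -> X) :
  ract (\sum_(i <- r | P i) F i) b = \sum_(i <- r | P i) ract (F i) b.
Proof. exact: (morphD_sum (ractDl b)). Qed.
Lemma ract0r x : ract x 0 = 0.
Proof. exact: (morphD0 (ractDr x)). Qed.

Lemma ract_nrm x b : nrm (ract x b) <= nrm b * nrm x.
Proof.
rewrite -(ler_pXn2r (n := 2)) ?nnegrE ?mulr_ge0 ?nrm_ge0//.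
rewrite -nrm_inner inner_ract inner_ractl; apply: le_trans (nrmM _ _) _.
apply: le_trans (ler_wpM2r (nrm_ge0 _) (nrmM _ _)) _.
rewrite nrm_adj nrm_inner exprMn mulrAC -expr2.
by [].
Qed.

Lemma badd_ract b : badd (fun x => ract x b).
Proof. by split; [exact: ractDl|exists (nrm b) => x; rewrite ract_nrm]. Qed.

(** A finite Parseval frame. Unlike orthonormality, the reconstruction formula says nothing about
    the inner products of the [b i], and it passes to tensor products and unitary images. *)
Definition is_frame (I : finType) (b : I -> X) : Prop :=
  forall x, x = \sum_i ract (b i) (inner (b i) x).

Lemma frame_parseval (I : finType) (b : I -> X) x y : is_frame b ->
  inner x y = \sum_i inner x (b i) ⋅ inner (b i) y.
Proof.
move=> fb; rewrite {1}(fb y) inner_sumr; apply: eq_bigr => i _.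
by rewrite inner_ract.
Qed.

End HilbertModules.

Section Correspondences.
Variables (R : realType) (A B : cstar_algebra R) (X : correspondence A B).
Local Notation C := R[i].
Implicit Types (x y z : X) (a : A).

Lemma lactDr a : {morph (fun x : X => lact a x) : x y / x + y}.
Proof. exact: (linear_morphD (lact_linearr a)). Qed.
Lemma lactZl (c : C) a x : lact (c *: a) x = c *: lact a x.
Proof. exact: (linear_morphZ (lact_linearl x)). Qed.
Lemma lactZr (c : C) a x : lact a (c *: x) = c *: lact a x.
Proof. exact: (linear_morphZ (lact_linearr a)). Qed.
Lemma lact_sumr a (I : Type) (r : seq I) (P : pred I) (F : I -> X) :
  lact a (\sum_(i <- r | P i) F i) = \sum_(i <- r | P i) lact a (F i).
Proof. exact: (morphD_sum (lactDr a)). Qed.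
Lemma inner_lactr a x y : inner x (lact a y) = inner (lact a^† x) y.
Proof. by rewrite lact_adj cadjK. Qed.

Lemma inner_ext x y : (forall z : X, inner z x = inner z y) -> x = y.
Proof.
move=> h; apply/eqP; rewrite -subr_eq0; apply/eqP/inner_eq0.
by rewrite innerBr h subrr.
Qed.

Lemma lact_ract a x b : lact a (ract x b) = ract (lact a x) b.
Proof.
by apply: inner_ext => z; rewrite inner_ract !inner_lactr inner_ract.
Qed.

End Correspondences.

Section CfunModules.
Variables (R : realType) (W : finType) (X : hilbert_module (cfun_algebra R W)).
Local Notation C := R[i].
Implicit Types x y z : X.

Lemma ract_cfun1 x : ract x (cfun1 R W) = x.
Proof.
apply/eqP; rewrite -subr_eq0; apply/eqP/inner_eq0.
by rewrite innerBr inner_ract cfun1_mulr subrr.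
Qed.

Lemma ev_inner_ge0 x w : exists2 r : R, 0 <= r & ev (inner x x) w = r%:C.
Proof.
have [b ->] := inner_pos x; exists (normc (ev b w) ^+ 2); first exact: sqr_ge0.
by rewrite evM evJ conjM_normc.
Qed.

(** Cauchy-Schwarz at the point w: for |z| ≤ 1 and c the value of <z, y> at w, the value of <y - c
    z, y - c z> there is nonnegative, which gives |c|² ≤ |y|². *)
Lemma ev_inner_le x y w : normc (ev (inner x y) w) <= nrm x * nrm y.
Proof.
have unit z : nrm z <= 1 -> normc (ev (inner z y) w) <= nrm y.
  move=> z1; set c := ev (inner z y) w.
  have [r r0 hr] := ev_inner_ge0 (y - c *: z) w.
  have [p p0 hp] := ev_inner_ge0 z w; have [q q0 hq] := ev_inner_ge0 y w.
  have p1 : p <= 1.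
    apply: (@le_trans _ _ (nrm (inner z z))); last by rewrite nrm_inner expr_le1 ?nrm_ge0.
    by have := nrm_ev (inner z z) w; rewrite hp normc_re ger0_norm.
  have qy : q <= nrm y ^+ 2.
    by rewrite -nrm_inner; have := nrm_ev (inner y y) w; rewrite hq normc_re ger0_norm.
  have : r = q - 2 * normc c ^+ 2 + normc c ^+ 2 * p.
    apply: complexI; rewrite -hr innerBr !innerBl !innerZr !innerZl.
    rewrite !(evD, evN, evZ) -/c -[inner y z]inner_adj evJ -/c hp hq.
    move: (conjM_normc c); move: (normc c ^+ 2) => N cc.
    by rewrite rmorphD rmorphB /= !rmorphM /= rmorph_nat -cc; ring.
  move=> rE; rewrite -(ler_pXn2r (n := 2)) ?nnegrE ?nrm_ge0 ?normc_ge0//.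
  have := sqr_ge0 (normc c); set cc := normc c ^+ 2 in rE *; nra.
have x1 : 0 < nrm x + 1 by rewrite ltr_wpDl ?nrm_ge0.
have [x0|x0] := eqVneq (nrm x) 0.
  by rewrite (nrm_eq0 x0) inner0l ev0 nrm0 mul0r normc0.
have xp : 0 < nrm x by rewrite lt_neqAle eq_sym x0 nrm_ge0.
have := unit ((nrm x)^-1%:C *: x); rewrite nrmZ normc_re gtr0_norm ?invr_gt0// mulVf//.
move=> /(_ (lexx _)); rewrite innerZl conjc_re evZ normcM normc_re.
by rewrite gtr0_norm ?invr_gt0// mulrC ler_pdivrMr// mulrC.
Qed.

Lemma inner_badd x : badd (inner x).
Proof.
split; first exact: innerDr.
exists (nrm x) => y; apply: nrm_cfun_le; last by move=> w; exact: ev_inner_le.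
by rewrite mulr_ge0 ?nrm_ge0.
Qed.

Lemma frame_term_badd z : badd (fun x => ract z (inner z x)).
Proof.
have [K K0 hK] := baddK (inner_badd z).
split=> [x y|]; first by rewrite innerDr ractDr.
exists (K * nrm z) => x; apply: le_trans (ract_nrm _ _) _.
by rewrite mulrAC ler_wpM2r ?nrm_ge0.
Qed.

Lemma frame_badd (I : finType) (b : I -> X) :
  badd (fun x => \sum_i ract (b i) (inner (b i) x)).
Proof. by apply: badd_sum => i; exact: frame_term_badd. Qed.

(* n orthonormal vectors and a frame b give G H = 1 for the matrices with
   entries <v_i, b_j>(w) and <b_j, v_i>(w). *)
Lemma orthonormal_bound (I : finType) (b : I -> X) n (v : 'I_n -> X) (r : 'I_n -> W) :
  is_frame b ->
  (forall i j, inner (v i) (v j) = (i == j)%:R *: cdelta R (r i)) ->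
  (n <= #|{: I * W}|)%N.
Proof.
move=> fb ov.
pose G := (\matrix_(i < n, k < #|{: I * W}|)
  ev (inner (v i) (b (enum_val k).1)) (enum_val k).2 : 'M[C]_(n, _)).
pose H := (\matrix_(k < #|{: I * W}|, j < n)
  ev (inner (b (enum_val k).1) (v j)) (enum_val k).2 : 'M[C]_(_, n)).
apply: (@mulmx1_min _ _ _ G H); apply/matrixP => i j; rewrite !mxE.
rewrite (eq_bigr (fun k => let p := enum_val k in
  ev (inner (v i) (b p.1)) p.2 * ev (inner (b p.1) (v j)) p.2)); last first.
  by move=> k _; rewrite !mxE.
rewrite -(big_enum_val (A := {: I * W}) (fun p : I * W =>
  ev (inner (v i) (b p.1)) p.2 * ev (inner (b p.1) (v j)) p.2))/=.
rewrite big_mkcond /=.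
rewrite -(pair_bigA _ (fun k w => ev (inner (v i) (b k)) w * ev (inner (b k) (v j)) w))/=.
rewrite exchange_big /=.
have -> : (i == j)%:R = \sum_w ev (inner (v i) (v j)) w.
  rewrite ov (bigD1 (r i))//= evZ ev_cdelta eqxx mulr1 big1 ?addr0// => w wr.
  by rewrite evZ ev_cdelta (negbTE wr) mulr0.
apply: eq_bigr => w _; rewrite (frame_parseval (v i) (v j) fb) ev_sum.
by apply: eq_bigr => k _; rewrite evM.
Qed.

(** The square of [b i] is the minimal projection at [r i] and not 1, because the fibres of X over
    the points of W may have different dimensions. *)
Definition is_orthonormal (I : finType) (b : I -> X) (r : I -> W) : Prop :=
  forall i j, inner (b i) (b j) = (i == j)%:R *: cdelta R (r i).

Lemma normalize_ex x w : ev (inner x x) w != 0 -> exists c : C,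
  inner (c *: ract x (cdelta R w)) (c *: ract x (cdelta R w)) = cdelta R w.
Proof.
have [r r0 hr] := ev_inner_ge0 x w; rewrite hr => rn0.
have rp : 0 < r.
  rewrite lt_neqAle r0 andbT; apply: contraNneq rn0 => <-; by rewrite rmorph0.
exists (Num.sqrt r)^-1%:C.
rewrite innerZl innerZr inner_ract inner_ractl cdelta_adj conjc_re cdelta_mulE hr cmulZl.
have h : (Num.sqrt r)^-1 * ((Num.sqrt r)^-1 * r) = 1.
  by rewrite mulrA -invfM -expr2 sqr_sqrtr// mulVf// gt_eqF.
by rewrite cdelta_mul eqxx scale1r !scalerA -!rmorphM /= -?mulrA h rmorph1 scale1r.
Qed.

(** A family of maximal size is a frame: a nonzero residual is nonzero at some point w, and its part
    over w, normalized, would extend the family. *)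
Lemma orthonormal_basis_ex (N : nat) :
  (forall n (v : 'I_n -> X) (r : 'I_n -> W), is_orthonormal v r -> (n <= N)%N) ->
  exists n (v : 'I_n -> X) (r : 'I_n -> W), is_orthonormal v r /\ is_frame v.
Proof.
move=> hN.
pose Pn n := `[< exists (v : 'I_n -> X) (r : 'I_n -> W), is_orthonormal v r >].
have P0 : exists n, Pn n.
  exists 0%N; apply/asboolP; exists (fun i => 0).
  have rr : 'I_0 -> W by case.
  by exists rr => -[].
have PN n : Pn n -> (n <= N)%N by move=> /asboolP[v [r /hN]].
have [n /asboolP[v [r ov]] maxn] := ex_maxnP P0 PN.
exists n, v, r; split=> // x; apply: contrapT => hx.
set y := x - \sum_i ract (v i) (inner (v i) x).
have y0 : y <> 0 by move=> /eqP; rewrite subr_eq0 => /eqP.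
have [w hw] : exists w, ev (inner y y) w != 0.
  apply: contrapT => h; apply: y0; apply: inner_eq0; apply: ev_ext => w.
  by rewrite ev0; apply/eqP/negPn/negP => h'; apply: h; exists w.
have vy i : inner (v i) y = 0.
  rewrite innerBr inner_sumr (bigD1 i)//= big1 ?addr0.
    rewrite inner_ract ov eqxx scale1r.
    have -> : v i = ract (v i) (cdelta R (r i)).
      apply/eqP; rewrite -subr_eq0; apply/eqP/inner_eq0.
      rewrite innerBr !innerBl !inner_ract !inner_ractl cdelta_adj ov eqxx scale1r.
      by rewrite !cdelta_mul eqxx scale1r cdelta_mul eqxx scale1r !subrr.
    by rewrite inner_ractl cdelta_adj cmulA cdelta_mul eqxx scale1r subrr.
  by move=> j ji; rewrite inner_ract ov eq_sym (negbTE ji) scale0r cmul0l.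
have [c hc] := normalize_ex hw; set z := c *: ract y (cdelta R w) in hc.
have vz i : inner (v i) z = 0 by rewrite innerZr inner_ract vy cmul0l scaler0.
pose v' (i : 'I_n.+1) := if unlift ord_max i is Some j then v j else z.
pose r' (i : 'I_n.+1) := if unlift ord_max i is Some j then r j else w.
suff /maxn : Pn n.+1 by rewrite ltnn.
apply/asboolP; exists v', r' => i j; rewrite /v' /r'.
case: (unliftP ord_max i) => [i'|] ->; case: (unliftP ord_max j) => [j'|] ->.
- by rewrite ov (inj_eq lift_inj).
- by rewrite vz eq_sym (negbTE (neq_lift _ _)) scale0r.
- by rewrite -inner_adj vz cadj0 (negbTE (neq_lift _ _)) scale0r.
- by rewrite hc eqxx scale1r.
Qed.

End CfunModules.

Section TensorFrames.
Variables (R : realType) (A : cstar_algebra R) (W U : finType).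
Variables (X : correspondence A (cfun_algebra R W)).
Variables (Y : correspondence (cfun_algebra R W) (cfun_algebra R U)).
Variable Z : interior_tensor X Y.
Local Notation "x ⊙ y" := (tens Z x y) (at level 40).

Lemma tensDl y : {morph (fun x => x ⊙ y) : a b / a + b}.
Proof. exact: (linear_morphD (tens_linearl Z y)). Qed.
Lemma tensDr x : {morph (fun y => x ⊙ y) : a b / a + b}.
Proof. exact: (linear_morphD (tens_linearr Z x)). Qed.
Lemma tensZl (c : R[i]) x y : (c *: x) ⊙ y = c *: (x ⊙ y).
Proof. exact: (linear_morphZ (tens_linearl Z y)). Qed.
Lemma tens_suml (I : Type) (r : seq I) (P : pred I) (F : I -> X) y :
  (\sum_(i <- r | P i) F i) ⊙ y = \sum_(i <- r | P i) F i ⊙ y.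
Proof. exact: (morphD_sum (tensDl y)). Qed.
Lemma tens_sumr (I : Type) (r : seq I) (P : pred I) (F : I -> Y) x :
  x ⊙ (\sum_(i <- r | P i) F i) = \sum_(i <- r | P i) x ⊙ F i.
Proof. exact: (morphD_sum (tensDr x)). Qed.

Variables (I J : finType) (b : I -> X) (c : J -> Y).
Hypotheses (fb : is_frame b) (fc : is_frame c).

(** Both sides are bounded in the argument, so x ⊙ y suffices: expand x in [b], move the coefficient
    across the balanced tensor, then expand in [c]. *)
Lemma tens_frame : is_frame (fun p : I * J => b p.1 ⊙ c p.2).
Proof.
have /dense_nrmP dT : dense _ := @tens_dense _ _ _ _ _ _ Z.
apply: (badd_dense_eq (@badd_id _ _) (frame_badd _) dT) => k _ [x _ [y _ <-]].
rewrite -tensZl; move: (k *: x) => {}x.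
rewrite -(pair_bigA _ (fun i j => ract (b i ⊙ c j) (inner (b i ⊙ c j) (x ⊙ y)))) /=.
rewrite {1}(fb x) tens_suml; apply: eq_bigr => i _.
rewrite tens_balanced {1}(fc (lact (inner (b i) x) y)) tens_sumr.
by apply: eq_bigr => j _; rewrite tens_ract tens_inner.
Qed.

(** With finite frames every element is a finite sum of elementary tensors, so additivity suffices
    and no continuity has to be checked. *)
Lemma tens_ext (F : zmodType) (f g : Z -> F) :
  {morph f : x y / x + y} -> {morph g : x y / x + y} ->
  (forall x y, f (x ⊙ y) = g (x ⊙ y)) -> f =1 g.
Proof.
move=> fD gD fg z; rewrite (tens_frame z) (morphD_sum fD) (morphD_sum gD).
by apply: eq_bigr => p _; rewrite tens_ract fg.
Qed.

End TensorFrames.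

Section UnitaryFrames.
Variables (R : realType) (A B : cstar_algebra R) (X Y : correspondence A B).
Variable u : X -> Y.
Hypothesis uu : Defs.is_unitary u.

Lemma unitaryD : {morph u : x y / x + y}.
Proof. by case: uu => /linear_morphD. Qed.

Lemma unitary_frame (I : finType) (b : I -> X) : is_frame b -> is_frame (u \o b).
Proof.
move=> fb y; have [_ _ uR ui us] := uu; have [x <-] := us y.
rewrite {1}(fb x) (morphD_sum unitaryD); apply: eq_bigr => i _.
by rewrite uR /= ui.
Qed.

End UnitaryFrames.

(** * Representations of correspondences *)

Section Representations.
Variables (R : realType) (E : cstar_algebra R).

Definition is_mrep (B : cstar_algebra R) (X : hilbert_module B) (ir : B -> E)
    (f : X -> E) : Prop :=
  [/\ linear f, forall x b, f (ract x b) = f x ⋅ ir b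
    & forall x y, (f x)^† ⋅ f y = ir (inner x y)].

Definition is_rep (A B : cstar_algebra R) (X : correspondence A B) (il : A -> E)
    (ir : B -> E) (f : X -> E) : Prop :=
  is_mrep ir f /\ forall a x, f (lact a x) = il a ⋅ f x.

(** For a frame [b] this is the range projection of the representation: it is self-adjoint and fixes
    every [f x] from the left. By [frame_sum_indep] it depends on [f] only. *)
Definition frame_sum (B : cstar_algebra R) (X : hilbert_module B) (f : X -> E)
    (I : finType) (b : I -> X) : E := \sum_i f (b i) ⋅ (f (b i))^†.

Section RightModule.
Variables (B : cstar_algebra R) (X : hilbert_module B) (ir : B -> E) (f : X -> E).
Hypotheses (hir : is_star_hom ir) (hf : is_mrep ir f).

Lemma mrepD : {morph f : x y / x + y}.
Proof. by case: hf => /linear_morphD. Qed.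

Lemma mrep_frame (I : finType) (b : I -> X) x : is_frame b ->
  f x = \sum_i f (b i) ⋅ ir (inner (b i) x).
Proof.
move=> fb; rewrite {1}(fb x) (morphD_sum mrepD); apply: eq_bigr => i _.
by case: hf => _ ->.
Qed.

Lemma mrep_frameJ (I : finType) (b : I -> X) x : is_frame b ->
  (f x)^† = \sum_i ir (inner x (b i)) ⋅ (f (b i))^†.
Proof.
move=> fb; rewrite (mrep_frame x fb) cadj_sum; apply: eq_bigr => i _.
by case: hir => _ _ hJ; rewrite cadjM -hJ inner_adj.
Qed.

Lemma frame_sum_indep (I J : finType) (b : I -> X) (c : J -> X) :
  is_frame b -> is_frame c -> frame_sum f b = frame_sum f c.
Proof.
move=> fb fc; rewrite /frame_sum.
under eq_bigr do rewrite (mrep_frameJ _ fc) cmul_sumr.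
rewrite exchange_big; apply: eq_bigr => j _ /=.
rewrite [X in _ = X ⋅ _](mrep_frame (c j) fb) cmul_suml; apply: eq_bigr => i _.
by rewrite cmulA.
Qed.

End RightModule.

Section LeftAction.
Variables (V : finType) (B : cstar_algebra R).
Variables (X : correspondence (cfun_algebra R V) B).
Variables (ir : B -> E) (f : X -> E) (I : finType) (b : I -> X).
Hypotheses (hir : is_star_hom ir) (hf : is_mrep ir f) (fb : is_frame b).

Lemma lact_cfun1 (x : X) : lact (cfun1 R V) x = x.
Proof. by have [a [y ->]] := lact_nondegenerate x; rewrite -lactM cfun1_mull. Qed.

(** The operator f x ↦ f (a x), extended by 0 off the range of [f], realized as an element of
    [E]. *)
Definition left_action a : E := \sum_i f (lact a (b i)) ⋅ (f (b i))^†.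

Lemma left_actionE a (x : X) : left_action a ⋅ f x = f (lact a x).
Proof.
have [_ fR fI] := hf.
rewrite [in RHS](fb x) lact_sumr (morphD_sum (mrepD hf)) cmul_suml.
by apply: eq_bigr => i _; rewrite -cmulA fI lact_ract fR.
Qed.

Lemma left_action_star_hom : is_star_hom left_action.
Proof.
have [fL fR fI] := hf; have [_ _ iJ] := hir; split.
- move=> c x y; rewrite scaler_sumr -big_split; apply: eq_bigr => i _.
  by rewrite lact_linearl fL cmulDl cmulZl.
- move=> x y; rewrite {3}/left_action cmul_sumr; apply: eq_bigr => i _.
  by rewrite cmulA left_actionE lactM.
- move=> x; rewrite /left_action cadj_sum.
  under [RHS]eq_bigr do rewrite cadjM cadjK (mrep_frameJ hir hf _ fb) cmul_sumr.
  rewrite exchange_big; apply: eq_bigr => i _ /=.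
  rewrite (mrep_frame hf (lact _ _) fb) cmul_suml; apply: eq_bigr => j _.
  by rewrite cmulA inner_lactr cadjK.
Qed.

Lemma left_action_cfun1 : left_action (cfun1 R V) = frame_sum f b.
Proof. by apply: eq_bigr => i _; rewrite lact_cfun1. Qed.

Lemma left_action_rep : is_rep left_action ir f.
Proof. by split=> // a x; rewrite left_actionE. Qed.

End LeftAction.

Section TensorRep.
Variables (A : cstar_algebra R) (W U : finType).
Variables (X : correspondence A (cfun_algebra R W)).
Variables (Y : correspondence (cfun_algebra R W) (cfun_algebra R U)).
Variable Z : interior_tensor X Y.
Local Notation "x ⊙ y" := (tens Z x y) (at level 40).
Variables (I J : finType) (b : I -> X) (c : J -> Y).
Hypotheses (fb : is_frame b) (fc : is_frame c).
Variables (il : A -> E) (im : cfun_algebra R W -> E) (ir : cfun_algebra R U -> E).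
Variables (f : X -> E) (g : Y -> E).
Hypothesis hir : is_star_hom ir.
Hypotheses (hf : is_rep il im f) (hg : is_rep im ir g).

(** [h] is defined by its frame expansion, and its formula on elementary tensors is then derived.
    The last clause is covariance: if [g] fills the unit of the middle algebra, tensoring with it
    leaves the range projection of [f] unchanged. *)
Lemma tensor_rep : exists h : Z -> E,
  [/\ is_rep il ir h, forall x y, h (x ⊙ y) = f x ⋅ g y
    & frame_sum g c = im (cfun1 R W) ->
        frame_sum h (fun p : I * J => b p.1 ⊙ c p.2) = frame_sum f b].
Proof.
have [mf fl] := hf; have [mg gl] := hg; have [fL fR fI] := mf; have [gL gR gI] := mg.
have [iL iM iJ] := hir.
pose h (z : Z) := \sum_i \sum_j f (b i) ⋅ g (c j) ⋅ ir (inner (b i ⊙ c j) z).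
have hE x y : h (x ⊙ y) = f x ⋅ g y.
  rewrite (mrep_frame mf x fb) cmul_suml; apply: eq_bigr => i _.
  rewrite -cmulA -gl (mrep_frame mg (lact _ _) fc) cmul_sumr.
  by apply: eq_bigr => j _; rewrite tens_inner cmulA.
have hL : linear h.
  move=> k x y; rewrite /h scaler_sumr -big_split; apply: eq_bigr => i _.
  rewrite scaler_sumr -big_split; apply: eq_bigr => j _ /=.
  by rewrite inner_linear iL cmulDr cmulZr.
have hD := linear_morphD hL.
exists h; split=> //; last first.
  move=> gc; rewrite /frame_sum.
  rewrite -(pair_bigA _ (fun i j => h (b i ⊙ c j) ⋅ (h (b i ⊙ c j))^†)) /=.
  apply: eq_bigr => i _; under eq_bigr do rewrite hE cadjM !cmulA.
  rewrite -cmul_suml; congr (_ ⋅ _).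
  under eq_bigr do rewrite -cmulA.
  by rewrite -cmul_sumr -/(frame_sum g c) gc -fR ract_cfun1.
split; last first.
  move=> a; apply: (tens_ext fb fc) => [x y|x y|x y]; rewrite ?lactDr ?hD ?cmulDr//.
  by rewrite tens_lact !hE fl cmulA.
split=> // z d.
  move: z; apply: (tens_ext fb fc) => [x y|x y|x y]; rewrite ?ractDl ?hD ?cmulDl//.
  by rewrite tens_ract !hE gR cmulA.
move: d; apply: (tens_ext fb fc) => [x y|x y|x y]; rewrite ?innerDr ?hD ?cmulDr ?(linear_morphD iL)//.
move: z; apply: (tens_ext fb fc) => [x' y'|x' y'|x' y'].
- by rewrite hD cadjD cmulDl.
- by rewrite innerDl (linear_morphD iL).
by rewrite !hE tens_inner -gI gl -!fI cadjM !cmulA.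
Qed.

End TensorRep.

Section Division.
Variables (V W : finType) (X : correspondence (cfun_algebra R V) (cfun_algebra R V)).
Variable M : correspondence (cfun_algebra R V) (cfun_algebra R W).
Variable Z : interior_tensor X M.
Local Notation "x ⊙ y" := (tens Z x y) (at level 40).
Variables (I J : finType) (b : I -> X) (c : J -> M).
Hypothesis fc : is_frame c.
Variables (il : cfun_algebra R V -> E) (ir : cfun_algebra R W -> E).
Variables (h : Z -> E) (m : M -> E).
Hypothesis hil : is_star_hom il.
Hypotheses (hh : is_rep il ir h) (hm : is_rep il ir m).
Hypothesis cm : frame_sum m c = il (cfun1 R V).
Hypothesis ch : frame_sum h (fun p : I * J => b p.1 ⊙ c p.2) = il (cfun1 R V).

(** [t x] is the operator m y ↦ h (x ⊙ y). As [m] fills the projection [il 1], these values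
    determine it and it inherits the inner product; as [h] fills the same projection, [t] is
    covariant. *)
Lemma division_rep : exists t : X -> E,
  [/\ is_rep il il t, forall x y, t x ⋅ m y = h (x ⊙ y)
    & frame_sum t b = il (cfun1 R V)].
Proof.
have [mh hl] := hh; have [mm ml] := hm; have [hL hR hI] := mh; have [mL mR mI] := mm.
have hD := linear_morphD hL; have [iL iM iJ] := hil.
pose t x := \sum_j h (x ⊙ c j) ⋅ (m (c j))^†.
have tE x y : t x ⋅ m y = h (x ⊙ y).
  rewrite {2}(fc y) tens_sumr (morphD_sum hD) cmul_suml; apply: eq_bigr => j _.
  by rewrite -cmulA mI -tens_ract hR.
have t1 x : t x ⋅ il (cfun1 R V) = t x.
  by rewrite -cm cmul_sumr; apply: eq_bigr => j _; rewrite cmulA tE.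
have tl a x : t (lact a x) = il a ⋅ t x.
  by rewrite cmul_sumr; apply: eq_bigr => j _; rewrite cmulA -hl tens_lact.
have trE x a : t (ract x a) = t x ⋅ il a.
  rewrite -[RHS](_ : t x ⋅ (il a ⋅ frame_sum m c) = _).
    rewrite /frame_sum !cmul_sumr; apply: eq_bigr => j _.
    by rewrite !cmulA -(cmulA (t x)) -ml tE tens_balanced.
  by rewrite cm -iM cfun1_mulr.
exists t; split=> //; last first.
  rewrite -ch /frame_sum.
  rewrite -(pair_bigA _ (fun i j => h (b i ⊙ c j) ⋅ (h (b i ⊙ c j))^†)) /=.
  apply: eq_bigr => i _; rewrite -{1}t1 -cm cmul_sumr cmul_suml.
  by apply: eq_bigr => j _; rewrite -!tE cadjM !cmulA.
split=> //; split=> //.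
  move=> k x y; rewrite scaler_sumr -big_split; apply: eq_bigr => j _.
  by rewrite tens_linearl hL cmulDl cmulZl.
move=> x y.
have tJ z : (t z)^† = il (cfun1 R V) ⋅ (t z)^†.
  rewrite -{1}t1 cadjM -iJ (_ : (cfun1 R V)^† = cfun1 R V)//.
  by apply: ev_ext => v; rewrite evJ ev1; exact: (conjc_re 1).
rewrite tJ -{1}[t y]t1 -cm {1}/frame_sum cmul_suml cmul_suml.
transitivity (\sum_i m (lact (inner x y) (c i)) ⋅ (m (c i))^†); last first.
  under eq_bigr do rewrite ml -cmulA.
  by rewrite -cmul_sumr -/(frame_sum m c) cm -iM cfun1_mulr.
(* Between the vectors [m (c i)] and [m (c j)], the entry of [(t x)^† ⋅ t y] is the inner product of
   x ⊙ [c i] and y ⊙ [c j], that is <c_i, <x, y> c_j>. *)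
transitivity (\sum_i \sum_j
    m (c i) ⋅ ir (inner (c i) (lact (inner x y) (c j))) ⋅ (m (c j))^†).
  apply: eq_bigr => i _; rewrite !cmul_sumr; apply: eq_bigr => j _.
  by rewrite -(tens_inner Z) -hI -!tE cadjM !cmulA.
rewrite exchange_big; apply: eq_bigr => j _ /=.
by rewrite -cmul_suml -(mrep_frame mm _ fc).
Qed.

End Division.
End Representations.

(** * Graph families as covariant representations of X(A) *)

Section GraphReps.
Variables (R : realType) (V : finType) (A : V -> V -> nat) (E : cstar_algebra R).
Local Notation C := R[i].
Local Notation cV := (cfun_algebra R V).
Local Notation X := (graph_correspondence R A).

Definition edge_vec (e : edge A) : X := [ffun f => (f == e)%:R] : edge_fun R A.
Definition edge_ev (x : X) (e : edge A) : C := (x : edge_fun R A) e.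

Lemma edge_ext (x y : X) : (forall e, edge_ev x e = edge_ev y e) -> x = y.
Proof. by move=> h; apply/ffunP. Qed.
Lemma edge_evD x y e : edge_ev (x + y) e = edge_ev x e + edge_ev y e.
Proof. exact: ffunE. Qed.
Lemma edge_evZ c x e : edge_ev (c *: x) e = c * edge_ev x e.
Proof. exact: ffunE. Qed.
Lemma edge_ev0 e : edge_ev 0 e = 0.
Proof. exact: ffunE. Qed.
Lemma edge_ev_sum (I : Type) (r : seq I) (Q : pred I) (F : I -> X) e :
  edge_ev (\sum_(i <- r | Q i) F i) e = \sum_(i <- r | Q i) edge_ev (F i) e.
Proof. by elim/big_rec2: _ => [|i a b _ <-]; [exact: edge_ev0|exact: edge_evD]. Qed.
Lemma edge_ev_vec f e : edge_ev (edge_vec f) e = (e == f)%:R.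
Proof. exact: ffunE. Qed.
Lemma edge_ev_lact a x e : edge_ev (lact a x) e = ev a (edge_source e) * edge_ev x e.
Proof. exact: ffunE. Qed.
Lemma edge_ev_ract x b e : edge_ev (ract x b) e = edge_ev x e * ev b (edge_range e).
Proof. exact: ffunE. Qed.
Lemma ev_edge_inner x y w : ev (inner x y) w =
  \sum_(e | edge_range e == w) (edge_ev x e)^* * edge_ev y e.
Proof. exact: ffunE. Qed.

Lemma inner_edge_vec e x : inner (edge_vec e) x = edge_ev x e *: cdelta R (edge_range e).
Proof.
apply: ev_ext => w; rewrite ev_edge_inner evZ ev_cdelta.
under eq_bigr do rewrite edge_ev_vec.
have J f : ((f == e)%:R : C)^* = (f == e)%:R.
  by case: (f == e); [exact: (conjc_re 1)|exact: (conjc_re 0)].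
under eq_bigr do rewrite J.
rewrite big_mkcond (bigD1 e)//= eqxx mul1r big1 ?addr0 => [|f fe].
  by rewrite eq_sym; case: eqVneq => _; rewrite ?mulr1 ?mulr0.
by rewrite (negbTE fe) mul0r; case: ifP.
Qed.

Lemma lact_edge_vec a e : lact a (edge_vec e) = ev a (edge_source e) *: edge_vec e.
Proof.
apply: edge_ext => f; rewrite edge_ev_lact edge_evZ edge_ev_vec.
by case: eqVneq => [->|]; rewrite ?mulr1 ?mulr0.
Qed.

Lemma ract_edge_vec e b : ract (edge_vec e) b = ev b (edge_range e) *: edge_vec e.
Proof.
apply: edge_ext => f; rewrite edge_ev_ract edge_evZ edge_ev_vec mulrC.
by case: eqVneq => [->|]; rewrite ?mulr1 ?mulr0.
Qed.

Lemma edge_vec_expand x : x = \sum_e edge_ev x e *: edge_vec e.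
Proof.
apply: edge_ext => f; rewrite edge_ev_sum.
under eq_bigr do rewrite edge_evZ edge_ev_vec.
rewrite (bigD1 f)//= eqxx mulr1 big1 ?addr0// => e ef.
by rewrite eq_sym (negbTE ef) mulr0.
Qed.

Lemma edge_frame : is_frame edge_vec.
Proof.
move=> x; rewrite {1}(edge_vec_expand x); apply: eq_bigr => e _.
by rewrite inner_edge_vec ractZr ract_edge_vec ev_cdelta eqxx scale1r.
Qed.

(** The hypothesis on [frame_sum], cut down by the projection of a vertex v, is the relation that
    expresses [P v] through the edges leaving v. *)
Lemma rep_graph_family (il : cV -> E) (t : X -> E) : is_star_hom il ->
  is_rep il il t -> frame_sum t edge_vec = il (cfun1 R V) ->
  is_graph_family (fun v => il (cdelta R v)) (t \o edge_vec).
Proof.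
move=> [iL iM iJ] [[tL tR tI] tl] tc; have i0 := morphD0 (linear_morphD iL).
have tJt e : (t (edge_vec e))^† ⋅ t (edge_vec e) = il (cdelta R (edge_range e)).
  by rewrite tI inner_edge_vec edge_ev_vec eqxx scale1r.
split=> //=.
- by move=> v; rewrite -iM -iJ cdelta_mul eqxx scale1r cdelta_adj.
- by move=> v w vw; rewrite -iM cdelta_mul (negbTE vw) scale0r.
- by move=> e; rewrite -cmulA tJt -tR ract_edge_vec ev_cdelta eqxx scale1r.
move=> v; rewrite -{1}(cfun1_mulr (cdelta R v)) iM -tc cmul_sumr [RHS]big_mkcond.
apply: eq_bigr => e _; rewrite cmulA -tl lact_edge_vec ev_cdelta.
by rewrite (linear_morphZ tL) cmulZl; case: ifP => _; rewrite ?scale1r ?scale0r.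
Qed.

Section FamilyRep.
Variables (P : V -> E) (S : edge A -> E).
Hypothesis gf : is_graph_family P S.

Definition vertex_rep (a : cV) : E := \sum_v ev a v *: P v.
Definition edge_rep (x : X) : E := \sum_e edge_ev x e *: S e.

Lemma vertex_rep_cdelta v : vertex_rep (cdelta R v) = P v.
Proof.
rewrite /vertex_rep; under eq_bigr do rewrite ev_cdelta.
exact: (sum_deltar (fun w => P w)).
Qed.

Lemma edge_rep_vec e : edge_rep (edge_vec e) = S e.
Proof.
rewrite /edge_rep; under eq_bigr do rewrite edge_ev_vec.
exact: (sum_deltar (fun w => S w)).
Qed.

Lemma vertex_rep_cfun1 : vertex_rep (cfun1 R V) = \sum_v P v.
Proof. by apply: eq_bigr => v _; rewrite ev1 scale1r. Qed.

Lemma vertex_rep_star_hom : is_star_hom vertex_rep.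
Proof.
split.
- move=> c x y; rewrite scaler_sumr -big_split; apply: eq_bigr => v _.
  by rewrite evD evZ scalerDl scalerA.
- move=> x y; rewrite cmul_suml; apply: eq_bigr => v _.
  rewrite cmul_sumr -(sum_delta (fun w => ev (x ⋅ y) w *: P w) v).
  apply: eq_bigr => w _; rewrite cmulZl cmulZr (vertex_mul gf) evM !scalerA.
  by case: eqVneq => [->|_]; rewrite ?mul1r ?mulr1 ?mulr0 ?mul0r ?scale0r.
- move=> x; rewrite cadj_sum; apply: eq_bigr => v _.
  by rewrite cadjZ (vertex_adj gf) evJ.
Qed.

Hypothesis pos : forall (a : edge A -> E),
  \sum_k (a k)^† ⋅ a k = 0 -> forall k, a k = 0.

Lemma edge_rep_rep : is_rep vertex_rep vertex_rep edge_rep.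
Proof.
split; last first.
  move=> a x; rewrite cmul_sumr; apply: eq_bigr => e _.
  rewrite edge_ev_lact cmulZr mulrC -scalerA; congr (_ *: _); rewrite cmul_suml.
  rewrite -[LHS](sum_delta (fun v => ev a v *: S e) (edge_source e)).
  apply: eq_bigr => v _; rewrite cmulZl (vertex_mul_edge gf pos) !scalerA.
  by rewrite mulrC.
split.
- move=> c x y; rewrite scaler_sumr -big_split; apply: eq_bigr => e _.
  by rewrite edge_evD edge_evZ scalerDl scalerA.
- move=> x b; rewrite cmul_suml; apply: eq_bigr => e _.
  rewrite edge_ev_ract cmulZl cmul_sumr -scalerA; congr (_ *: _).
  rewrite -[LHS](sum_delta (fun v => ev b v *: S e) (edge_range e)).
  apply: eq_bigr => v _; rewrite cmulZr (edge_mul_vertex gf) !scalerA.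
  by rewrite mulrC.
- move=> x y; rewrite cadj_sum cmul_suml.
  transitivity (\sum_e ((edge_ev x e)^* * edge_ev y e) *: P (edge_range e)).
    apply: eq_bigr => e _; rewrite cadjZ cmul_sumr.
    rewrite -(sum_delta (fun f => ((edge_ev x e)^* * edge_ev y f) *: P (edge_range e)) e).
    apply: eq_bigr => f _; rewrite cmulZl cmulZr (edge_orth gf pos) !scalerA.
    by rewrite mulrC.
  rewrite (partition_big (fun e : edge A => edge_range e) xpredT)//=.
  apply: eq_bigr => w _; rewrite ev_edge_inner scaler_suml.
  by apply: eq_bigr => e /eqP ->.
Qed.

Lemma edge_rep_frame_sum : frame_sum edge_rep edge_vec = vertex_rep (cfun1 R V).
Proof.
rewrite vertex_rep_cfun1 [LHS](partition_big (@edge_source V A) xpredT)//=.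
apply: eq_bigr => v _; rewrite (vertex_sum gf).
by apply: eq_bigr => e _; rewrite edge_rep_vec.
Qed.

End FamilyRep.
End GraphReps.

(** * The homomorphism induced by a correspondence *)

Section Enumeration.
Variables (I W : finType) (r : I -> W).
Hypothesis rs : forall w, exists i, r i = w.

Let fib w := [seq i <- enum I | r i == w].

(** Division with remainder by the size of the fibre of [r i]: the remainder gives the position of i
    in its fibre, the quotient is k. *)
Definition tau (i : I) (k : nat) : nat := (index i (fib (r i)) + size (fib (r i)) * k)%N.

Let mem_fib i : i \in fib (r i).
Proof. by rewrite mem_filter eqxx mem_enum. Qed.

Let tau_mod i k : (tau i k %% size (fib (r i)) = index i (fib (r i)))%N.
Proof. by rewrite /tau addnC mulnC modnMDl modn_small// index_mem. Qed.

Let tau_div i k : (tau i k %/ size (fib (r i)) = k)%N.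
Proof.
have h : (index i (fib (r i)) < size (fib (r i)))%N by rewrite index_mem.
by rewrite /tau addnC mulnC divnMDl ?divn_small ?addn0// (leq_ltn_trans _ h).
Qed.

Lemma tau_inj i j k l : r i = r j -> tau i k = tau j l -> i = j /\ k = l.
Proof.
move=> rij h; have hm := tau_mod i k; have hd := tau_div i k.
move: hm hd; rewrite h rij tau_mod tau_div => hm hd; split=> //.
rewrite -(nth_index i (mem_fib i)) rij -hm nth_index//; exact: mem_fib.
Qed.

Lemma tau_surj w n : exists i k, r i = w /\ tau i k = n.
Proof.
have [i0 ri0] := rs w; have c0 : (0 < size (fib w))%N.
  by rewrite -has_predT; apply/hasP; exists i0 => //; rewrite -ri0.
have hn : (n %% size (fib w) < size (fib w))%N by rewrite ltn_mod.
set i := nth i0 (fib w) (n %% size (fib w)).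
have ri : r i = w.
  by have := mem_nth i0 hn; rewrite mem_filter => /andP[/eqP].
exists i, (n %/ size (fib w))%N; split=> //.
rewrite /tau ri index_uniq// 1?filter_uniq ?enum_uniq//.
by rewrite addnC mulnC -divn_eq.
Qed.

End Enumeration.

Section Columns.
Variables (R : realType) (W : finType) (B : W -> W -> nat) (D : graph_algebra R B).
Variables (E : cstar_algebra R) (theta : D -> nat -> nat -> E).
Hypothesis st : stable_system theta.
Variable X : hilbert_module (cfun_algebra R W).
Variables (I : finType) (b : I -> X) (r : I -> W).
Hypotheses (ob : is_orthonormal b r) (fb : is_frame b).
Hypothesis rs : forall w, exists i, r i = w.
Local Notation C := R[i].
Local Notation vrep := (vertex_rep (vertex_proj D)).

Let mxt : mx_system theta. Proof. by case: st. Qed.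
Let gf := graph_familyP D.

Definition corner_rep (a : cfun_algebra R W) : E := theta (vrep a) 0 0.

Lemma is_star_hom_comp (A1 A2 A3 : cstar_algebra R) (f : A1 -> A2) (g : A2 -> A3) :
  is_star_hom g -> is_star_hom f -> is_star_hom (fun x => g (f x)).
Proof.
move=> [gL gM gJ] [fL fM fJ]; split=> [c x y|x y|x].
- by rewrite fL gL.
- by rewrite fM gM.
- by rewrite fJ gJ.
Qed.

Lemma corner_rep_star_hom : is_star_hom corner_rep.
Proof.
exact: (is_star_hom_comp (theta_star_hom mxt 0) (vertex_rep_star_hom gf)).
Qed.

(* The i-th copy of the module: for each vertex w, the pairs of a basis vector
   with range w and of a copy are numbered bijectively by tau. *)
Definition column (i : nat) (x : X) : E :=
  \sum_k theta (vrep (inner (b k) x)) (tau r k i) 0.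

Let vL := vertex_rep_star_hom gf.

Lemma inner_basis_cdelta k x : inner (b k) x = cdelta R (r k) ⋅ inner (b k) x.
Proof.
suff {1}-> : b k = ract (b k) (cdelta R (r k)) by rewrite inner_ractl cdelta_adj.
apply/eqP; rewrite -subr_eq0; apply/eqP/inner_eq0.
rewrite innerBr !innerBl !inner_ract !inner_ractl cdelta_adj ob eqxx scale1r.
by rewrite !cdelta_mul eqxx scale1r cdelta_mul eqxx scale1r !subrr.
Qed.

Lemma column_linear i : linear (column i).
Proof.
move=> c x y; rewrite scaler_sumr -big_split; apply: eq_bigr => k _.
by case: vL => vl _ _; rewrite inner_linear vl (thetaD mxt) (thetaZ mxt).
Qed.

Lemma column_ract i x a : column i (ract x a) = column i x ⋅ corner_rep a.
Proof.
rewrite cmul_suml; apply: eq_bigr => k _; case: vL => _ vM _.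
by rewrite inner_ract vM (thetaMe mxt).
Qed.

Lemma column_inner i j x y :
  (column i x)^† ⋅ column j y = (i == j)%:R *: corner_rep (inner x y).
Proof.
case: vL => vl vM vJ; rewrite cadj_sum cmul_suml /corner_rep (frame_parseval x y fb).
rewrite (morphD_sum (linear_morphD vl)) (theta_sum mxt) scaler_sumr.
apply: eq_bigr => k _; rewrite (thetaJ mxt) -vJ inner_adj cmul_sumr.
rewrite -(sum_delta (fun l => (i == j)%:R *:
   theta (vrep (inner x (b k) ⋅ inner (b l) y)) 0 0) k).
apply: eq_bigr => l _; rewrite (thetaM mxt) -vM.
have [rkl|rkl] := eqVneq (r k) (r l).
  have -> : (tau r k i == tau r l j) = (k == l) && (i == j).
    apply/eqP/andP => [/(tau_inj rkl)[-> ->]//|[/eqP -> /eqP ->]//].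
  by case: (k == l); rewrite ?scale1r// !scale0r.
have -> : inner x (b k) ⋅ inner (b l) y = 0.
  rewrite (inner_basis_cdelta l) -[inner x (b k)]inner_adj (inner_basis_cdelta k).
  rewrite cadjM cdelta_adj cmulA -(cmulA _ (cdelta _ _) (cdelta _ _)) cdelta_mul (negbTE rkl) scale0r.
  by rewrite cmul0r cmul0l.
by rewrite (morphD0 (linear_morphD vl)) (theta0 mxt) !scaler0.
Qed.

Lemma column_mrep i : is_mrep corner_rep (column i).
Proof.
split; [exact: column_linear|exact: column_ract|move=> x y].
by rewrite column_inner eqxx scale1r.
Qed.

Lemma column_basis i k : column i (b k) = theta (vertex_proj D (r k)) (tau r k i) 0.
Proof.
rewrite /column -(sum_deltar (fun l => theta (vertex_proj D (r l)) (tau r l i) 0) k).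
case: vL => vl _ _; apply: eq_bigr => l _; rewrite ob (linear_morphZ vl) (thetaZ mxt).
by rewrite vertex_rep_cdelta.
Qed.

(** Over each vertex w, row n is used by exactly one basis vector in exactly one copy, so finitely
    many copies cover row n over all vertices. *)
Lemma column_full n : exists N,
  theta (\sum_v vertex_proj D v) n n ⋅ \sum_(i < N) frame_sum (column i) b =
  theta (\sum_v vertex_proj D v) n n.
Proof.
have /choice[p hp] : forall w, exists p : I * nat, r p.1 = w /\ tau r p.1 p.2 = n.
  by move=> w; have [i [k [h1 h2]]] := tau_surj rs w n; exists (i, k).
(* [(p w).2] is the copy using row n over w; the successor lets the strict bound on i include the
   largest of them. *)
exists (\max_w (p w).2).+1.
have term i k : theta (\sum_v vertex_proj D v) n n ⋅
    (column i (b k) ⋅ (column i (b k))^†) =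
    (n == tau r k i)%:R *: theta (vertex_proj D (r k)) n n.
  rewrite column_basis (thetaJ mxt) (vertex_adj gf) (thetaMe mxt) (thetaM mxt).
  rewrite (vertex_mul gf) eqxx scale1r cmul_suml.
  under eq_bigr do rewrite (vertex_mul gf).
  case: eqVneq => [<-|]; last by rewrite !scale0r.
  congr (_ *: theta _ _ _); rewrite -[RHS](sum_deltar (fun w => vertex_proj D w) (r k)).
  by apply: eq_bigr => w _.
rewrite cmul_sumr [RHS](theta_sum mxt).
transitivity (\sum_(i < (\max_w (p w).2).+1) \sum_k
    (n == tau r k i)%:R *: theta (vertex_proj D (r k)) n n).
  apply: eq_bigr => i _; rewrite /frame_sum cmul_sumr.
  by apply: eq_bigr => k _; rewrite term.
rewrite exchange_big /= (partition_big r xpredT)//=; apply: eq_bigr => w _.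
have [rw tw] := hp w; rewrite (bigD1 (p w).1) ?rw//= [X in _ + X]big1 ?addr0.
  have lt : ((p w).2 < (\max_w (p w).2).+1)%N by rewrite ltnS leq_bigmax.
  rewrite (bigD1 (Ordinal lt))//= tw eqxx scale1r big1 ?addr0//.
  move=> i iw; case: eqVneq => [h|]; last by rewrite scale0r.
  have [_ e] := tau_inj (erefl (r (p w).1)) (etrans tw h).
  by move: iw; rewrite -val_eqE /= -e eqxx.
move=> k /andP[/eqP rk kp]; rewrite big1// => i _.
case: eqVneq => [h|]; last by rewrite scale0r.
have [e _] := tau_inj (etrans rw (esym rk)) (etrans tw h).
by move: kp; rewrite e eqxx.
Qed.

(** The entries of a column are combinations of vertex projections. Applied to the gauge action,
    this says that the copies of [M] have degree 0. *)
Lemma column_fixed (g : E -> E) : is_star_hom g ->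
  (forall w k l, g (theta (vertex_proj D w) k l) = theta (vertex_proj D w) k l) ->
  forall i x, g (column i x) = column i x.
Proof.
move=> [gL _ _] gP i x; rewrite (morphD_sum (linear_morphD gL)); apply: eq_bigr => k _.
rewrite /vertex_rep (theta_sum mxt) (morphD_sum (linear_morphD gL)).
by apply: eq_bigr => w _; rewrite (thetaZ mxt) (linear_morphZ gL) gP.
Qed.

End Columns.

Section StableGraphAlgebra.
Variables (R : realType) (V : finType) (A : V -> V -> nat) (D : graph_algebra R A).
Variables (E : cstar_algebra R) (theta : D -> nat -> nat -> E).
Hypothesis st : stable_system theta.

Definition graph_one : D := \sum_v vertex_proj D v.

Lemma graph_pos (a : edge A -> D) : \sum_k (a k)^† ⋅ a k = 0 -> forall k, a k = 0.
Proof. by case: st => mxt inj _; exact: (sum_adj_mul_eq0 mxt). Qed.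

Lemma graph_one_unit : is_unit graph_one.
Proof. exact: (graph_algebra_unit graph_pos). Qed.

Lemma corner_rep_cfun1 : corner_rep theta (cfun1 R V) = theta graph_one 0 0.
Proof. by rewrite /corner_rep vertex_rep_cfun1. Qed.

Definition corner_edge_rep (x : graph_correspondence R A) : E :=
  theta (edge_rep (edge_isom D) x) 0 0.

Lemma corner_edge_rep_rep :
  is_rep (corner_rep theta) (corner_rep theta) corner_edge_rep.
Proof.
have mxt : mx_system theta by case: st.
have [[sL sR sI] sl] := edge_rep_rep (graph_familyP D) graph_pos.
split; last by move=> a x; rewrite /corner_edge_rep sl (thetaMe mxt).
split.
- by move=> c x y; rewrite /corner_edge_rep sL (thetaD mxt) (thetaZ mxt).
- by move=> x b; rewrite /corner_edge_rep sR (thetaMe mxt).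
- by move=> x y; rewrite /corner_edge_rep (thetaJ mxt) (thetaMe mxt) sI.
Qed.

Lemma corner_edge_frame_sum :
  frame_sum corner_edge_rep (@edge_vec R V A) = corner_rep theta (cfun1 R V).
Proof.
have mxt : mx_system theta by case: st.
have := edge_rep_frame_sum (graph_familyP D) => h.
rewrite /corner_rep -h /frame_sum (theta_sum mxt); apply: eq_bigr => e _.
by rewrite /corner_edge_rep (thetaJ mxt) (thetaMe mxt).
Qed.

End StableGraphAlgebra.

Section Induced.
Variables (R : realType) (V W : finType) (A : V -> V -> nat) (B : W -> W -> nat).
Variables (CA : graph_algebra R A) (CB : graph_algebra R B).
Variables (EA EB : cstar_algebra R).
Variables (thA : CA -> nat -> nat -> EA) (thB : CB -> nat -> nat -> EB).
Hypotheses (stA : stable_system thA) (stB : stable_system thB).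
Local Notation C := R[i].
Local Notation X := (graph_correspondence R A).
Local Notation Y := (graph_correspondence R B).
Variable M : correspondence (cfun_algebra R V) (cfun_algebra R W).
Variables (XM : interior_tensor X M) (MY : interior_tensor M Y).
Variable Phi : XM -> MY.
Hypothesis uPhi : Defs.is_unitary Phi.
Local Notation iA := (vertex_rep (vertex_proj CA)).
Local Notation sA := (edge_rep (edge_isom CA)).
Local Notation oA := (graph_one CA).
Local Notation oB := (graph_one CB).
Local Notation i0 := (corner_rep thB).
Local Notation s0 := (corner_edge_rep thB).

(* f is the homomorphism induced by the correspondence M ⊗ C^*(G_B): m i is
   its i-th copy of M, and h i the corresponding copy of M ⊗ Y. *)
Record implements (f : EA -> EB) (m : nat -> M -> EB) (h : nat -> MY -> EB) : Prop :=
  Implements {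
  imp_star_hom : is_star_hom f;
  imp_mrep : forall i, is_mrep i0 (m i);
  imp_inner : forall i j x y, (m i x)^† ⋅ m j y = (i == j)%:R *: i0 (inner x y);
  imp_vertex : forall a i j x, f (thA (iA a) i j) ⋅ m j x = m i (lact a x);
  imp_edge : forall x i j y, f (thA (sA x) i j) ⋅ m j y = h i (Phi (tens XM x y));
  imp_tens : forall i x y, h i (tens MY x y) = m i x ⋅ s0 y;
  imp_tensD : forall i, {morph h i : x y / x + y};
  imp_frame : forall i (I : finType) (b : I -> M), is_frame b ->
    frame_sum (m i) b = f (thA oA i i);
  imp_full : forall n, exists N,
    thB oB n n ⋅ f (approx_unit thA oA N) = thB oB n n
}.

Variables (I : finType) (b : I -> M) (r : I -> W).
Hypotheses (ob : is_orthonormal b r) (fb : is_frame b).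
Hypothesis rs : forall w, exists i, r i = w.

Let mxA : mx_system thA. Proof. by case: stA. Qed.
Let mxB : mx_system thB. Proof. by case: stB. Qed.
Let hi0 : is_star_hom i0. Proof. exact: corner_rep_star_hom. Qed.
Local Notation m := (column thB b r).

Let mm i : is_mrep i0 (m i). Proof. exact: column_mrep. Qed.
Let mI i j x y : (m i x)^† ⋅ m j y = (i == j)%:R *: i0 (inner x y).
Proof. exact: column_inner. Qed.

Definition induced_left := left_action (m 0%N) b.
Local Notation il := induced_left.

Let hil : is_star_hom il. Proof. exact: (left_action_star_hom hi0 (mm 0) fb). Qed.
Let rep0 : is_rep il i0 (m 0%N). Proof. exact: (left_action_rep (mm 0) fb). Qed.
Let il1 : il (cfun1 R V) = frame_sum (m 0%N) b. Proof. exact: left_action_cfun1. Qed.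

(** The partial isometry carrying copy 0 of [M] onto copy i. *)
Definition shift_col i : EB := \sum_k m i (b k) ⋅ (m 0%N (b k))^†.
Local Notation V_ := shift_col.

Lemma shift_colE i x : V_ i ⋅ m 0%N x = m i x.
Proof.
rewrite cmul_suml [RHS](mrep_frame (mm i) x fb); apply: eq_bigr => k _.
by rewrite -cmulA mI eqxx scale1r.
Qed.

Lemma shift_colJ j x : (V_ j)^† ⋅ m j x = m 0%N x.
Proof.
rewrite cadj_sum cmul_suml [RHS](mrep_frame (mm 0) x fb); apply: eq_bigr => k _.
by rewrite cadjM cadjK -cmulA mI eqxx scale1r.
Qed.

Lemma shift_colJM i j : (V_ i)^† ⋅ V_ j = (i == j)%:R *: il (cfun1 R V).
Proof.
case: eqVneq => [->|ij].
  rewrite scale1r il1 {2}/shift_col cmul_sumr; apply: eq_bigr => k _.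
  by rewrite cmulA shift_colJ.
rewrite scale0r cadj_sum cmul_suml big1// => k _; rewrite cadjM cadjK cmul_sumr big1// => l _.
by rewrite cmulA -(cmulA (m 0%N (b k))) mI (negbTE ij) scale0r cmul0r cmul0l.
Qed.

Lemma shift_col_unit i : V_ i ⋅ il (cfun1 R V) = V_ i.
Proof.
rewrite il1 cmul_sumr; apply: eq_bigr => k _.
by rewrite cmulA shift_colE.
Qed.

Lemma shift_col_frame i : V_ i ⋅ (V_ i)^† = frame_sum (m i) b.
Proof.
rewrite [X in _ ⋅ X]cadj_sum cmul_sumr; apply: eq_bigr => k _.
by rewrite cadjM cadjK cmulA shift_colE.
Qed.

(** [Phi] makes X act on copy 0: the operator of x sends m y to the representative of Phi (x ⊗ y).
    The last clause is stated for any maps with the values of the gauge action on generators and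
    matrix entries, so the construction does not depend on the action. *)
Lemma induced_ex : exists (f : EA -> EB) (h : nat -> MY -> EB),
  implements f m h /\
  forall (z : C) (gA : CA -> CA) (gB : CB -> CB) (GA : EA -> EA) (GB : EB -> EB),
    is_star_hom GA -> is_star_hom GB ->
    (forall v, gA (vertex_proj CA v) = vertex_proj CA v) ->
    (forall e, gA (edge_isom CA e) = z *: edge_isom CA e) ->
    (forall v, gB (vertex_proj CB v) = vertex_proj CB v) ->
    (forall e, gB (edge_isom CB e) = z *: edge_isom CB e) ->
    (forall d i j, GA (thA d i j) = thA (gA d) i j) ->
    (forall d i j, GB (thB d i j) = thB (gB d) i j) ->
    forall x, f (GA x) = GB (f x).
Proof.
have fe := @edge_frame R V A; have feB := @edge_frame R W B.
have reps := corner_edge_rep_rep stB.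
have [h0 [rh0 h0E h0c]] := tensor_rep MY fb feB hi0 rep0 reps.
have {}h0c := h0c (corner_edge_frame_sum stB).
have [mh0 h0l] := rh0; have [h0L h0R h0I] := mh0; have h0D := linear_morphD h0L.
have [uL ul uR uI _] := uPhi.
have hP : is_rep il i0 (h0 \o Phi).
  split=> [|a x] /=; last by rewrite ul h0l.
  split=> [c x y|x a|x y] /=; first by rewrite uL h0L.
    by rewrite uR h0R.
  by rewrite h0I uI.
have fP := unitary_frame uPhi (tens_frame (Z := XM) fe fb).
have fMY := tens_frame (Z := MY) fb feB.
have cP : frame_sum (h0 \o Phi) (fun p : edge A * I => tens XM (edge_vec R p.1) (b p.2))
    = il (cfun1 R V).
  by rewrite il1 -h0c (frame_sum_indep hi0 mh0 fMY fP).
(* [Y] is covariant and [Phi] is unitary, so X ⊗ M represented through [h0 \o Phi] has the same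
   range projection as [m 0], which can therefore be divided out. *)
have [t [rt tE tc]] := division_rep fb hil hP rep0 (esym il1) cP.
have gt := rep_graph_family hil rt tc.
have [Pi [hPi PiV PiS]] := graph_universal CA gt.
have [PL PM PJ] := hPi; have [ilL ilM ilJ] := hil.
have [[tL _ _] _] := rt.
have Pii a : Pi (iA a) = il a.
  rewrite [in RHS](cfun_cdelta a) (linear_comb ilL) (linear_comb PL).
  by apply: eq_bigr => v _; rewrite PiV.
have Pis x : Pi (sA x) = t x.
  rewrite [in RHS](edge_vec_expand x) (linear_comb tL) (linear_comb PL).
  by apply: eq_bigr => e _; rewrite PiS.
have Pi1 : Pi oA = il (cfun1 R V) by rewrite -Pii vertex_rep_cfun1.
have uA := graph_one_unit stA.
pose th' a i j := V_ i ⋅ Pi a ⋅ (V_ j)^†.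
have mx' : mx_system th'.
  split.
  - move=> i j c x y; rewrite /th' PL cmulDr cmulDl cmulZr cmulZl.
    by [].
  - move=> a i j a' k l; rewrite /th' !cmulA -(cmulA _ (V_ j)^†) shift_colJM.
    rewrite cmulZr !cmulZl -Pi1 -(cmulA _ (Pi a)) -PM (uA a).2.
    by rewrite -(cmulA _ (Pi a)) -PM.
  - by move=> a i j; rewrite /th' !cadjM cadjK PJ cmulA.
have [f [hf fE]] := stable_extension stA uA mx'.
have [fL fM fJ] := hf.
have fone i : f (thA oA i i) = frame_sum (m i) b.
  by rewrite fE /th' Pi1 shift_col_unit shift_col_frame.
exists f, (fun i z => V_ i ⋅ h0 z); split.
  split=> //.
  - by move=> a i j x; rewrite fE /th' -cmulA shift_colJ Pii -cmulA (left_actionE (mm 0) fb) shift_colE.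
  - by move=> x i j y; rewrite fE /th' -cmulA shift_colJ Pis -cmulA tE.
  - by move=> i x y; rewrite h0E cmulA shift_colE.
  - by move=> i x y; rewrite h0D cmulDr.
  - by move=> i K c fc; rewrite fone (frame_sum_indep hi0 (mm i) fc fb).
  - move=> n; have [N hN] := column_full stB ob rs n; exists N.
    rewrite -[RHS]hN (morphD_sum (linear_morphD fL)); congr (_ ⋅ _).
    by apply: eq_bigr => i _; rewrite fone.
move=> z gA gB GA GB hGA hGB gAv gAe gBv gBe GAE GBE.
have [GL GM GJ] := hGB; have GD := linear_morphD GL.
have Gm i x : GB (m i x) = m i x.
  by apply: (column_fixed stB) => // w k l; rewrite GBE gBv.
have GV i : GB (V_ i) = V_ i.
  by rewrite (morphD_sum GD); apply: eq_bigr => k _; rewrite GM GJ !Gm.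
have Gil a : GB (il a) = il a.
  by rewrite (morphD_sum GD); apply: eq_bigr => k _; rewrite GM GJ !Gm.
have Gs y : GB (s0 y) = z *: s0 y.
  rewrite /corner_edge_rep /edge_rep !(theta_sum mxB) (morphD_sum GD) scaler_sumr.
  apply: eq_bigr => e _.
  by rewrite !(thetaZ mxB) (linear_morphZ GL) GBE gBe (thetaZ mxB) !scalerA mulrC.
(* An elementary tensor is a fixed column times one edge factor of G_B, which contributes the scalar
   z. *)
have Gh0 x : GB (h0 x) = z *: h0 x.
  move: x; apply: (tens_ext fb feB) => [x y|x y|x y].
  - by rewrite h0D GD.
  - by rewrite h0D scalerDr.
  - by rewrite h0E GM Gm Gs cmulZr.
have Gt x : GB (t x) = z *: t x.
  have t1 : t x = \sum_k h0 (Phi (tens XM x (b k))) ⋅ (m 0%N (b k))^†.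
    have [[_ tR _] _] := rt.
    rewrite -[LHS](_ : t x ⋅ il (cfun1 R V) = _).
      rewrite il1 cmul_sumr; apply: eq_bigr => k _.
      by rewrite cmulA tE.
    rewrite -tR; congr t; exact: ract_cfun1.
  rewrite t1 (morphD_sum GD) scaler_sumr; apply: eq_bigr => k _.
  by rewrite GM GJ Gm Gh0 cmulZl.
apply: (stable_star_hom_eq stA (@graph_generated _ _ _ CA)) => [||d].
- exact: (is_star_hom_comp hf hGA).
- exact: (is_star_hom_comp hGB hf).
move=> [[v _ <-]|[e _ <-]] i j; rewrite GAE ?gAv ?gAe ?(thetaZ mxA) ?(linear_morphZ fL) !fE /th'.
  by rewrite PiV !GM GJ !GV Gil.
rewrite PiS !GM GJ !GV /= Gt cmulZr cmulZl.
by [].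
Qed.

End Induced.

(** * Composition and alignment *)

Section StableBijective.
Variables (R : realType) (D E : cstar_algebra R) (theta : D -> nat -> nat -> E) (e : D).
Hypothesis st : stable_system theta.
Hypothesis eu : is_unit e.
Variables (h : E -> E) (w : nat -> E).
Hypothesis hh : is_star_hom h.
Hypothesis ww : forall i j, w i ⋅ (w j)^† = (i == j)%:R *: theta e 0 0.
Hypothesis hw : forall d i j, h (theta d i j) = (w i)^† ⋅ theta d 0 0 ⋅ w j.
Hypothesis hfull : forall n, exists N,
  theta e n n ⋅ h (approx_unit theta e N) = theta e n n.

Let mxt : mx_system theta. Proof. by case: st. Qed.

(** The entries of [h x] relative to the rows [w] are the ordinary entries of x; on the dense span
    this follows from the orthogonality relations of the rows. *)
Lemma implemented_compress i j x : w i ⋅ h x ⋅ (w j)^† = theta e 0 i ⋅ x ⋅ theta e j 0.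
Proof.
have bh := star_hom_badd hh.
move: x; apply: (stable_ext_eq st) => [||d k l].
- by apply: (badd_comp (badd_cmulr _)); apply: badd_comp bh; exact: badd_cmull.
- by apply: (badd_comp (badd_cmulr _)); exact: badd_cmull.
rewrite hw !cmulA ww -(cmulA _ (w l)) ww cmulZl cmulZr cmulZl.
rewrite (theta_unitl st eu) !scale1r (theta_unitr st eu) scale1r.
rewrite (theta_unitl st eu) cmulZl (theta_unitr st eu) !scalerA mulrC.
by [].
Qed.

(** If h x = 0, all entries of x vanish, and so do its corners, which converge to x. An injective
    homomorphism has closed range, so surjectivity is only needed on the entries [theta a k l]. *)
Lemma implemented_bijective : bijective h.
Proof.
have [hL hM hJ] := hh; have hD := linear_morphD hL.
have inj : injective h.
  apply: (is_star_hom_injP hh) => x hx.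
  apply: (seq_lim_unique (corner_lim st eu x)) => d d0; exists 0%N => n _.
  suff -> : corner theta e n x = 0 by rewrite subr0 nrm0.
  rewrite /corner /approx_unit cmul_suml cmul_suml big1// => i _.
  rewrite cmul_sumr big1// => j _.
  have -> : theta e i i = theta e i 0 ⋅ theta e 0 i by rewrite (thetaMe mxt) (eu e).1.
  have -> : theta e j j = theta e j 0 ⋅ theta e 0 j by rewrite (thetaMe mxt) (eu e).1.
  rewrite !cmulA -(cmulA (theta e i 0)) -(cmulA (theta e i 0)) -implemented_compress hx.
  by rewrite cmul0r cmul0l cmul0r cmul0l.
have cl := star_hom_range_closed hh inj.
suff surj : forall y, exists x, h x = y.
  have [g hg] := choice surj; exists g => // x; apply: inj; exact: hg.
move=> y; suff : range h y by move=> [x _ <-]; exists x.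
move/closed_nrmP: cl; apply=> d d0; case: st => _ _ dS.
have [z [n [c [u [Su ->]]]] yz] := dS y d d0; exists (\sum_i c i *: u i) => //.
have /choice[x hx] : forall i, exists x, h x = u i.
  move=> i; have [a [k [l ->]]] := Su i.
  have [N hN] := hfull k; have [N' hN'] := hfull l.
  have hNJ : h (approx_unit theta e N) ⋅ theta e k k = theta e k k.
    have := congr1 (@cadj _ _) hN; rewrite cadjM -hJ (approx_unitJ st eu) (thetaJ mxt).
    by rewrite (unit_adj eu).
  have /choice[co hco] : forall p : nat * nat, exists b,
      theta e 0 0 ⋅ (w p.1 ⋅ theta a k l ⋅ (w p.2)^†) ⋅ theta e 0 0 = theta b 0 0.
    by move=> p; exact: (corner_range st eu).
  exists (\sum_(i < N) \sum_(j < N') theta (co (nat_of_ord i, nat_of_ord j)) i j).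
  (* Fullness encloses [theta a k l] between images of approximate units. Each [h (theta e p p)] is
     [(w p)^† ⋅ w p], up to the unit of the corner, so the enclosed element splits into images of
     entries at (p, q). *)
  have -> : theta a k l = h (approx_unit theta e N) ⋅ theta a k l ⋅ h (approx_unit theta e N').
    have -> : theta a k l = theta e k k ⋅ theta a k l ⋅ theta e l l.
      by rewrite (theta_unitl st eu) eqxx scale1r (theta_unitr st eu) eqxx scale1r.
    by rewrite !cmulA hNJ -(cmulA _ _ (h _)) hN'.
  rewrite (morphD_sum hD) /approx_unit !(morphD_sum hD) cmul_suml cmul_suml.
  apply: eq_bigr => p _; rewrite (morphD_sum hD) cmul_sumr; apply: eq_bigr => q _.
  by rewrite !hw -hco /= !cmulA.
exists (\sum_i c i *: x i) => //.
by rewrite (linear_comb hL); apply: eq_bigr => i _; rewrite hx.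
Qed.

End StableBijective.

Section PowerReps.
Variables (R : realType) (T : tensor_choice R) (V : finType) (A : V -> V -> nat).
Local Notation X := (graph_correspondence R A).
Local Notation pw k := (tensor_power T X k).
Local Notation el k x := (elementary_tensor T (X := X) k x).

Lemma power_frame k : exists (J : finType) (c : J -> pw k), is_frame c.
Proof.
elim: k => [|k [J [c fc]]]; first by exists (edge A), (@edge_vec R V A); exact: edge_frame.
exists (J * edge A)%type.
exists (fun p : J * edge A => tens (T (pw k) X) (c p.1) (edge_vec R p.2)).
exact: (tens_frame fc (@edge_frame R V A)).
Qed.

Lemma elementary_eq k (x y : nat -> X) :
  (forall i, (i <= k)%N -> x i = y i) -> el k x = el k y.
Proof.
elim: k => [|k IH] h /=; first exact: h.
by rewrite h// IH// => i ik; apply: h; exact: leqW.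
Qed.

Lemma power_ext k (F : zmodType) (f g : pw k -> F) :
  {morph f : x y / x + y} -> {morph g : x y / x + y} ->
  (forall x, f (el k x) = g (el k x)) -> f =1 g.
Proof.
elim: k f g => [|k IH] f g fD gD fg z; first exact: (fg (fun=> z)).
have [J [c fc]] := power_frame k.
move: z; apply: (tens_ext fc (@edge_frame R V A) fD gD) => x y.
move: x; apply: IH => [x1 x2|x1 x2|x].
- by rewrite (linear_morphD (tens_linearl _ _)) fD.
- by rewrite (linear_morphD (tens_linearl _ _)) gD.
pose x' i := if i == k.+1 then y else x i.
have := fg x'; rewrite /= {2 4}/x' eqxx.
rewrite (@elementary_eq k x' x)// => i ik.
by rewrite /x' ltn_eqF.
Qed.

Section Rep.
Variables (E : cstar_algebra R) (i0 : cfun_algebra R V -> E) (s0 : X -> E).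
Hypotheses (hi : is_star_hom i0) (hs : is_rep i0 i0 s0).
Hypothesis cs : frame_sum s0 (@edge_vec R V A) = i0 (cfun1 R V).

Fixpoint word k (x : nat -> X) : E :=
  if k is k'.+1 then word k' x ⋅ s0 (x k'.+1) else s0 (x 0%N).

Lemma word_shift k x : word k.+1 x = s0 (x 0%N) ⋅ word k (x \o succn).
Proof. by elim: k => [//|k IH]; rewrite [LHS]/= -/(word k.+1 x) IH cmulA. Qed.

(** The representation of a power multiplies the edge factors. Its range projection stays the unit
    of the corner, which iterates the relation at the vertices along words of length [k.+1]. *)
Lemma power_rep k : exists s : pw k -> E, [/\ is_rep i0 i0 s,
  forall x, s (el k x) = word k x
  & forall (J : finType) (c : J -> pw k), is_frame c -> frame_sum s c = i0 (cfun1 R V)].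
Proof.
elim: k => [|k [s [rs sE sc]]].
  exists s0; split=> // J c fc; rewrite -cs; case: hs => ms _.
  exact: (frame_sum_indep hi ms fc (@edge_frame R V A)).
have [J [c fc]] := power_frame k.
have fe := @edge_frame R V A.
have [s' [rs' sE' sc']] := tensor_rep (T (pw k) X) fc fe hi rs hs.
exists s'; split=> // [x|J' c' fc']; first by rewrite /= sE' sE.
rewrite -(sc _ _ fc) -(sc' cs); case: rs' => ms' _.
exact: (frame_sum_indep hi ms' fc' (tens_frame fc fe)).
Qed.

(** Tensors have become products in [E], so the iterated associativity isomorphism amounts to
    regrouping a word at its first letter. *)
Lemma power_assoc_rep k (a : T X (pw k) -> pw k.+1) (s : pw k -> E)
    (s' : pw k.+1 -> E) :
  is_power_assoc (k := k) a -> {morph s : x y / x + y} -> {morph s' : x y / x + y} ->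
  (forall x, s (el k x) = word k x) ->
  (forall x, s' (el k.+1 x) = word k.+1 x) ->
  forall x z, s' (a (tens (T X (pw k)) x z)) = s0 x ⋅ s z.
Proof.
move=> [ua aE] sD sD' sE sE' x; apply: power_ext => [y z|y z|y].
- by rewrite (linear_morphD (tens_linearr _ _)) (unitaryD ua) sD'.
- by rewrite sD cmulDr.
pose x' i := if i is j.+1 then y j else x.
have := aE x'; rewrite [x' 0%N]/= (_ : x' \o succn = y)// => ->.
by rewrite sE' word_shift sE.
Qed.

End Rep.
End PowerReps.

(** * The composite of the two induced homomorphisms *)

Section Composite.
Variables (R : realType) (T : tensor_choice R) (V W : finType).
Variables (A : V -> V -> nat) (B : W -> W -> nat).
Variables (CA : graph_algebra R A) (CB : graph_algebra R B).
Variables (EA EB : cstar_algebra R).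
Variables (thA : CA -> nat -> nat -> EA) (thB : CB -> nat -> nat -> EB).
Hypotheses (stA : stable_system thA) (stB : stable_system thB).
Local Notation X := (graph_correspondence R A).
Local Notation Y := (graph_correspondence R B).
Variable M : correspondence (cfun_algebra R V) (cfun_algebra R W).
Variable N : correspondence (cfun_algebra R W) (cfun_algebra R V).
Variables (PhiM : T X M -> T M Y) (PhiN : T Y N -> T N X) (k : nat).
Variable psi : T M N -> tensor_power T X k.
Hypothesis upsi : Defs.is_unitary psi.
Hypothesis al : alignment PhiM PhiN psi.
Variables (I J : finType) (b : I -> M) (c : J -> N).
Hypotheses (fb : is_frame b) (fc : is_frame c).
Variables (f : EA -> EB) (m : nat -> M -> EB) (h : nat -> T M Y -> EB).
Variables (g : EB -> EA) (n : nat -> N -> EA) (h' : nat -> T N X -> EA).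
Hypothesis impf : implements thA thB PhiM f m h.
Hypothesis impg : implements thB thA PhiN g n h'.
Local Notation "x ⊙ y" := (tens (T _ _) x y) (at level 40, left associativity).
Local Notation iA := (vertex_rep (vertex_proj CA)).
Local Notation sA := (edge_rep (edge_isom CA)).
Local Notation oA := (graph_one CA).
Local Notation oB := (graph_one CB).
Local Notation i0A := (corner_rep thA).
Local Notation i0B := (corner_rep thB).
Local Notation s0A := (corner_edge_rep thA).

Let mxA : mx_system thA. Proof. by case: stA. Qed.
Let mxB : mx_system thB. Proof. by case: stB. Qed.
Let hi : is_star_hom i0A. Proof. exact: corner_rep_star_hom. Qed.
Let hf : is_star_hom f. Proof. exact: imp_star_hom impf. Qed.
Let hg : is_star_hom g. Proof. exact: imp_star_hom impg. Qed.
Let gD : {morph g : x y / x + y}. Proof. by case: hg => /linear_morphD. Qed.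
Let gM : {morph g : x y / x ⋅ y}. Proof. by case: hg. Qed.
Let gJ : {morph g : x / x^† }. Proof. by case: hg. Qed.

Variable s : tensor_power T X k -> EA.
Hypothesis rs : is_rep i0A i0A s.
Hypothesis sel : forall x, s (elementary_tensor T (X := X) k x) = word s0A k x.
Hypothesis cs : forall (L : finType) (d : L -> tensor_power T X k), is_frame d ->
  frame_sum s d = i0A (cfun1 R V).

(** The i-th copy of M ⊗ N. Copy 0 of [N] is the right partner, because the inner products of the
    columns [m i] lie in the corner (0, 0) of EB. *)
Definition pair_rep i x y : EA := g (m i x) ⋅ n 0 y.

Lemma corner_mul_n a y : g (i0B a) ⋅ n 0 y = n 0 (lact a y).
Proof. exact: (imp_vertex impg). Qed.

Lemma pair_rep_inner i j x y x' y' :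
  (pair_rep i x y)^† ⋅ pair_rep j x' y' = (i == j)%:R *: i0A (inner (x ⊙ y) (x' ⊙ y')).
Proof.
rewrite cadjM cmulA -(cmulA _ (g (m i x))^†) -gJ -gM (imp_inner impf).
case: hg => gL _ _; rewrite (linear_morphZ gL) cmulZr cmulZl -cmulA corner_mul_n.
by rewrite (imp_inner impg) eqxx scale1r tens_inner.
Qed.

Lemma pair_rep_frame i x y : pair_rep i x y =
  \sum_(p : I * J) pair_rep i (b p.1) (c p.2) ⋅ i0A (inner (b p.1 ⊙ c p.2) (x ⊙ y)).
Proof.
rewrite -(pair_bigA _ (fun k l => pair_rep i (b k) (c l) ⋅
  i0A (inner (b k ⊙ c l) (x ⊙ y)))) /= {1}/pair_rep.
rewrite (mrep_frame (imp_mrep impf i) x fb) (morphD_sum gD) cmul_suml.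
apply: eq_bigr => p _; rewrite gM -cmulA corner_mul_n.
rewrite (mrep_frame (imp_mrep impg 0) (lact _ _) fc) cmul_sumr.
by apply: eq_bigr => q _; rewrite /pair_rep tens_inner cmulA.
Qed.

Let q (p : I * J) : tensor_power T X k := psi (b p.1 ⊙ c p.2).

Let fq : is_frame q.
Proof. exact: (unitary_frame upsi (tens_frame (Z := T M N) fb fc)). Qed.

Let psi_inner x y : inner (psi x) (psi y) = inner x y.
Proof. by case: upsi. Qed.

(** The partial isometry that carries copy i of M ⊗ N through [psi] onto the power of X, whose range
    projection is the unit of the corner (0, 0). *)
Definition comp_row i : EA := \sum_p s (q p) ⋅ (pair_rep i (b p.1) (c p.2))^†.
Local Notation w := comp_row.

Lemma comp_row_pair i j x y : w i ⋅ pair_rep j x y = (i == j)%:R *: s (psi (x ⊙ y)).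
Proof.
case: rs => ms _; rewrite (mrep_frame ms (psi _) fq) cmul_suml scaler_sumr.
by apply: eq_bigr => p _; rewrite -cmulA pair_rep_inner cmulZr psi_inner.
Qed.

Lemma comp_row_mul i j : w i ⋅ (w j)^† = (i == j)%:R *: thA oA 0 0.
Proof.
rewrite -corner_rep_cfun1 -(cs fq) [X in _ ⋅ X]cadj_sum cmul_sumr scaler_sumr.
apply: eq_bigr => p _; rewrite cadjM cadjK cmulA comp_row_pair cmulZl.
by [].
Qed.

Lemma comp_rowJ i x y : (w i)^† ⋅ s (psi (x ⊙ y)) = pair_rep i x y.
Proof.
case: rs => [[_ _ sI] _]; rewrite cadj_sum cmul_suml [RHS]pair_rep_frame.
by apply: eq_bigr => p _; rewrite cadjM cadjK -cmulA sI psi_inner.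
Qed.

Lemma comp_rowJM i : (w i)^† ⋅ w i = g (f (thA oA i i)).
Proof.
rewrite -(imp_frame impf i fb) [in LHS]/comp_row cmul_sumr.
transitivity (\sum_(p : I * J)
    pair_rep i (b p.1) (c p.2) ⋅ (pair_rep i (b p.1) (c p.2))^†).
  by apply: eq_bigr => p _; rewrite cmulA comp_rowJ.
rewrite -(pair_bigA _ (fun k l => pair_rep i (b k) (c l) ⋅ (pair_rep i (b k) (c l))^†)) /=.
rewrite (morphD_sum gD); apply: eq_bigr => p _; rewrite gM gJ.
rewrite /pair_rep; under eq_bigr do rewrite cadjM !cmulA.
rewrite -cmul_suml; congr (_ ⋅ _); under eq_bigr do rewrite -cmulA.
rewrite -cmul_sumr -/(frame_sum (n 0) c) (imp_frame impg 0 fc) -gM; congr g.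
have [_ mR _] := imp_mrep impf i.
by rewrite -corner_rep_cfun1 -mR ract_cfun1.
Qed.

(** Alignment enters here. Applying [f] and then [g] to an edge follows one side of the diagram,
    through [PhiM] and [PhiN]; letting x multiply the word of psi (y ⊗ z) follows the other side. *)
Lemma comp_edge x i j y z :
  g (f (thA (sA x) i j)) ⋅ pair_rep j y z = (w i)^† ⋅ s0A x ⋅ s (psi (y ⊙ z)).
Proof.
have [phiM_id [id_phiN [psi_id [id_psi [aMYN [aMNX [aXMN [aX [H1 H2 eqn]]]]]]]]] := al.
have [[u1 e1] [u2 e2] [u3 e3] [u4 e4]] := H1.
have [[v1 d1] [v2 d2] [v3 d3] hX] := H2.
have fe := @edge_frame R V A; have feB := @edge_frame R W B.
have hs0 := corner_edge_rep_rep stA.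
have [s' [rs' sE' _]] := tensor_rep (T (tensor_power T X k) X) fq fe hi rs hs0.
have s'D := mrepD rs'.1.
(* What the last two arrows of the diagram, [aMNX] and [psi_id], become in EA. *)
have c1 y' t : g (m i y') ⋅ h' 0 t = (w i)^† ⋅ s' (psi_id (aMNX (y' ⊙ t))).
  move: t; apply: (tens_ext fc fe) => [t1 t2|t1 t2|z' x'].
  - by rewrite (imp_tensD impg) cmulDr.
  - by rewrite tensDr (unitaryD v2) (unitaryD u3) s'D cmulDr.
  - by rewrite (imp_tens impg) cmulA d2 e3 sE' cmulA comp_rowJ.
(* The preceding identity extended backwards across [PhiN], whose effect is that of [g] on an edge
   of G_B. *)
have c2 t : g (h i t) ⋅ n 0 z = (w i)^† ⋅ s' (psi_id (aMNX (id_phiN (aMYN (t ⊙ z))))).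
  move: t; apply: (tens_ext fb feB) => [t1 t2|t1 t2|y' x'].
  - by rewrite (imp_tensD impf) gD cmulDl.
  - by rewrite tensDl (unitaryD v1) (unitaryD u2) (unitaryD v2) (unitaryD u3) s'D cmulDr.
  - by rewrite (imp_tens impf) gM -cmulA (imp_edge impg) d1 e2 c1.
rewrite cmulA -gM (imp_edge impf) c2 -(e1 (x ⊙ y) z).
have /= -> := eqn ((x ⊙ y) ⊙ z).
rewrite d3 e4 (power_assoc_rep hX (mrepD rs.1) s'D sel) ?cmulA// => x'.
by rewrite /= sE' sel.
Qed.

Lemma comp_vertex a i j y z :
  g (f (thA (iA a) i j)) ⋅ pair_rep j y z = (w i)^† ⋅ i0A a ⋅ s (psi (y ⊙ z)).
Proof.
have [_ ul _ _ _] := upsi; case: rs => _ sl.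
by rewrite cmulA -gM (imp_vertex impf) -cmulA -sl -ul tens_lact comp_rowJ.
Qed.

Lemma comp_implemented d i j : (exists a, d = iA a) \/ (exists x, d = sA x) ->
  g (f (thA d i j)) = (w i)^† ⋅ thA d 0 0 ⋅ w j.
Proof.
move=> hd; have uA := graph_one_unit stA.
have key y z : g (f (thA d i j)) ⋅ pair_rep j y z =
    (w i)^† ⋅ thA d 0 0 ⋅ s (psi (y ⊙ z)).
  by case: hd => [[a ->]|[x ->]]; [exact: comp_vertex|exact: comp_edge].
have [_ fM _] := hf.
(* The unit at (j, j) is sent to [(w j)^† ⋅ w j], and [(w j)^†] is built from values of
   [pair_rep j], on which the left side is already known. *)
have -> : thA d i j = thA d i j ⋅ thA oA j j by rewrite (thetaMe mxA) (uA d).2.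
rewrite fM gM -comp_rowJM cmulA; congr (_ ⋅ _).
rewrite /comp_row [in LHS]cadj_sum cmul_sumr.
transitivity ((w i)^† ⋅ thA d 0 0 ⋅ frame_sum s q).
  by rewrite cmul_sumr; apply: eq_bigr => p _; rewrite cadjM cadjK cmulA key cmulA.
by rewrite (cs fq) corner_rep_cfun1 -cmulA (thetaMe mxA) (uA d).2.
Qed.

(** The implementing formula is known on generators. Its right side is itself a matrix system
    because the rows are orthonormal, so it extends to a homomorphism, and uniqueness identifies
    that with g ∘ f. *)
Lemma composite_bijective : bijective (g \o f).
Proof.
have uA := graph_one_unit stA; have uB := graph_one_unit stB.
have hgf : is_star_hom (fun x => g (f x)) := is_star_hom_comp hg hf.
pose th' d i j := (w i)^† ⋅ thA d 0 0 ⋅ w j.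
have wu i : thA oA 0 0 ⋅ w i = w i.
  rewrite -corner_rep_cfun1 cmul_sumr; apply: eq_bigr => p _; rewrite cmulA.
  have [_ sl] := rs; rewrite -sl; congr (s _ ⋅ _); exact: lact_cfun1.
have mx' : mx_system th'.
  split.
  - move=> i j z x y; rewrite /th' (thetaD mxA) (thetaZ mxA).
    by rewrite cmulDr cmulDl cmulZr cmulZl.
  - move=> d i j d' i' j'; rewrite /th' !cmulA -(cmulA _ (w j)) comp_row_mul.
    rewrite cmulZr !cmulZl -(cmulA _ (thA d 0 0)) (thetaMe mxA) (uA d).2.
    by rewrite -(cmulA _ (thA d 0 0)) (thetaMe mxA).
  - by move=> d i j; rewrite /th' !cadjM cadjK (thetaJ mxA) cmulA.
have [F [hF FE]] := stable_extension stA uA mx'.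
have gfE d i j : g (f (thA d i j)) = (w i)^† ⋅ thA d 0 0 ⋅ w j.
  rewrite -[RHS]FE.
  apply: (stable_star_hom_eq stA (@graph_generated _ _ _ CA) hgf hF) => {i j}{}d.
  move=> hd i j; rewrite FE; apply: comp_implemented.
  case: hd => [[v _ <-]|[e _ <-]]; [left; exists (cdelta R v)|right; exists (edge_vec R e)].
    by rewrite vertex_rep_cdelta.
  by rewrite edge_rep_vec.
apply: (implemented_bijective stA uA hgf comp_row_mul gfE) => l.
(* Row l of EA is covered by the images of L rows of EB, and row i of EB by the images of [K i] rows
   of EA; the largest [K i] serves all i below L. *)
have [L hL] := imp_full impg l.
have /choice[K hK] := imp_full impf.
exists (\max_(i < L) K i).
have mono i : (i < L)%N ->
    thB oB i i ⋅ f (approx_unit thA oA (\max_(i < L) K i)) = thB oB i i.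
  move=> iL; have le : (K i <= \max_(i < L) K i)%N by exact: (leq_bigmax (Ordinal iL)).
  have [_ fM _] := hf.
  rewrite -{1}(hK i) -cmulA -fM (approx_unitM stA uA).
  by rewrite (minn_idPl le).
rewrite -{1}hL -cmulA -gM -[RHS]hL; congr (_ ⋅ g _).
rewrite {1}/approx_unit cmul_suml; apply: eq_bigr => i _.
exact: mono.
Qed.

End Composite.

(** * Finiteness of M and N *)

Section EssentialPowers.
Variables (R : realType) (T : tensor_choice R) (V : finType) (A : V -> V -> nat).
Hypothesis essA : essential A.
Local Notation X := (graph_correspondence R A).
Local Notation pw k := (tensor_power T X k).

Lemma edge_ex v w : A v w != 0%N -> exists e : edge A, edge_source e = v /\ edge_range e = w.
Proof.
rewrite -lt0n => h.
by exists (existT (fun p : V * V => 'I_(A p.1 p.2)) (v, w) (Ordinal h)).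
Qed.

Lemma edge_from v : exists e : edge A, edge_source e = v.
Proof. by have [w /edge_ex[e [h _]]] := essA.1 v; exists e. Qed.

Lemma edge_to w : exists e : edge A, edge_range e = w.
Proof. by have [v /edge_ex[e [_ h]]] := essA.2 w; exists e. Qed.

Lemma inner_lact_edge a (e : edge A) :
  inner (edge_vec R e) (lact a (edge_vec R e)) =
  ev a (edge_source e) *: cdelta R (edge_range e).
Proof. by rewrite lact_edge_vec innerZr inner_edge_vec edge_ev_vec eqxx scale1r. Qed.

Lemma tens_edge_neq0 k (x : pw k) (e : edge A) :
  ev (inner x x) (edge_source e) != 0 ->
  ev (inner (tens (T (pw k) X) x (edge_vec R e)) (tens (T (pw k) X) x (edge_vec R e)))
    (edge_range e) != 0.
Proof. by rewrite tens_inner inner_lact_edge evZ ev_cdelta eqxx mulr1. Qed.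

(** As no row of A is zero, a path starting at v can always be prolonged. *)
Lemma power_left k v : exists (z : pw k) u,
  ev (inner (lact (cdelta R v) z) (lact (cdelta R v) z)) u != 0.
Proof.
elim: k => [|k [z [u zu]]].
  have [e ev] := edge_from v; exists (edge_vec R e), (edge_range e).
  rewrite inner_lactr -lactM cdelta_adj cdelta_mul eqxx scale1r.
  rewrite lact_adj cdelta_adj inner_lact_edge evZ !ev_cdelta ev !eqxx mulr1.
  exact: oner_neq0.
have [e eu] := edge_from u; exists (tens (T (pw k) X) z (edge_vec R e)), (edge_range e).
by rewrite tens_lact; apply: tens_edge_neq0; rewrite eu.
Qed.

(** As no column of A is zero, a path ending at w can always be prolonged backwards. *)
Lemma power_right k w : exists z : pw k, ev (inner z z) w != 0.
Proof.
elim: k w => [|k IH] w; have [e ew] := edge_to w.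
  exists (edge_vec R e); rewrite inner_edge_vec edge_ev_vec eqxx scale1r ev_cdelta ew eqxx.
  exact: oner_neq0.
have [z zu] := IH (edge_source e); exists (tens (T (pw k) X) z (edge_vec R e)).
by rewrite -ew; exact: tens_edge_neq0.
Qed.

End EssentialPowers.

Section FiniteBasis.
Variables (R : realType) (V W U : finType).
Variables (M : correspondence (cfun_algebra R V) (cfun_algebra R W)).
Variables (N : correspondence (cfun_algebra R W) (cfun_algebra R U)).
Variables (MN : interior_tensor M N).
Variable Z : correspondence (cfun_algebra R V) (cfun_algebra R U).
Variable psi : MN -> Z.
Hypothesis upsi : Defs.is_unitary psi.
Local Notation "x ⊙ y" := (tens MN x y) (at level 40).

Let dS : nrm_dense (lin_span [set x ⊙ y | x in setT & y in setT]).
Proof. by apply/dense_nrmP; exact: (@tens_dense _ _ _ _ _ _ MN). Qed.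

(** If the projection at v killed [M], it would kill the elementary tensors, hence M ⊗ N and its
    unitary image. *)
Lemma left_factor_neq0 v : (exists z u,
    ev (inner (lact (cdelta R v) z) (lact (cdelta R v) z : Z)) u != 0) ->
  exists x : M, lact (cdelta R v) x <> 0.
Proof.
move=> [z [u]]; have [uL ul _ _ us] := upsi; have [t <-] := us z => hz.
apply: contrapT => h.
have h0 (x : M) : lact (cdelta R v) x = 0.
  by apply: contrapT => h'; apply: h; exists x.
suff t0 : lact (cdelta R v) t = 0.
  by move: hz; rewrite -ul t0 (morphD0 (linear_morphD uL)) inner0l ev0 eqxx.
apply: inner_ext => y; rewrite inner0r inner_lactr.
apply: (badd_dense_eq (inner_badd _) (badd_0 _ _) dS) => c _ [x _ [x' _ <-]].
rewrite innerZr -inner_lactr tens_lact h0.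
by rewrite (morphD0 (tensDl MN x')) inner0r scaler0.
Qed.

Lemma right_factor_neq0 u : (exists z : Z, ev (inner z z) u != 0) ->
  exists y : N, ract y (cdelta R u) <> 0.
Proof.
move=> [z]; have [uL _ uR uI us] := upsi; have [t <-] := us z; rewrite uI => hz.
apply: contrapT => h.
have h0 (y : N) : ract y (cdelta R u) = 0.
  by apply: contrapT => h'; apply: h; exists y.
suff t0 : ract t (cdelta R u) = 0.
  have := congr1 (inner t) t0; rewrite inner_ract inner0r => /(congr1 (fun a => ev a u)).
  by rewrite evM ev_cdelta eqxx mulr1 ev0 => tu; move: hz; rewrite tu eqxx.
apply: (badd_dense_eq (badd_ract MN (cdelta R u)) (badd_0 MN MN) dS).
move=> c _ [x _ [y _ <-]]; by rewrite ractZl tens_ract h0 (morphD0 (tensDr MN x)) scaler0.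
Qed.

(** Pairing [b i] with a unit vector of [N] fixed by the projection at [r i] preserves norms, and
    orthogonality holds already in [M]. The orthonormal family obtained in [Z] is bounded in size by
    the frame of [Z]. *)
Lemma left_factor_basis (L : finType) (d : L -> Z) : is_frame d ->
  (forall w, exists y : N, lact (cdelta R w) y <> 0) ->
  exists n (b : 'I_n -> M) (r : 'I_n -> W), is_orthonormal b r /\ is_frame b.
Proof.
move=> fd hN; apply: (@orthonormal_basis_ex _ _ _ #|{: L * U}|) => n b r ob.
have /choice[y hy] : forall w, exists p : N * U,
    lact (cdelta R w) p.1 = p.1 /\ inner p.1 p.1 = cdelta R p.2.
  move=> w; have [y y0] := hN w.
  have [u hu] : exists u, ev (inner (lact (cdelta R w) y) (lact (cdelta R w) y)) u != 0.
    apply: contrapT => h; apply: y0; apply: inner_eq0; apply: ev_ext => u.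
    by rewrite ev0; apply/eqP/negPn/negP => h'; apply: h; exists u.
  have [c hc] := normalize_ex hu.
  exists (c *: ract (lact (cdelta R w) y) (cdelta R u), u); split=> //=.
  by rewrite lactZr lact_ract -lactM cdelta_mul eqxx scale1r.
apply: (@orthonormal_bound _ _ Z L d n (fun i => psi (b i ⊙ (y (r i)).1))
  (fun i => (y (r i)).2)) => // i j.
have [_ _ _ uI _] := upsi.
rewrite uI tens_inner ob lactZl innerZr; case: eqVneq => [<-|]; last by rewrite !scale0r.
by have [-> ->] := hy (r i).
Qed.

End FiniteBasis.

Lemma basis_range_surj (R : realType) (V W : finType)
    (M : correspondence (cfun_algebra R V) (cfun_algebra R W))
    (I : finType) (b : I -> M) (r : I -> W) w :
  is_orthonormal b r -> is_frame b -> (exists x : M, ract x (cdelta R w) <> 0) ->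
  exists i, r i = w.
Proof.
move=> ob fb [x x0]; apply: contrapT => h; apply: x0.
rewrite (fb x) ract_suml big1// => i _.
rewrite -ractM (inner_basis_cdelta ob) cfun_mulC cmulA cdelta_mul.
by case: eqVneq => [e|_]; [case: h; exists i|rewrite scale0r cmul0l ract0r].
Qed.

Lemma bijective_of_composites (S S' : Type) (f : S -> S') (g : S' -> S) :
  bijective (g \o f) -> bijective (f \o g) -> bijective f.
Proof.
move=> [p gf _] [q _ fg]; exists (p \o g) => [x|y]; first exact: gf.
by rewrite -[y]fg /=; congr f; exact: gf.
Qed.

Theorem theorem6p3 (R : realType) (V W : finType)
    (A : V -> V -> nat) (B : W -> W -> nat)
    (essA : essential A) (essB : essential B)
    (H : hilbert_space R) (sepH : separable H) (infH : infinite_dimensional H)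
    (K : compact_operators H)
    (CA : graph_algebra R A) (CB : graph_algebra R B)
    (CAK : stabilization CA K) (CBK : stabilization CB K) :
  aligned_shift_equivalent (graph_correspondence R A)
    (graph_correspondence R B) ->
  equivariantly_isomorphic CAK CBK.
Proof.
move=> [T [k [s [alX alY]]]].
have [u mu] := compact_matrix_units K sepH infH.
have stab (V' : finType) (A' : V' -> V' -> nat) (D : graph_algebra R A')
    (E : stabilization D K) : stable_system (tensor_theta E u).
  apply: (@tensor_stable_system _ _ _ E u mu (graph_one D)).
  apply: graph_algebra_unit => a.
  by apply: (sum_adj_mul_eq0 (tensor_mx_system E mu)); exact: tensor_theta_inj.
have stA := stab _ _ _ CAK; have stB := stab _ _ _ CBK.
have [LA [dA fA]] := power_frame T A k; have [LB [dB fB]] := power_frame T B k.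
have uX := PsiX_unitary s; have uY := PsiY_unitary s.
(* Finiteness of [M] comes from M ⊗ N inside a power of X(A); that [N] is nonzero from the left at
   each vertex of B comes from N ⊗ M inside a power of X(B). *)
have [nM [bM [rM [oM fM]]]] := left_factor_basis uX fA
  (fun w => left_factor_neq0 uY (power_left T essB k w)).
have [nN [bN [rN [oN fN]]]] := left_factor_basis uY fB
  (fun v => left_factor_neq0 uX (power_left T essA k v)).
(* On the right, each vertex of B must occur in [M], because [M] is the right factor of N ⊗ M. *)
have sM w := basis_range_surj oM fM (right_factor_neq0 uY (power_right T essB k w)).
have sN v := basis_range_surj oN fN (right_factor_neq0 uX (power_right T essA k v)).
have [f [h [impf eqf]]] := induced_ex stA stB (PhiM_unitary s) oM fM sM.
have [g [h' [impg _]]] := induced_ex stB stA (PhiN_unitary s) oN fN sN.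
have bij (V' : finType) (A' : V' -> V' -> nat) (D : graph_algebra R A')
    (E : stabilization D K) (st : stable_system (tensor_theta E u)) :=
  power_rep T (corner_rep_star_hom st) (corner_edge_rep_rep st) (corner_edge_frame_sum st) k.
have [sA [rsA sAE sAc]] := bij _ _ _ CAK stA.
have [sB [rsB sBE sBc]] := bij _ _ _ CBK stB.
exists f; split.
- exact: imp_star_hom impf.
(* Each alignment relation governs one composite: the one for X gives g ∘ f, the one for Y gives f ∘
   g. *)
- apply: (bijective_of_composites (g := g)).
    exact: (composite_bijective stA stB uX alX fM fN impf impg rsA sAE sAc).
  exact: (composite_bijective stB stA uY alY fN fM impg impf rsB sBE sBc).
move=> z z1; have [hGA GAE] := stab_gaugeP CAK z1; have [hGB GBE] := stab_gaugeP CBK z1.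
have [_ gAv gAe] := gaugeP CA z1; have [_ gBv gBe] := gaugeP CB z1.
apply: (eqf z (gauge z) (gauge z)) => // d i j; [exact: GAE|exact: GBE].
Qed.
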